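(* Let $k$ be an algebraically closed field. For every integer $n$ with $1\le n\le 19$, a set of $n$ general points in $\mathbb{P}^3_k$ is glicci.
   Context: ''A general $X$ has property $Y$'' means that there is a nonempty Zariski open subset of the family of all $X$'s having property $Y$; here the $X$'s are the reduced sets of $n$ points of $\mathbb{P}^3$. A closed subscheme of $\mathbb{P}^m$ is arithmetically Gorenstein (AG) if its homogeneous coordinate ring is Gorenstein. Let $V_1,V_2\subseteq\mathbb{P}^m$ be equidimensional closed subschemes of the same dimension $r$ without embedded components. They are linked by an AG scheme $X$ if $X$ is an AG scheme of dimension $r$ containing $V_1,V_2$ with $\mathcal{I}_{V_2,X}\cong\mathcal{H}om(\mathcal{O}_{V_1},\mathcal{O}_X)$ and $\mathcal{I}_{V_1,X}\cong\mathcal{H}om(\mathcal{O}_{V_2},\mathcal{O}_X)$. The equivalence relation generated by such links is Gorenstein liaison ($G$-liaison). A scheme is glicci if it is in the $G$-liaison class of a complete intersection. *)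

(* Defs.v *)
From HB Require Import structures.
From Stdlib Require Import Relation_Operators.
From mathcomp Require Import all_boot all_order all_algebra.
From mathcomp Require Import perm fraction.
From mathcomp.multinomials Require Import mpoly.

Set Implicit Arguments.
Unset Strict Implicit.
Unset Printing Implicit Defensive.

Import GRing.Theory.
Local Open Scope ring_scope.

(** * Commutative algebra: Gorenstein rings *)

Section CommutativeAlgebra.
Variable A : comNzRingType.
Implicit Types I P : A -> Prop.

Definition sub_ideal I P := forall x, I x -> P x.

Definition is_ideal I :=
  [/\ I 0, forall x y, I x -> I y -> I (x + y) & forall a x, I x -> I (a * x)].

Definition is_prime P :=
  [/\ is_ideal P, ~ P 1 & forall x y, P (x * y) -> P x \/ P y].

Definition is_maximal P :=
  [/\ is_ideal P, ~ P 1 &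
      forall I, is_ideal I -> ~ I 1 -> sub_ideal P I -> sub_ideal I P].

Definition generated (r : nat) (g : 'I_r -> A) : A -> Prop :=
  fun x => exists c : 'I_r -> A, x = \sum_(i < r) c i * g i.

Definition noetherian :=
  forall I, is_ideal I ->
    exists r, exists g : 'I_r -> A, forall x, I x <-> generated g x.

Definition injective_module (E : lmodType A) :=
  forall (M N : lmodType A) (i : {linear M -> N}) (g : {linear M -> E}),
    injective i -> exists h : {linear N -> E}, forall x, h (i x) = g x.

(* A has a finite injective resolution
   0 -> A -> E 0 -> E 1 -> ... -> E n -> 0 as a module over itself. *)
Definition finite_injective_dimension :=
  exists (n : nat) (E : nat -> lmodType A)
         (eps : {linear A^o -> E 0%N})
         (d : forall i, {linear E i -> E i.+1}),
    [/\ forall i, injective_module (E i),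
        injective eps,
        forall x, d 0%N x = 0 <-> exists a, x = eps a,
        forall i x, d i.+1 x = 0 <-> exists y, x = d i y &
        forall i (x : E i), (n < i)%N -> x = 0].

(* phi : A -> L exhibits L as the localization of A at the prime P. *)
Definition is_localization_at P (L : comNzRingType) (phi : {rmorphism A -> L}) :=
  [/\ forall s, ~ P s -> exists u, phi s * u = 1,
      forall z, exists a s, ~ P s /\ phi s * z = phi a &
      forall a, phi a = 0 <-> exists s, ~ P s /\ s * a = 0].

End CommutativeAlgebra.

(* A Noetherian ring is Gorenstein when its localization at each maximal ideal
   has finite injective dimension over itself.  Localizations being unique up
   to isomorphism, the choice of the model L is immaterial. *)
Definition gorenstein (A : comNzRingType) :=
  noetherian A /\
  forall P : A -> Prop, is_maximal P ->
    exists (L : comNzRingType) (phi : {rmorphism A -> L}),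
      is_localization_at P phi /\ finite_injective_dimension L.

(** * Closed subschemes of projective space *)

(* A closed subscheme V of P^m is represented by its saturated homogeneous
   ideal I_V in S = k[x_0, ..., x_m]; a point of the scheme P^m is a
   homogeneous prime ideal that does not contain (x_0, ..., x_m). *)

Section ProjectiveSchemes.
Variables (k : closedFieldType) (m : nat).
Local Notation S := {mpoly k[m.+1]}.
Local Notation K := {fraction S}.
Local Notation "x %:F" := (@FracField.tofrac S x).
Implicit Types (I P V : S -> Prop) (f g : S) (r : nat).

Definition homogeneous (d : nat) f := f \is d.-homog for (@mdeg m.+1).

Definition homogeneous_ideal I :=
  is_ideal I /\ forall d f, I f -> I (pihomog (@mdeg m.+1) d f).

Definition saturated I :=
  forall f, (exists N, forall g, homogeneous N g -> I (g * f)) -> I f.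

Definition closed_subscheme I := homogeneous_ideal I /\ saturated I.

Definition scheme_point P :=
  [/\ homogeneous_ideal P, is_prime P & exists i, ~ P 'X_i].

(* A chain of r + 1 points of V, each a strict specialization of the
   preceding one. *)
Definition has_chain V r :=
  exists P : nat -> S -> Prop,
    (forall i, (i <= r)%N -> scheme_point (P i) /\ sub_ideal V (P i)) /\
    (forall i, (i < r)%N -> sub_ideal (P i) (P i.+1) /\
                            ~ sub_ideal (P i.+1) (P i)).

(* The dimension of V as a topological space; in particular V is nonempty. *)
Definition dimension V r := has_chain V r /\ ~ has_chain V r.+1.

(* The generic points of the irreducible components of V. *)
Definition component V P :=
  [/\ scheme_point P, sub_ideal V P &
      forall Q, scheme_point Q -> sub_ideal V Q -> sub_ideal Q P ->
        sub_ideal P Q].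

Definition equidimensional V r :=
  dimension V r /\ forall P, component V P -> dimension P r.

Definition associated_point V P :=
  scheme_point P /\
  exists d f, homogeneous d f /\ forall g, P g <-> V (g * f).

Definition no_embedded_components V :=
  forall P, associated_point V P -> component V P.

(* The homogeneous coordinate ring S / I_V, up to isomorphism. *)
Definition is_coordinate_ring V (A : comNzRingType) (pi : {rmorphism S -> A}) :=
  (forall a, exists f, pi f = a) /\ (forall f, pi f = 0 <-> V f).

Definition arithmetically_gorenstein V :=
  closed_subscheme V /\
  exists (A : comNzRingType) (pi : {rmorphism S -> A}),
    is_coordinate_ring V pi /\ gorenstein A.

Definition complete_intersection r V :=
  [/\ closed_subscheme V, dimension V r &
      exists F : 'I_(m - r) -> S,
        (forall i, exists d, homogeneous d (F i)) /\
        (forall f, V f <-> generated F f)].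

(** ** The sheaves I_{V,X} and Hom(O_V, O_X) *)

(* Both sheaves are coherent on P^m, so they are determined by their sections
   over the affine opens D_+(f), f homogeneous of positive degree.  All the
   sections of O_{P^m} and of its ideal sheaves are viewed inside K = Frac S,
   where restriction maps become inclusions; sections of O_X are elements of
   K modulo the sections of I_X. *)

Definition degree f := (msize f).-1.

Definition basic_open f :=
  [/\ f != 0, (0 < degree f)%N & homogeneous (degree f) f].

(* D_+(g) is contained in D_+(f). *)
Definition basic_open_sub g f := forall P, scheme_point P -> P f -> P g.

(* Sections over D_+(f) of the ideal sheaf of V. *)
Definition ideal_sections f V (x : K) :=
  exists e a, [/\ homogeneous (e * degree f) a, V a & x = a%:F / f%:F ^+ e].

Definition regular_sections f (x : K) := ideal_sections f (fun=> True) x.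

(* h represents an element of Hom(O_V, O_X)(D_+(f)), that is a linear map
   R/I -> R/J where R, I, J are the sections over D_+(f) of O_{P^m}, I_V, I_X.
   Only the values of h on R modulo J are relevant. *)
Definition represents_hom f V X (h : K -> K) :=
  [/\ forall y, regular_sections f y -> regular_sections f (h y),
      forall y, ideal_sections f V y -> ideal_sections f X (h y) &
      forall a y z, regular_sections f a -> regular_sections f y ->
        regular_sections f z ->
        ideal_sections f X (h (a * y + z) - (a * h y + h z))].

Definition same_hom f X (h h' : K -> K) :=
  forall y, regular_sections f y -> ideal_sections f X (h y - h' y).

(* phi represents an isomorphism of O_X-modules I_{W,X} -> Hom(O_V, O_X):
   for x in I_W(D_+(f)), phi f x represents the image over D_+(f) of the class
   of x modulo I_X. *)
Definition represents_sheaf_iso V W X (phi : S -> K -> K -> K) :=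
  (forall f, basic_open f ->
     [/\ forall x, ideal_sections f W x -> represents_hom f V X (phi f x),
         forall a x y, regular_sections f a -> ideal_sections f W x ->
           ideal_sections f W y ->
           same_hom f X (phi f (a * x + y))
                        (fun z => a * phi f x z + phi f y z),
         forall x, ideal_sections f W x ->
           (same_hom f X (phi f x) (fun=> 0) <-> ideal_sections f X x) &
         forall h, represents_hom f V X h ->
           exists2 x, ideal_sections f W x & same_hom f X (phi f x) h]) /\
  (forall f g, basic_open f -> basic_open g -> basic_open_sub g f ->
     forall x y, ideal_sections f W x -> regular_sections f y ->
       ideal_sections g X (phi g x y - phi f x y)).

Definition ideal_sheaf_iso_hom V W X :=
  exists phi, represents_sheaf_iso V W X phi.

(** ** Gorenstein liaison *)

Definition liaison_scheme r V :=
  [/\ closed_subscheme V, equidimensional V r & no_embedded_components V].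

Definition linked_by r X V1 V2 :=
  [/\ arithmetically_gorenstein X /\ dimension X r,
      sub_ideal X V1 /\ sub_ideal X V2,
      ideal_sheaf_iso_hom V1 V2 X &
      ideal_sheaf_iso_hom V2 V1 X].

Definition g_linked r V1 V2 :=
  [/\ liaison_scheme r V1, liaison_scheme r V2 & exists X, linked_by r X V1 V2].

Definition g_liaison r := clos_refl_sym_trans (S -> Prop) (g_linked r).

Definition glicci V :=
  exists r C, complete_intersection r C /\ g_liaison r V C.

(** * General sets of points *)

(* A set of n points of P^m(k) is given by an n x (m+1) matrix whose rows are
   homogeneous coordinates of the points. *)

Definition distinct_points n (p : 'M[k]_(n, m.+1)) :=
  (forall i, row i p != 0) /\
  (forall i j, i != j -> forall c : k, row i p != c *: row j p).

(* The saturated ideal of the reduced scheme: the polynomials all of whose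
   homogeneous components vanish at all the points. *)
Definition points_ideal n (p : 'M[k]_(n, m.+1)) : S -> Prop :=
  fun f => forall d i, (pihomog (@mdeg m.+1) d f).@[fun j => p i j] = 0.

(* F, a polynomial in the n * (m+1) entries of the matrix, is homogeneous in
   the coordinates of each of the n points separately. *)
Definition multihomogeneous n (F : {mpoly k[n * m.+1]}) :=
  exists d : 'I_n -> nat, forall mm, mm \in msupp F ->
    forall i, (\sum_(j < m.+1) mm (mxvec_index i j))%N = d i.

(* U is (the preimage in (P^m)^n minus the diagonals of) a Zariski open subset
   of the family of reduced sets of n points, which is the quotient of that
   space by the permutations of the points. *)
Definition open_family n (U : 'M[k]_(n, m.+1) -> Prop) :=
  (exists Phi : {mpoly k[n * m.+1]} -> Prop,
     (forall F, Phi F -> multihomogeneous F) /\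
     (forall p, U p <-> distinct_points p /\
        exists2 F, Phi F & F.@[fun v => mxvec p 0 v] != 0)) /\
  (forall p (s : 'S_n), U p -> U (row_perm s p)).

Definition general_points n (Y : (S -> Prop) -> Prop) :=
  exists U : 'M[k]_(n, m.+1) -> Prop,
    [/\ open_family U, exists p, U p & forall p, U p -> Y (points_ideal p)].

End ProjectiveSchemes.

(* Main.v *)
From HB Require Import structures.
From Stdlib Require Import Relation_Operators.
From mathcomp Require Import all_boot all_order all_algebra.
From mathcomp Require Import fingroup perm fraction boolp zify ring.
From mathcomp Require classical_sets.
From mathcomp.multinomials Require Import mpoly.
Require Import Defs.

Set Implicit Arguments.
Unset Strict Implicit.
Unset Printing Implicit Defensive.
Import GRing.Theory.
Local Open Scope ring_scope.

(** A set of n points is linked to a set of n' points by a reduced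
    arithmetically Gorenstein set of n + n' points, and a single point is a
    complete intersection.  The theorem follows from the links
      N =  3:  2 -> 1                       N = 20:  12 -> 8, 13 -> 7
      N =  5:  3 -> 2, 4 -> 1               N = 27:  14 -> 13, 15 -> 12
      N =  8:  5 -> 3, 6 -> 2, 7 -> 1       N = 30:  16 -> 14, 17 -> 13,
      N = 14:  8 -> 6, 9 -> 5, 10 -> 4, 11 -> 3      18 -> 12, 19 -> 11
    where N = n + n', provided that n general points can be completed to such
    a Gorenstein set by n' points that are themselves general enough for the
    next link.

    Gorenstein sets of points.  Let x_1, ..., x_N be points of the chart
    x_0 = 1 with weights c_i <> 0 such that sum_i c_i f(x_i) = 0 for every f
    of degree less than s, and let V_d in k^N be the space of values of the
    polynomials of degree at most d.  The relation says that V_d and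
    V_(s-1-d) are orthogonal for the form sum_i c_i y_i z_i; if the dimensions
    r_d of these spaces add up to N, each is the orthogonal of the other.
    Then the localization B of the cone over the points at its vertex is its
    own dual over D = k[t]_(t), for the trace form sum_i c_i y_i z_i / t^s,
    so that 0 -> B -> K^N -> K^N / B -> 0, with K = Frac D, is an injective
    resolution of B.  Hence the points form an arithmetically Gorenstein
    scheme (cone_ring_gorenstein), and two complementary parts of it are
    linked: the ideal sheaf of one part acts by multiplication as the sheaf of
    homomorphisms from the other (gorenstein_link, rank_link).

    Generic parts.  The equations sum_i c_i f(x_i) = 0, deg f < s, define a
    variety of weighted sets, and a part p of n points moves freely in this
    variety near a base configuration at which the differential in the other
    coordinates q, c is onto (deform).  Dually, this submersivity says that no
    nonzero f of degree less than s vanishes on all the points and is singular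
    at those of q.  Applying this first to q and then to p makes both parts
    generic (link_step).  The implicit function theorem behind it, over an
    arbitrary algebraically closed field, combines Newton's iteration along
    arcs (hensel) with the fact that a variety which dominates an affine
    space has points over almost every point of it (generic_point).

    Base configurations.  Take m = s + 3 planes, any three of which meet in
    one point and no four in a common point.  The polynomials of degree less
    than s restricted to the lines where two of the planes meet satisfy the
    relations that express the vanishing of the sum of the residues of a
    differential on a line; combining the lines with integer coefficients
    mu_ij gives a relation between the values at the triple points, with
    coefficients mu_ij - mu_il + mu_jl up to explicit nonzero weights
    (alternating_relation).  For suitable mu these coefficients are 1 or -1 on
    exactly N triple points and 0 elsewhere.  All the ranks and the
    submersivity that are needed then follow from one argument: a polynomial
    of degree e with more than e zeros on a line, counted with multiplicity,
    vanishes on it, and one of degree e <= m - 3 that vanishes at all the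
    triple points is zero.  Propagating zeros along the lines is a finite
    computation (configurations_valid). *)

(** * Prime ideals and the extension of points *)

(** The union of the empty chain is the empty predicate, for which [Q] may fail;
    the chain condition is therefore required of nonempty chains only. *)
Lemma Zorn_predicate (T : Type) (Q : (T -> Prop) -> Prop) (A0 : T -> Prop) :
    Q A0 -> (exists x, A0 x) ->
    (forall F : (T -> Prop) -> Prop, (exists A, F A) -> (forall A, F A -> Q A) ->
       (forall A B, F A -> F B ->
          (forall x, A x -> B x) \/ (forall x, B x -> A x)) ->
       Q (fun x => exists2 A, F A & A x)) ->
  exists2 A, Q A & forall B, Q B -> (forall x, A x -> B x) ->
                     forall x, B x -> A x.
Proof.
move=> QA0 [x0 A0x0] Qchain.
pose P (A : classical_sets.set T) := (forall x, ~ A x) \/ Q A.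
have [F FP totF|A [PA maxA]] := @classical_sets.Zorn_bigcup T P.
  have [[A [FA QA]]|noF] := pselect (exists A, F A /\ Q A); last first.
    left=> x [A FA Ax]; case: (FP A FA) => [/(_ x)//|QA].
    by apply: noF; exists A.
  right; pose F' A := F A /\ Q A.
  have /Qchain QF' : exists A, F' A by exists A.
  have {}QF' : Q (fun x => exists2 A, F' A & A x).
    apply: QF' => [B []//|B C [FB _] [FC _]].
    by have [] := totF _ _ FB FC; [left|right].
  rewrite (_ : classical_sets.bigcup _ _ = fun x => exists2 A, F' A & A x) //.
  apply/funext => x; apply/propext; split=> [[B FB Bx]|[B [FB _] Bx]].
    by exists B => //; split=> //; case: (FP B FB) => [/(_ x)//|].
  by exists B.
have QA : Q A.
  case: PA => // A0'; case: (maxA A0); last by right.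
  by split=> [x /A0'//|/(_ x0 A0x0)]; apply: A0'.
exists A => // B QB AB x Bx; apply: contrapT => nAx.
by apply: (maxA B); [split=> // /(_ x Bx)|right].
Qed.

Section PrimeAvoidance.
Variable C : comNzRingType.
Implicit Types I P M : C -> Prop.

Lemma ideal_sum I (r : nat) (F : 'I_r -> C) :
  is_ideal I -> (forall i, I (F i)) -> I (\sum_i F i).
Proof. by move=> [I0 ID _] IF; elim/big_ind: _ => // x y; apply: ID. Qed.

Lemma is_ideal_generated r (g : 'I_r -> C) : is_ideal (generated g).
Proof.
split.
- by exists (fun=> 0); rewrite big1 // => i _; rewrite mul0r.
- move=> x y [c ->] [e ->]; exists (fun i => c i + e i).
  by rewrite -big_split; apply: eq_bigr => i _; rewrite mulrDl.
- move=> a x [c ->]; exists (fun i => a * c i).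
  by rewrite mulr_sumr; apply: eq_bigr => i _; rewrite mulrA.
Qed.

(** An ideal that is maximal among those disjoint from a multiplicative set is
    prime (Krull). *)
Lemma prime_avoiding I M :
    is_ideal I -> M 1 -> (forall x y, M x -> M y -> M (x * y)) ->
    (forall x, I x -> ~ M x) ->
  exists P, [/\ is_prime P, sub_ideal I P & forall x, P x -> ~ M x].
Proof.
move=> idI M1 MM IM.
pose Q J := [/\ is_ideal J, sub_ideal I J & forall x, J x -> ~ M x].
have [||F [A FA] FQ totF|P [idP IP PM] maxP] := @Zorn_predicate _ Q I.
- by split.
- by exists 0; case: idI.
- split.
  + split.
    * by exists A => //; case: (FQ A FA) => -[].
    * move=> x y [B FB Bx] [D FD Dy].
      have [BD|DB] := totF _ _ FB FD.
        exists D => //; case: (FQ D FD) => -[_ DD _] _ _; apply: DD => //.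
        exact: BD.
      exists B => //; case: (FQ B FB) => -[_ DD _] _ _; apply: DD => //.
      exact: DB.
    * move=> a x [B FB Bx]; exists B => //.
      by case: (FQ B FB) => -[_ _ BM] _ _; apply: BM.
  + by move=> x Ix; exists A => //; case: (FQ A FA) => _ IA _; apply: IA.
  + by move=> x [B FB Bx]; case: (FQ B FB) => _ _; apply.
exists P; split=> //; split=> //; first by move=> P1; apply: (PM 1).
have [P0 PD PZ] := idP.
have adjoin x : ~ P x -> exists a p, P p /\ M (p + a * x).
  move=> nPx; apply: contrapT => nex; apply: nPx.
  apply: (maxP (fun y => exists a p, P p /\ y = p + a * x)); first split.
  - split.
    + by exists 0, 0; rewrite mul0r addr0.
    + move=> _ _ [a [p [Pp ->]]] [b [q [Pq ->]]].
      by exists (a + b), (p + q); split; [apply: PD|rewrite mulrDl addrACA].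
    + move=> b _ [a [p [Pp ->]]]; exists (b * a), (b * p).
      by split; [apply: PZ|rewrite mulrDr mulrA].
  - by move=> y Iy; exists 0, y; rewrite mul0r addr0; split=> //; apply: IP.
  - by move=> _ [a [p [Pp ->]]] My; apply: nex; exists a, p.
  - by move=> y Py; exists 0, y; rewrite mul0r addr0.
  - by exists 1, 0; rewrite mul1r add0r.
move=> x y Pxy; apply: contrapT => nPxy.
have [a [p [Pp Mp]]] : exists a p, P p /\ M (p + a * x).
  by apply: adjoin => Px; apply: nPxy; left.
have [b [q [Pq Mq]]] : exists a p, P p /\ M (p + a * y).
  by apply: adjoin => Py; apply: nPxy; right.
apply: (PM ((p + a * x) * (q + b * y))); last exact: MM.
rewrite mulrDl; apply: (PD); first by rewrite mulrC; apply: (PZ).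
rewrite mulrDr; apply: (PD); first exact: (PZ).
by rewrite mulrACA; apply: PZ.
Qed.

End PrimeAvoidance.

Section PrimeIdeal.
Variables (C : comNzRingType) (P : C -> Prop).
Hypothesis prP : is_prime P.

Lemma prime_prod l (F : 'I_l -> C) : P (\prod_i F i) -> exists i, P (F i).
Proof.
have [_ P1 PM] := prP; elim: l F => [|l IHl] F; first by rewrite big_ord0.
rewrite big_ord_recl => /PM[|/IHl[i]]; first by exists ord0.
by exists (lift ord0 i).
Qed.

Lemma primeX x n : P (x ^+ n) -> P x.
Proof.
have [_ P1 PM] := prP.
by elim: n => [//|n IHn]; rewrite exprS => /PM[].
Qed.

Lemma primeB x y : P x -> P y -> P (x - y).
Proof.
have [[_ PD PZ] _ _] := prP.
by move=> Px Py; apply: PD => //; rewrite -mulN1r; apply: PZ.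
Qed.
End PrimeIdeal.

Section Extension.
Variables (k : closedFieldType) (A : idomainType).

(** The property of finitely generated algebras expressed by Chevalley's theorem:
    if the closed set of P dominates the spectrum of A, then almost every
    k-point of A lifts to a point of this set where g does not vanish.  It
    involves B only through i, so that it can be established by adjoining one
    element at a time and then passing to a quotient. *)
Definition points_extend (B : comNzRingType) (i : {rmorphism A -> B}) :=
  forall P : B -> Prop, is_prime P -> (forall a, a != 0 -> ~ P (i a)) ->
  forall g, ~ P g ->
  exists2 h : A, h != 0 &
    forall eps : {rmorphism A -> k}, eps h != 0 ->
    exists eta : {rmorphism B -> k},
      [/\ forall a, eta (i a) = eps a, forall b, P b -> eta b = 0 & eta g != 0].

Lemma points_extend_base : points_extend (idfun : {rmorphism A -> A}).
Proof.
move=> P prP PA g nPg; exists g.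
  by apply/eqP => g0; apply: nPg; rewrite g0; case: prP => -[].
move=> eps epsg; exists eps; split=> // b Pb.
by have [->|/PA] := eqVneq b 0; [rewrite rmorph0|case].
Qed.

Section Step.
Variables (B : comNzRingType) (i : {rmorphism A -> B}).
Hypothesis extB : points_extend i.
Variable P : {poly B} -> Prop.
Hypothesis prP : is_prime P.
Let P0 b := P b%:P.

Let prP0 : is_prime P0.
Proof.
case: prP => -[P_0 PD PZ] P_1 PM; split; first split.
- by rewrite /P0 polyC0.
- by move=> x y Px Py; rewrite /P0 polyCD; apply: PD.
- by move=> a x Px; rewrite /P0 polyCM; apply: PZ.
- by rewrite /P0 polyC1.
- by move=> x y; rewrite /P0 polyCM => /PM.
Qed.

Let allP0 (p : {poly B}) := forall j, P0 p`_j.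

Let allP0P p : allP0 p -> P p.
Proof.
case: prP => -[P_0 PD PZ] _ _ Pp; rewrite -[p]coefK poly_def.
elim/big_ind: _ => // j _; rewrite -mul_polyC mulrC; exact/PZ/Pp.
Qed.

(** The terms whose coefficient lies in P0 can be removed, as P0[x] is in P. *)
Let truncate (J : {poly B} -> Prop) (p : {poly B}) :
    (forall x y, J x -> P y -> J (x - y)) -> J p -> ~ allP0 p ->
  exists q, [/\ J q, ~ P0 (lead_coef q), (size q <= size p)%N &
             allP0 (p - q)].
Proof.
move=> JB; move: {2}(size p) (leqnn (size p)) => n.
elim: n p => [|n IHn] p.
  rewrite size_poly_leq0 => /eqP-> _ []; move=> j; rewrite coef0.
  by case: prP0 => -[].
move=> szp Jp nPp; have [lP|] := pselect (P0 (lead_coef p)); last first.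
  by exists p; split=> // j; rewrite subrr coef0; case: prP0 => -[].
pose m := lead_coef p *: 'X^((size p).-1).
have coefm j : P0 m`_j.
  rewrite coefZ coefXn; case: prP0 => -[P00 _ PZ] _ _.
  by case: eqP => _; rewrite ?mulr1 ?mulr0.
have p_n0 : p != 0.
  by apply/eqP => p0; apply: nPp => j; rewrite p0 coef0; case: prP0 => -[].
have szpm : (size (p - m)%R < size p)%N.
  rewrite -[X in (_ < X)%N]prednK ?size_poly_gt0 // ltnS; apply/leq_sizeP => j.
  rewrite leq_eqVlt => /predU1P[<-|ltj].
    by rewrite coefB coefZ coefXn eqxx mulr1 -lead_coefE subrr.
  rewrite coefB coefZ coefXn gtn_eqF // mulr0 subr0 nth_default //.
  by rewrite -[size p]prednK ?size_poly_gt0.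
have nPpm : ~ allP0 (p - m).
  move=> Ppm; apply: nPp => j; rewrite -[p](subrK m) coefD.
  by case: prP0 => -[_ PD _] _ _; apply: PD.
have [||q [Jq lq szq Pq]] := IHn (p - m) _ _ nPpm.
- by rewrite -ltnS (leq_trans szpm).
- by apply: JB => //; apply: allP0P.
exists q; split=> //; first exact: leq_trans (ltnW szpm).
move=> j; rewrite -[p](subrK m) addrAC coefD.
by case: prP0 => -[_ PD _] _ _; apply: PD.
Qed.

Let least_degree (J : {poly B} -> Prop) :
    (forall x y, J x -> P y -> J (x - y)) -> (exists2 p, J p & ~ allP0 p) ->
  exists f, [/\ J f, ~ P0 (lead_coef f) &
    forall p, J p -> ~ allP0 p -> (size f <= size p)%N].
Proof.
move=> JB [f1 Jf1 nPf1]; have [f2 [Jf2 lf2 _ _]] := truncate JB Jf1 nPf1.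
have exn : exists n, `[< exists2 f, J f & ~ P0 (lead_coef f) /\ size f = n >].
  by exists (size f2); apply/asboolP; exists f2.
case: (ex_minnP exn) => n /asboolP[f Jf [lf szf]] minn.
exists f; split=> // p Jp nPp.
have [q [Jq lq szq _]] := truncate JB Jp nPp.
by rewrite szf (leq_trans _ szq) //; apply: minn; apply/asboolP; exists q.
Qed.

(** If P is P0[x], a nonzero coefficient of g modulo P0 gives points with
    g(x) <> 0.  Otherwise let f in P have the least degree among the elements
    outside P0[x]: up to powers of its leading coefficient, f generates P modulo
    P0[x].  The ideal (P, g) contains a constant r outside P0, namely any element
    e of least degree outside P0[x], since pseudo-division of g and f by a
    nonconstant e would put g or a shorter quotient of f in P.  A point of P0 at
    which r and the leading coefficient of f survive extends to a root of f, and
    g does not vanish there because r is a multiple of g modulo P. *)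
Lemma points_extend_step : (forall a, a != 0 -> ~ P (i a)%:P) ->
  forall g, ~ P g ->
  exists2 h : A, h != 0 &
    forall eps : {rmorphism A -> k}, eps h != 0 ->
    exists eta : {rmorphism {poly B} -> k},
      [/\ forall a, eta (i a)%:P = eps a, forall b, P b -> eta b = 0
        & eta g != 0].
Proof.
move=> PA g nPg; have [[P_0 PD PZ] P_1 PM] := prP.
have [[P00 P0D P0Z] P01 P0M] := prP0.
have [allP|] := pselect (forall f, P f -> allP0 f).
  have [j nPj] : exists j, ~ P0 g`_j.
    by apply: contrapT => nex; apply/nPg/allP0P => j; apply: contrapT => nPj;
      apply: nex; exists j.
  have [h h0 Hh] := extB prP0 PA nPj.
  exists h => // eps /Hh[eta [etaA etaP etag]].
  have : map_poly eta g != 0.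
    by apply/eqP => /(congr1 (fun p : {poly k} => p`_j)) /eqP;
      rewrite coef_map coef0 (negPf etag).
  move=> /closed_nonrootP[x gx].
  exists (horner_eval x \o map_poly eta : {rmorphism {poly B} -> k}); split.
  - by move=> a; rewrite /= map_polyC /= /horner_eval hornerC etaA.
  - move=> b /allP Pb /=; rewrite (_ : map_poly eta b = 0) ?rmorph0 //.
    by apply/polyP => l; rewrite coef_map coef0; apply/etaP/Pb.
  - exact: gx.
move=> /existsNP[f1 /not_implyP[Pf1 nPf1]].
have PBl x y : P x -> P y -> P (x - y) by apply: primeB.
have [f [Pf lf minf]] := least_degree PBl (ex_intro2 _ _ f1 Pf1 nPf1).
have f0 : f != 0 by apply/eqP => f0; apply: lf; rewrite f0 lead_coef0.
have szf : (1 < size f)%N.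
  rewrite ltnNge; apply/negP => /size1_polyC fE; apply: lf.
  by rewrite fE lead_coefC /P0 -fE.
pose J p := exists a q, P q /\ p = q + a * g.
have JB x y : J x -> P y -> J (x - y).
  by move=> [a [q [Pq ->]]] Py; exists a, (q - y); rewrite addrAC; split=> //;
    apply: PBl.
have JZ a x : J x -> J (a * x).
  move=> [b [q [Pq ->]]]; exists (a * b), (a * q).
  by rewrite mulrDr mulrA; split=> //; apply: PZ.
have JBB x y : J x -> J y -> J (x - y).
  move=> [a [q [Pq ->]]] [b [r [Pr ->]]]; exists (a - b), (q - r).
  by rewrite mulrBl opprD addrACA; split=> //; apply: PBl.
have Jf : J f by exists 0, f; rewrite mul0r addr0.
have Jg : J g by exists 1, 0; rewrite mul1r add0r.
have [|e [Je le mine]] := least_degree JB; first by exists f => // /(_ (size f).-1).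
have e0 : e != 0 by apply/eqP => e0; apply: le; rewrite e0 lead_coef0.
have sze : size e = 1%N.
  apply/eqP; rewrite eqn_leq size_poly_gt0 e0 andbT leqNgt; apply/negP => sze.
  have nPl n : ~ P0 (lead_coef e ^+ n) by move/(primeX prP0).
  have Pe : ~ P e.
    move=> Pe; have := Pdiv.ComRing.redivpP g e.
    case: Pdiv.Ring.redivp => -[m q] r; case=> m' q' r' Er /(_ e0) szr.
    have Jr : J r'.
      have -> : r' = (lead_coef e ^+ m')%:P * g - q' * e.
        by rewrite mul_polyC Er addrAC subrr add0r.
      by apply: JBB; apply: JZ.
    have Pr : P r'.
      apply: allP0P; apply: contrapT => nr; have := mine _ Jr nr.
      by rewrite leqNgt szr.
    have : P ((lead_coef e ^+ m')%:P * g).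
      by rewrite mul_polyC Er; apply: PD => //; apply: PZ.
    by case/PM => // /nPl.
  have := Pdiv.ComRing.redivpP f e.
  case: Pdiv.Ring.redivp => -[m q] r; case=> m' q' r' Er /(_ e0) szr.
  have Er' : r' = (lead_coef e ^+ m')%:P * f - q' * e.
    by rewrite mul_polyC Er addrAC subrr add0r.
  have Pr : allP0 r'.
    apply: contrapT => nr; have Jr : J r' by rewrite Er'; apply: JBB; apply: JZ.
    by have := mine r' Jr nr; rewrite leqNgt szr.
  have /PM[Pq|//] : P (q' * e).
    rewrite -[q' * e](addrK r') -Er -mul_polyC; apply: PBl; first exact: PZ.
    exact: allP0P.
  have nPq : ~ allP0 q'.
    move=> Pq0; apply: (@nPl m'); have : P0 (lead_coef e ^+ m' * lead_coef f).
      rewrite lead_coefE -coefCM mul_polyC Er coefD; apply: P0D => //.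
      rewrite coefM; apply: (ideal_sum (I := P0)) => [|j]; first by case: prP0.
      by rewrite mulrC; apply: (P0Z); apply: Pq0.
    by case/P0M.
  have [q1 [Pq1 lq1 szq1 Pqq]] := truncate PBl Pq nPq.
  have ltq : (size q1 < size f)%N.
    rewrite ltnNge; apply/negP => leq1.
    pose n := (size q1 + size e).-2.
    have lef : (size f <= n)%N by rewrite /n; lia.
    have : P0 (lead_coef q1 * lead_coef e).
      rewrite mul_lead_coef -/n -[q1](subrK q') mulrDl coefD; apply: P0D.
        rewrite coefM; apply: (ideal_sum (I := P0)) => [|j].
          by case: prP0.
        rewrite mulrC; apply: (P0Z).
        by rewrite -opprB coefN -mulN1r; apply: P0Z.
      have -> : q' * e = (lead_coef e ^+ m')%:P * f - r'.
        by rewrite mul_polyC Er addrK.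
      rewrite coefB coefCM (nth_default _ lef) mulr0.
      by apply: (primeB prP0); [exact: P00|exact: Pr].
    by case/P0M.
  have /(minf q1 Pq1) : ~ allP0 q1 by move=> /(_ (size q1).-1).
  by rewrite leqNgt ltq.
have [r er] : exists r, e = r%:P by exists e`_0; apply: size1_polyC; rewrite sze.
have [g' [p [Pp rE]]] := Je.
have nPr : ~ P0 (lead_coef f * r).
  by case/P0M=> //; rewrite -(lead_coefC r) -er.
have [h h0 Hh] := extB prP0 PA nPr.
exists h => // eps /Hh[eta [etaA etaP]]; rewrite rmorphM mulf_eq0 negb_or.
move=> /andP[etaf etar].
have szef : size (map_poly eta f) = size f by rewrite size_map_poly_id0.
have /closed_rootP[x fx] : size (map_poly eta f) != 1%N by rewrite szef gtn_eqF.
pose theta : {rmorphism {poly B} -> k} := horner_eval x \o map_poly eta.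
have thetaC b : theta b%:P = eta b.
  by rewrite /theta /= map_polyC /= /horner_eval hornerC.
have thetaf : theta f = 0 by apply/eqP.
have theta0 q : allP0 q -> theta q = 0.
  move=> Pq; rewrite /theta /= (_ : map_poly eta q = 0) ?rmorph0 //.
  by apply/polyP => l; rewrite coef_map coef0; apply/etaP/Pq.
have thetaP q : P q -> theta q = 0.
  move=> Pq; have := Pdiv.ComRing.redivpP q f.
  case: Pdiv.Ring.redivp => -[m q'] r'; case=> m1 q1 r1 Er /(_ f0) szr.
  have /theta0 r10 : allP0 r1.
    apply: contrapT => nr; have Pr : P r1.
      have -> : r1 = (lead_coef f ^+ m1)%:P * q - q1 * f.
        by rewrite mul_polyC Er addrAC subrr add0r.
      by apply: PBl; apply: PZ.
    by have := minf r1 Pr nr; rewrite leqNgt szr.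
  have /eqP := congr1 theta Er.
  rewrite rmorphD rmorphM thetaf r10 mulr0 addr0 -mul_polyC rmorphM thetaC.
  by rewrite mulf_eq0 rmorphXn expf_eq0 (negPf etaf) andbF => /eqP.
exists theta; split=> //; first by move=> a; rewrite thetaC etaA.
have : theta e != 0 by rewrite er thetaC.
by rewrite rE rmorphD (thetaP p) // add0r rmorphM mulf_eq0 negb_or => /andP[].
Qed.
End Step.
End Extension.

Section MakeMorphism.
Variables (R S : comNzRingType) (f : R -> S).
Hypotheses (fB : zmod_morphism f) (fM : monoid_morphism f).
Definition make_rmorphism : {rmorphism R -> S} :=
  HB.pack f (GRing.isZmodMorphism.Build R S f fB)
    (GRing.isMonoidMorphism.Build R S f fM).
End MakeMorphism.

Section ExtensionGen.
Variables (k : closedFieldType) (A : idomainType).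

Lemma points_extend_surj (B C : comNzRingType) (i : {rmorphism A -> B})
    (psi : {rmorphism B -> C}) (j : {rmorphism A -> C}) :
    (forall a, psi (i a) = j a) -> (forall c, exists b, psi b = c) ->
  points_extend k i -> points_extend k j.
Proof.
move=> psi_i /choice[s sK] extB P prP PA g nPg.
have [[P0 PD PZ] P1 PM] := prP.
have prPpsi : is_prime (P \o psi).
  split; first split; rewrite /= ?rmorph0 ?rmorph1 //.
  - by move=> x y Px Py; rewrite rmorphD; apply: PD.
  - by move=> a x Px; rewrite rmorphM; apply: PZ.
  - by move=> x y; rewrite rmorphM; apply: PM.
have PiA a : a != 0 -> ~ (P \o psi) (i a) by rewrite /= psi_i; apply: PA.
have nPsg : ~ (P \o psi) (s g) by rewrite /= sK.
have [h h0 Hh] := extB (P \o psi) prPpsi PiA (s g) nPsg.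
exists h => // eps /Hh[eta [etaA etaP etag]].
have etaE b b' : psi b = psi b' -> eta b = eta b'.
  move=> Ebb; apply/eqP; rewrite -subr_eq0 -rmorphB; apply/eqP/etaP.
  by rewrite /= rmorphB Ebb subrr.
have fB : zmod_morphism (eta \o s).
  by move=> x y /=; rewrite -rmorphB; apply: etaE; rewrite rmorphB !sK.
have fM : monoid_morphism (eta \o s).
  split; first by rewrite /= -(rmorph1 eta); apply: etaE; rewrite sK rmorph1.
  by move=> x y /=; rewrite -rmorphM; apply: etaE; rewrite rmorphM !sK.
exists (make_rmorphism fB fM); split=> //= [a|c Pc].
  by rewrite -etaA; apply: etaE; rewrite sK psi_i.
by apply: etaP; rewrite /= sK.
Qed.

(** The hypothesis on x says that C is generated by these elements as a ring over
    A, without the choice of a presentation. *)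
Lemma points_extend_fg (C : comNzRingType) (j : {rmorphism A -> C}) r
    (x : 'I_r -> C) :
    (forall (B : comNzRingType) (psi : {rmorphism B -> C}),
       (forall a, exists b, psi b = j a) -> (forall l, exists b, psi b = x l) ->
     forall c, exists b, psi b = c) ->
  points_extend k j.
Proof.
move=> gen.
suff [B [i [psi [extB psi_i psi_x]]]] : exists (B : comNzRingType)
    (i : {rmorphism A -> B}) (psi : {rmorphism B -> C}),
    [/\ points_extend k i, forall a, psi (i a) = j a &
     forall l, exists b, psi b = x l].
  apply: points_extend_surj extB => //; apply: gen => // a.
  by exists (i a).
elim: r x {gen} => [|r IHr] x.
  by exists A, idfun, j; split=> [||[]//]; first exact: points_extend_base.
have [B [i [psi [extB psi_i psi_x]]]] := IHr (x \o widen_ord (leqnSn r)).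
exists {poly B}, (polyC \o i : {rmorphism A -> {poly B}}).
exists (horner_eval (x ord_max) \o map_poly psi : {rmorphism {poly B} -> C}).
split.
- by move=> P prP PA g nPg; apply: points_extend_step nPg.
- by move=> a /=; rewrite map_polyC /= /horner_eval hornerC.
- move=> l; have [ltlr|] := ltnP l r.
    have [b psib] := psi_x (Ordinal ltlr); exists b%:P.
    rewrite /= map_polyC /= /horner_eval hornerC psib /=; congr x.
    exact: val_inj.
  move=> lerl; exists 'X; rewrite /= map_polyX /horner_eval hornerX; congr x.
  by apply: val_inj => /=; have := ltn_ord l; lia.
Qed.

End ExtensionGen.

Lemma mpoly_closed_ind (R : comNzRingType) n (Q : {mpoly R[n]} -> Prop) :
    (forall c, Q c%:MP) -> (forall i, Q 'X_i) ->
    (forall p q, Q p -> Q q -> Q (p + q)) ->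
    (forall p q, Q p -> Q q -> Q (p * q)) ->
  forall p, Q p.
Proof.
move=> QC QX QD QM p; rewrite [p]mpolyE.
apply: (big_ind Q) => [||m _]; first by rewrite -mpolyC0; apply: QC.
  exact: QD.
rewrite -mul_mpolyC mpolyXE_id; apply: (QM) => //.
apply: (big_ind Q) => [||i _]; first by rewrite -mpolyC1; apply: QC.
  exact: QM.
by elim: (m i) => [|e IHe]; rewrite ?expr0 ?exprS -?mpolyC1; [apply: QC|apply: QM].
Qed.

Section MPolyMorphisms.
Variables (R : comNzRingType) (n : nat).

Lemma mpoly_generated (B : comNzRingType) (psi : {rmorphism B -> {mpoly R[n]}}) :
    (forall c, exists b, psi b = c%:MP) -> (forall i, exists b, psi b = 'X_i) ->
  forall p, exists b, psi b = p.
Proof.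
move=> psiC psiX; elim/mpoly_closed_ind=> // [p q [b <-] [b' <-]|p q [b <-] [b' <-]].
  by exists (b + b'); rewrite rmorphD.
by exists (b * b'); rewrite rmorphM.
Qed.

Lemma mpoly_rmorph_eq (S : comNzRingType) (f g : {rmorphism {mpoly R[n]} -> S}) :
    (forall c, f c%:MP = g c%:MP) -> (forall i, f 'X_i = g 'X_i) -> f =1 g.
Proof.
move=> fgC fgX; elim/mpoly_closed_ind=> // p q Ep Eq.
  by rewrite !rmorphD Ep Eq.
by rewrite !rmorphM Ep Eq.
Qed.
End MPolyMorphisms.

Definition joint (T : Type) d r (u : 'I_d -> T) (w : 'I_r -> T)
  (v : 'I_(d + r)) : T := match split v with inl i => u i | inr j => w j end.

Lemma jointl T d r (u : 'I_d -> T) (w : 'I_r -> T) i :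
  joint u w (lshift r i) = u i.
Proof. by rewrite /joint (unsplitK (inl i)). Qed.

Lemma jointr T d r (u : 'I_d -> T) (w : 'I_r -> T) j :
  joint u w (rshift d j) = w j.
Proof. by rewrite /joint (unsplitK (inr j)). Qed.

Section GenericPoint.
Variables (k : closedFieldType) (d r : nat).
Local Notation C := {mpoly k[d + r]}.

Definition lift_base : {rmorphism {mpoly k[d]} -> C} :=
  mmap (@mpolyC (d + r) k) (fun i => 'X_(lshift r i)).

(** The equations in P define a variety that dominates the u-space. *)
Theorem generic_point (P : C -> Prop) (g : C) :
    is_prime P -> (forall G, G != 0 -> ~ P (lift_base G)) -> ~ P g ->
  exists2 h : {mpoly k[d]}, h != 0 & forall u, h.@[u] != 0 ->
    exists w, (forall F, P F -> F.@[joint u w] = 0) /\ g.@[joint u w] != 0.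
Proof.
move=> prP PA nPg.
have ext : points_extend k lift_base.
  apply: (@points_extend_fg k _ _ _ r (fun j => 'X_(rshift d j))).
  move=> B psi psiA psiX; apply: mpoly_generated => [c|v].
    by have [b psib] := psiA c%:MP; exists b; rewrite psib /= /lift_base mmapC.
  rewrite -[v]splitK; case: (split v) => [i|j] /=; last exact: psiX.
  have [b psib] := psiA 'X_i; exists b.
  by rewrite psib /= /lift_base mmapX mmap1U.
have [h h0 Hh] := ext P prP PA g nPg.
exists h => // u hu; have [eta [etaA etaP etag]] := Hh (meval u) hu.
exists (fun j => eta 'X_(rshift d j)).
have etaE F : F.@[joint u (fun j => eta 'X_(rshift d j))] = eta F.
  pose m : {rmorphism C -> k} := meval (joint u (fun j => eta 'X_(rshift d j))).
  apply: (mpoly_rmorph_eq (f := m)) => [c|v].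
    rewrite /m /= mevalC; have := etaA c%:MP.
    by rewrite /= /lift_base mmapC mevalC => ->.
  rewrite /m /= mevalXU /joint -{2}[v]splitK; case: (split v) => [i|j] //=.
  by have := etaA 'X_i; rewrite /= /lift_base mmapX mmap1U mevalXU => ->.
by split=> [F /etaP|]; rewrite etaE.
Qed.

End GenericPoint.

Lemma mpoly_nonroot (k : closedFieldType) n (F : {mpoly k[n]}) :
  F != 0 -> exists v, F.@[v] != 0.
Proof.
move=> F0; pose j : {rmorphism k -> {mpoly k[n]}} := @mpolyC n k.
have ext : points_extend k j.
  apply: (@points_extend_fg _ _ _ _ n (fun i => 'X_i)) => B psi psiC psiX.
  exact: mpoly_generated.
have [|a a0 aE|/eqP/(negP F0)//|h h0 Hh] := ext (fun G => G = 0) _ _ F.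
- split; first by split=> // [x y -> ->|a x ->]; rewrite ?addr0 ?mulr0.
    by apply/eqP; rewrite oner_eq0.
  by move=> x y /eqP; rewrite mulf_eq0 => /orP[]/eqP; [left|right].
- by move: a0; rewrite -(mpolyC_eq0 n) => /eqP; apply.
have [eta [etaC _ etaF]] := Hh idfun h0.
exists (fun i => eta 'X_i); suff -> : F.@[fun i => eta 'X_i] = eta F by [].
pose m : {rmorphism {mpoly k[n]} -> k} := meval (fun i => eta 'X_i).
apply: (mpoly_rmorph_eq (f := m)) => [c|i].
  by rewrite /m /= mevalC; have := etaC c.
by rewrite /m /= mevalXU.
Qed.

(** * Arcs and an implicit function theorem *)

Section Arcs.
Variables (k : fieldType) (n : nat).
Implicit Types (F : {mpoly k[n]}) (z : 'I_n -> {poly k}).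

Definition arc_eval z : {rmorphism {mpoly k[n]} -> {poly k}} :=
  mmap (@polyC k) z.

Lemma arc_evalC z c : arc_eval z c%:MP = c%:P.
Proof. by rewrite /= mmapC. Qed.

Lemma arc_evalX z i : arc_eval z 'X_i = z i.
Proof. by rewrite /= mmapX mmap1U. Qed.

Lemma arc_eval_horner z F x : (arc_eval z F).[x] = F.@[fun i => (z i).[x]].
Proof.
pose f : {rmorphism {mpoly k[n]} -> k} := horner_eval x \o arc_eval z.
apply: (mpoly_rmorph_eq (f := f) (g := meval _)) => [c|i].
  by rewrite /f /= mmapC /horner_eval hornerC mevalC.
by rewrite /f /= mmapX mmap1U mevalXU.
Qed.

Definition dirderiv F (a e : 'I_n -> k) : k :=
  (arc_eval (fun i => (a i)%:P + e i *: 'X) F)`_1.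

Lemma dirderivC c a e : dirderiv c%:MP a e = 0.
Proof. by rewrite /dirderiv arc_evalC coefC. Qed.

Lemma dirderivX i a e : dirderiv 'X_i a e = e i.
Proof.
by rewrite /dirderiv arc_evalX coefD coefC coefZ coefX add0r mulr1.
Qed.

Lemma dirderivD F G a e : dirderiv (F + G) a e = dirderiv F a e + dirderiv G a e.
Proof. by rewrite /dirderiv rmorphD coefD. Qed.

Lemma dirderivM F G a e :
  dirderiv (F * G) a e = F.@[a] * dirderiv G a e + dirderiv F a e * G.@[a].
Proof.
have ev0 H : (arc_eval (fun i => (a i)%:P + e i *: 'X) H)`_0 = H.@[a].
  rewrite -horner_coef0 arc_eval_horner; apply: meval_eq => i.
  by rewrite !hornerE.
by rewrite /dirderiv rmorphM coefM !big_ord_recl big_ord0 addr0 /= !ev0.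
Qed.

(** The congruence behind Newton's iteration: moving an arc at order N + 1 changes
    the value of F at this order by the differential of F at the origin of the
    arc. *)
Lemma arc_taylor z a e N F : (forall i, (z i).[0] = a i) ->
  exists R, arc_eval (fun i => z i + e i *: 'X^(N.+1)) F
            = arc_eval z F + dirderiv F a e *: 'X^(N.+1) + 'X^(N.+2) * R.
Proof.
move=> za; elim/mpoly_closed_ind: F => [c|i|F G [R ER] [T ET]|F G [R ER] [T ET]].
- by exists 0; rewrite !arc_evalC dirderivC scale0r mulr0 !addr0.
- by exists 0; rewrite !arc_evalX dirderivX mulr0 addr0.
- exists (R + T); rewrite rmorphD ER ET [in RHS]rmorphD dirderivD scalerDl.
  by rewrite mulrDr; ring.
have ev0 H : exists S, arc_eval z H = (H.@[a])%:P + 'X * S.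
  have : root (arc_eval z H - (H.@[a])%:P) 0.
    rewrite /root !hornerE arc_eval_horner (meval_eq _ za) subrr //.
  move=> /factor_theorem[S]; rewrite subr0 => ES; exists S.
  by rewrite mulrC -ES addrC subrK.
have [S ES] := ev0 F; have [U EU] := ev0 G.
rewrite rmorphM ER ET rmorphM dirderivM -!mul_polyC polyCD !polyCM.
rewrite !exprS; set y := 'X^N.
set f1 := (dirderiv F a e)%:P; set g1 := (dirderiv G a e)%:P.
exists (f1 * U + g1 * S + arc_eval z F * T + arc_eval z G * R
        + y * (f1 * g1) + 'X * y * (f1 * T + g1 * R) + 'X * 'X * y * R * T).
rewrite ES EU; move: f1 g1 y (F.@[a])%:P (G.@[a])%:P => f1 g1 y f0 g0; ring.
Qed.

End Arcs.

Section ImplicitFunction.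
Variables (k : closedFieldType) (d r K : nat).
Local Notation C := {mpoly k[d + r]}.
Variables (E : 'I_K -> C) (D : C) (u0 : 'I_d -> k) (w0 : 'I_r -> k).
Hypothesis E0 : forall j, (E j).@[joint u0 w0] = 0.
Hypothesis D0 : D.@[joint u0 w0] != 0.
Hypothesis submersion : forall eta : 'I_K -> k, exists del : 'I_r -> k,
  forall j, dirderiv (E j) (joint u0 w0) (joint (fun=> 0) del) = eta j.

Let line (v : 'I_d -> k) i : {poly k} := (u0 i)%:P + v i *: 'X.

(** Newton's iteration adds one coefficient of w at a time.  The equations need
    only be solvable at each step, so that w is not unique and the numbers of
    equations and unknowns are unrelated. *)
Lemma hensel v N : exists2 w : 'I_r -> {poly k}, forall l, (w l).[0] = w0 l &
  forall j, exists R, arc_eval (joint (line v) w) (E j) = 'X^(N.+1) * R.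
Proof.
have z0 w : (forall l, (w l).[0] = w0 l) ->
    forall i, (joint (line v) w i).[0] = joint u0 w0 i.
  move=> w_0 i; rewrite /joint; case: (split i) => [a|b] //.
  by rewrite /line !hornerE.
elim: N => [|N [w w_0 Ew]].
  exists (fun l => (w0 l)%:P) => [l|j]; first by rewrite hornerC.
  have : root (arc_eval (joint (line v) (fun l => (w0 l)%:P)) (E j)) 0.
    rewrite /root arc_eval_horner (meval_eq _ (z0 _ _)) ?E0 // => l.
    by rewrite hornerC.
  move=> /factor_theorem[R ER]; exists R.
  by rewrite ER subr0 mulrC expr1.
have [R ER] := choice Ew.
have [del Edel] := submersion (fun j => - (R j).[0]).
exists (fun l => w l + del l *: 'X^(N.+1)) => [l|j].
  by rewrite !hornerE w_0 expr0n mulr0 addr0.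
have [S ES] := arc_taylor (joint (fun=> 0) del) N (E j) (z0 w w_0).
have /factor_theorem[T ET] : root (R j - ((R j).[0])%:P) 0.
  by rewrite /root !hornerE subrr.
exists (T + S).
have -> : arc_eval (joint (line v) (fun l => w l + del l *: 'X^(N.+1))) (E j)
    = arc_eval (fun i => joint (line v) w i + joint (fun=> 0) del i *: 'X^(N.+1))
        (E j).
  apply: mpoly_rmorph_eq => [c|i]; first by rewrite !arc_evalC.
  rewrite !arc_evalX /joint; case: (split i) => [a|b] //.
  by rewrite scale0r addr0.
rewrite ES ER Edel -mul_polyC polyCN.
have {1}-> : R j = T * 'X + ((R j).[0])%:P by rewrite -['X]subr0 -ET subrK.
by rewrite !exprS; ring.
Qed.

(** The solutions over almost every u come from a prime ideal that contains the
    equations E and avoids D and the nonzero polynomials in u.  Such an ideal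
    exists unless some G(u) D^n is in the ideal of E.  In that case restrict
    this relation to an arc over a line through u0 on which G is not zero, along
    which E vanishes to an order larger than the degree of G: as D does not
    vanish at the origin of the arc, a power of the parameter larger than this
    degree divides the restriction of G. *)
Theorem implicit_function :
  exists2 h : {mpoly k[d]}, h != 0 & forall u, h.@[u] != 0 ->
    exists w, (forall j, (E j).@[joint u w] = 0) /\ D.@[joint u w] != 0.
Proof.
pose M F := exists G n, G != 0 /\ F = lift_base k d r G * D ^+ n.
have [||x y [G [n [G0 ->]]] [H [m [H0 ->]]]|F [c FE] [G [n [G0 FM]]]|P [prP EP PM]]
    := @prime_avoiding C (generated E) M.
- exact: is_ideal_generated.
- by exists 1, 0%N; rewrite oner_neq0 rmorph1 expr0 mulr1.
- exists (G * H), (n + m)%N; rewrite mulf_neq0 // rmorphM exprD.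
  by split=> //; rewrite mulrACA.
-
  have [u1 Gu1] := mpoly_nonroot G0.
  pose v i := u1 i - u0 i; pose g := arc_eval (line v) G.
  have g0 : g != 0.
    apply/eqP => /(congr1 (horner^~ 1)) /eqP; rewrite /g arc_eval_horner horner0.
    rewrite (meval_eq _ (_ : _ =1 u1)) ?(negPf Gu1) // => i.
    by rewrite /line hornerD hornerC hornerZ hornerX mulr1 /v addrC subrK.
  have [w w_0 Ew] := hensel v (size g).
  have z0 i : (joint (line v) w i).[0] = joint u0 w0 i.
    by rewrite /joint; case: (split i) => // a; rewrite /line !hornerE.
  have [R ER] := choice Ew.
  pose ev := arc_eval (joint (line v) w).
  have evG : ev (lift_base k d r G) = g.
    pose f : {rmorphism {mpoly k[d]} -> {poly k}} := ev \o lift_base k d r.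
    apply: (mpoly_rmorph_eq (f := f)) => [a|i].
      by rewrite /f /= !mmapC.
    by rewrite /f /= !mmapX !mmap1U mmapX mmap1U jointl.
  pose N := (size g).+1; have : 'X^N %| g.
    have cop : coprimep 'X^N (ev D ^+ n).
      apply/coprimep_expl/coprimep_expr; rewrite coprimep_sym coprimepX.
      by rewrite /root /ev arc_eval_horner (meval_eq _ z0).
    rewrite -(Gauss_dvdpl _ cop) -evG -rmorphXn -rmorphM -FM FE rmorph_sum.
    elim/big_rec: _ => [|j x _ IHx]; first exact: dvdp0.
    by apply: dvdp_add IHx; rewrite rmorphM [X in _ * X]ER mulrCA dvdp_mulIl.
  by move=> /(dvdp_leq g0); rewrite size_polyXn => /ltnW; rewrite ltnn.
have [||h h0 Hh] := generic_point (g := D) prP.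
- by move=> G G0 PG; apply: (PM _ PG); exists G, 0%N; rewrite expr0 mulr1.
- move=> PD; apply: (PM _ PD); exists 1, 1%N.
  by rewrite oner_neq0 rmorph1 mul1r expr1.
exists h => // u /Hh[w [Pw Dw]]; exists w; split=> // j; apply/Pw/EP.
exists (fun i => (i == j)%:R); rewrite (bigD1 j) //= eqxx mul1r big1 ?addr0 //.
by move=> i /negPf->; rewrite mul0r.
Qed.

End ImplicitFunction.

(** * Quotient modules *)

Record submodule (R : comNzRingType) (V : lmodType R) := Submodule {
  in_submodule :> V -> Prop;
  submodule0 : in_submodule 0;
  submoduleD : forall x y, in_submodule x -> in_submodule y -> in_submodule (x + y);
  submoduleZ : forall a x, in_submodule x -> in_submodule (a *: x) }.

Section QuotientModule.
Variables (R : comNzRingType) (V : lmodType R) (S : submodule V).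

Let submoduleN x : S x -> S (- x).
Proof. by rewrite -scaleN1r; apply: submoduleZ. Qed.

Let submoduleB x y : S x -> S y -> S (x - y).
Proof. by move=> Sx /submoduleN; apply: submoduleD. Qed.

(** The choice operator depends only on the extension of a predicate, so that it
    selects one element of each coset. *)
Definition coset_repr (x : V) : V := choose (fun y => `[< S (y - x) >]) x.

Let coset_reprP x : S (coset_repr x - x).
Proof.
apply/asboolP/(@chooseP _ (fun y => `[< S (y - x) >])); apply/asboolP.
by rewrite subrr; apply: submodule0.
Qed.

Let coset_repr_eq x y : S (x - y) -> coset_repr x = coset_repr y.
Proof.
move=> Sxy; rewrite /coset_repr.
rewrite (_ : (fun z => `[< S (z - x) >]) = (fun z => `[< S (z - y) >])).
  by apply: choose_id; apply/asboolP; rewrite ?subrr //; apply: submodule0.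
apply/funext => z; apply: asbool_equiv_eq; split=> Sz.
  by rewrite -(subrK x z) -addrA; apply: submoduleD.
have -> : z - x = (z - y) - (x - y) by rewrite opprB addrA subrK.
exact: submoduleB.
Qed.

Record quotient := Quotient { quotient_val : V;
  _ : coset_repr quotient_val == quotient_val }.
HB.instance Definition _ := [isSub for quotient_val].
HB.instance Definition _ := [Choice of quotient by <:].

Let coset_repr_idem x : coset_repr (coset_repr x) == coset_repr x.
Proof. exact/eqP/coset_repr_eq/coset_reprP. Qed.

Definition coset_of x : quotient := Quotient (coset_repr_idem x).

Lemma coset_of_eq x y : coset_of x = coset_of y <-> S (x - y).
Proof.
split=> [/(congr1 quotient_val) /= Exy|Sxy]; last exact/val_inj/coset_repr_eq.
rewrite -(subrK (coset_repr x) x) -addrA {2}Exy; apply: submoduleD.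
  by rewrite -opprB; apply: submoduleN; apply: coset_reprP.
exact: coset_reprP.
Qed.

Lemma coset_ofK q : coset_of (quotient_val q) = q.
Proof. by apply: val_inj; case: q => x /= /eqP. Qed.

Let qadd p q := coset_of (quotient_val p + quotient_val q).
Let qopp p := coset_of (- quotient_val p).
Let qscale a p := coset_of (a *: quotient_val p).

Let valK x : S (quotient_val (coset_of x) - x).
Proof. exact: coset_reprP. Qed.

Let addE x y : qadd (coset_of x) (coset_of y) = coset_of (x + y).
Proof.
by apply/coset_of_eq; rewrite opprD addrACA; apply: submoduleD; apply: valK.
Qed.

Let oppE x : qopp (coset_of x) = coset_of (- x).
Proof.
by apply/coset_of_eq; rewrite -opprD; apply/submoduleN/valK.
Qed.

Let scaleE a x : qscale a (coset_of x) = coset_of (a *: x).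
Proof. by apply/coset_of_eq; rewrite -scalerBr; apply/submoduleZ/valK. Qed.

Let qaddA : associative qadd.
Proof.
by move=> p q r; rewrite -(coset_ofK p) -(coset_ofK q) -(coset_ofK r) !addE addrA.
Qed.
Let qaddC : commutative qadd.
Proof. by move=> p q; rewrite /qadd addrC. Qed.
Let qadd0 : left_id (coset_of 0) qadd.
Proof. by move=> p; rewrite -(coset_ofK p) addE add0r. Qed.
Let qaddN : left_inverse (coset_of 0) qopp qadd.
Proof. by move=> p; rewrite -(coset_ofK p) oppE addE addNr. Qed.
HB.instance Definition _ := GRing.isZmodule.Build quotient qaddA qaddC qadd0 qaddN.

Let qscaleA a b p : qscale a (qscale b p) = qscale (a * b) p.
Proof. by rewrite -(coset_ofK p) !scaleE scalerA. Qed.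
Let qscale1 : left_id 1 qscale.
Proof. by move=> p; rewrite -(coset_ofK p) scaleE scale1r. Qed.
Let qscaleDr : right_distributive qscale +%R.
Proof.
move=> a p q; rewrite -(coset_ofK p) -(coset_ofK q).
by rewrite [X in qscale _ X]addE !scaleE [RHS]addE scalerDr.
Qed.
Let qscaleDl p : {morph qscale^~ p : a b / a + b}.
Proof.
by move=> a b; rewrite -(coset_ofK p) !scaleE [RHS]addE scalerDl.
Qed.
HB.instance Definition _ :=
  GRing.Zmodule_isLmodule.Build R quotient qscaleA qscale1 qscaleDr qscaleDl.

Lemma coset_of_linear : linear coset_of.
Proof.
by move=> a x y; rewrite -addE -scaleE.
Qed.
HB.instance Definition _ := GRing.isLinear.Build R V quotient _ coset_of coset_of_linear.
End QuotientModule.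

(** * Injective resolutions from self-duality *)

Definition make_linear (R : comNzRingType) (U V : lmodType R) (f : U -> V)
  (fL : linear f) : {linear U -> V} := HB.pack f (GRing.isLinear.Build R U V _ f fL).

Definition principal_ideals (D : comNzRingType) :=
  forall I : D -> Prop, is_ideal I ->
    exists a, forall x, I x <-> exists y, x = y * a.

Section Divisible.
Variables (D B : comNzRingType) (iota : {rmorphism D -> B}).
Variables (W : lmodType D) (N : lmodType B).
Hypothesis pidD : principal_ideals D.
Hypothesis divW : forall d (w : W), d != 0 -> exists w', d *: w' = w.

(** The graph of a D-linear map to W from a D-submodule of N, where N is a module
    over D through [iota]; extension of partial maps becomes inclusion. *)
Definition linear_graph (G : N -> W -> Prop) :=
  [/\ G 0 0, forall x y v w, G x v -> G y w -> G (x + y) (v + w),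
      forall a x v, G x v -> G (iota a *: x) (a *: v) &
      forall w, G 0 w -> w = 0].

(** A maximal partial map is defined at every n: the d such that it is defined at
    d n form an ideal with a generator d0, and dividing its value at d0 n by d0
    gives an admissible value at n. *)
Lemma divisible_extension G0 : linear_graph G0 ->
  exists chi : N -> W, [/\ forall x y, chi (x + y) = chi x + chi y,
    forall a x, chi (iota a *: x) = a *: chi x & forall x w, G0 x w -> chi x = w].
Proof.
move=> lG0; pose unc (G : N -> W -> Prop) p := G p.1 p.2.
pose Q (G : N * W -> Prop) := linear_graph (fun x w => G (x, w)) /\
  forall p, unc G0 p -> G p.
have [||F [A FA] FQ totF|G [lG G0G] maxG] := @Zorn_predicate _ Q (unc G0).
- by split.
- by exists (0, 0); case: lG0.
- split; last by move=> p G0p; exists A => //; case: (FQ A FA) => _; apply.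
  split.
  + by exists A => //; case: (FQ A FA) => -[].
  + move=> x y v w [G1 FG1 G1x] [G2 FG2 G2y].
    have [G12|G21] := totF _ _ FG1 FG2.
      exists G2 => //; case: (FQ G2 FG2) => -[_ GD _ _] _.
      by apply: GD => //; apply: G12.
    exists G1 => //; case: (FQ G1 FG1) => -[_ GD _ _] _.
    by apply: GD => //; apply: G21.
  + move=> a x v [G1 FG1 G1x]; exists G1 => //.
    by case: (FQ G1 FG1) => -[_ _ GZ _] _; apply: GZ.
  + move=> w [G1 FG1 G1w]; case: (FQ G1 FG1) => -[_ _ _ Gf] _.
    exact: Gf.
have [G_0 GD GZ Gf] := lG.
have GN x v : G (x, v) -> G (- x, - v).
  by move=> /(GZ (- 1)); rewrite rmorphN1 !scaleN1r.
have Gtotal n : exists w, G (n, w).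
  have [|d0 Id0] := pidD (I := fun d => exists w, G (iota d *: n, w)).
    split; first by exists 0; rewrite rmorph0 scale0r.
      move=> a b [v Gv] [w Gw]; exists (v + w).
      by rewrite rmorphD scalerDl; apply: GD.
    by move=> a b [w Gw]; exists (a *: w); rewrite rmorphM -scalerA; apply: GZ.
  have [w0 Gw0] : exists w, G (iota d0 *: n, w).
    by apply/Id0; exists 1; rewrite mul1r.
  have [w1 w1E] : exists w1, d0 *: w1 = w0.
    have [d00|] := eqVneq d0 0; last exact: divW.
    exists 0; rewrite scaler0; apply/esym/Gf.
    by move: Gw0; rewrite d00 rmorph0 scale0r.
  pose G' (p : N * W) :=
    exists d x w, G (x, w) /\ p = (x + iota d *: n, w + d *: w1).
  exists w1; apply: (maxG G').
  - split; first split.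
    + by exists 0, 0, 0; rewrite rmorph0 !scale0r !addr0.
    + move=> _ _ _ _ [a [x [v [Gx [-> ->]]]]] [b [y [w [Gy [-> ->]]]]].
      exists (a + b), (x + y), (v + w); split; first exact: GD.
      by rewrite rmorphD !scalerDl !addrA; congr (_, _);
        rewrite -!addrA; congr (_ + _); rewrite addrCA.
    + move=> a _ _ [b [x [v [Gx [-> ->]]]]]; exists (a * b), (iota a *: x), (a *: v).
      by split; [exact: GZ|rewrite rmorphM !scalerDr !scalerA].
    + move=> w [d [x [v [Gx [/esym/eqP]]]]]; rewrite addr_eq0 => /eqP xE ->.
      have [y dE] : exists y, d = y * d0.
        by apply/Id0; exists (- v); rewrite -[_ *: n]opprK -xE; apply: GN.
      apply: Gf; rewrite dE -scalerA w1E -(subrr x) {2}xE opprK dE rmorphM -scalerA.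
      by apply: GD => //; apply: GZ.
    + by move=> p G0p; exists 0, p.1, p.2; rewrite rmorph0 !scale0r !addr0 -surjective_pairing;
        split=> //; apply: G0G.
  - by move=> [x w] Gx; exists 0, x, w; rewrite rmorph0 !scale0r !addr0.
  - by exists 1, 0, 0; rewrite rmorph1 !scale1r !add0r.
have [chi Gchi] := choice Gtotal.
have chiE x w : G (x, w) -> chi x = w.
  move=> Gx; apply/eqP; rewrite -subr_eq0; apply/eqP/Gf.
  by rewrite -(subrr x); apply: GD => //; apply: GN.
exists chi; split.
- by move=> x y; apply/chiE/GD.
- by move=> a x; apply/chiE/GZ.
- by move=> x w G0x; apply/chiE/G0G.
Qed.

End Divisible.

(** B is a ring with pi D^n <= B <= D^n, and K is the fraction field of D.  The
    pairing (y, b) |-> sum_i omega_i y_i b_i makes K^n the dual of B with values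
    in K.  Being self-dual, B is also the
    dual of B with values in D, so that K^n / B is its dual with values in K / D.
    Both targets are divisible over D, hence injective, and the coinduced B-modules
    K^n and K^n / B are injective as well. *)
Section Resolution.
Variables (D B : comNzRingType) (K : fieldType) (n : nat).
Variables (iota : {rmorphism D -> B}) (kappa : {rmorphism D -> K}).
Variables (beta : 'I_n -> {rmorphism B -> K}) (pi : D) (omega : 'I_n -> K).
Hypothesis pidD : principal_ideals D.
Hypothesis kappa_inj : injective kappa.
Hypothesis beta_inj : forall b, (forall i, beta i b = 0) -> b = 0.
Hypothesis beta_iota : forall i d, beta i (iota d) = kappa d.
Hypothesis betaD : forall i b, exists d, beta i b = kappa d.
Hypothesis pi0 : pi != 0.
Hypothesis conductor : forall v : 'I_n -> D,
  exists b, forall i, beta i b = kappa (pi * v i).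
Hypothesis omega0 : forall i, omega i != 0.
Hypothesis self_dual : forall y : 'I_n -> K,
  (forall b, exists d, \sum_i omega i * y i * beta i b = kappa d) <->
  (exists b, forall i, y i = beta i b).

Let kappa_neq0 d : d != 0 -> kappa d != 0.
Proof. by rewrite -(rmorph0 kappa) (inj_eq kappa_inj). Qed.

Definition fieldD : Type := K.
HB.instance Definition _ := GRing.Zmodule.on fieldD.
Definition fieldD_scale (d : D) (x : fieldD) : fieldD := kappa d * (x : K).
Let fieldD_scaleA a b x : fieldD_scale a (fieldD_scale b x) = fieldD_scale (a * b) x.
Proof. by rewrite /fieldD_scale rmorphM mulrA. Qed.
Let fieldD_scale1 : left_id 1 fieldD_scale.
Proof. by move=> x; rewrite /fieldD_scale rmorph1 mul1r. Qed.
Let fieldD_scaleDr : right_distributive fieldD_scale +%R.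
Proof. by move=> a x y; rewrite /fieldD_scale -mulrDr. Qed.
Let fieldD_scaleDl x : {morph fieldD_scale^~ x : a b / a + b}.
Proof. by move=> a b; rewrite /fieldD_scale rmorphD mulrDl. Qed.
HB.instance Definition _ := GRing.Zmodule_isLmodule.Build D fieldD
  fieldD_scaleA fieldD_scale1 fieldD_scaleDr fieldD_scaleDl.

Definition fractions : Type := {ffun 'I_n -> K}.
HB.instance Definition _ := GRing.Zmodule.on fractions.
Definition fractions_scale (b : B) (y : fractions) : fractions :=
  [ffun i => beta i b * (y : {ffun _ -> _}) i].
Let fractions_scaleA a b x :
  fractions_scale a (fractions_scale b x) = fractions_scale (a * b) x.
Proof. by apply/ffunP => i; rewrite !ffunE rmorphM mulrA. Qed.
Let fractions_scale1 : left_id 1 fractions_scale.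
Proof. by move=> x; apply/ffunP => i; rewrite !ffunE rmorph1 mul1r. Qed.
Let fractions_scaleDr : right_distributive fractions_scale +%R.
Proof. by move=> a x y; apply/ffunP => i; rewrite !ffunE -mulrDr. Qed.
Let fractions_scaleDl x : {morph fractions_scale^~ x : a b / a + b}.
Proof. by move=> a b; apply/ffunP => i; rewrite !ffunE rmorphD mulrDl. Qed.
HB.instance Definition _ := GRing.Zmodule_isLmodule.Build B fractions
  fractions_scaleA fractions_scale1 fractions_scaleDr fractions_scaleDl.

Definition at_ (y : fractions) (i : 'I_n) : K := (y : {ffun _ -> _}) i.

Lemma at_D y z i : at_ (y + z) i = at_ y i + at_ z i.
Proof. exact: ffunE. Qed.

Lemma at_Z b y i : at_ (b *: y) i = beta i b * at_ y i.
Proof. exact: ffunE. Qed.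

Definition pairing (y : fractions) (b : B) : fieldD :=
  \sum_i omega i * at_ y i * beta i b.

Lemma pairingDl y z b : pairing (y + z) b = pairing y b + pairing z b.
Proof.
rewrite /pairing -big_split; apply: eq_bigr => i _.
by rewrite at_D mulrDr mulrDl.
Qed.

Lemma pairingZ a y b : pairing (a *: y) b = pairing y (a * b).
Proof.
rewrite /pairing; apply: eq_bigr => i _.
by rewrite at_Z rmorphM; ring.
Qed.

Lemma pairing_iota d y b : pairing y (iota d * b) = d *: pairing y b.
Proof.
rewrite /pairing [RHS]mulr_sumr; apply: eq_bigr => i _.
by rewrite rmorphM beta_iota; ring.
Qed.

Let unit_vector j : exists e, forall i, beta i e = kappa pi * (i == j)%:R.
Proof.
have [e eE] := conductor (fun i => (i == j)%:R).
by exists e => i; rewrite eE rmorphM rmorph_nat.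
Qed.

Let coordinates b : exists v : 'I_n -> D, forall i, beta i b = kappa (v i).
Proof. by have [v vE] := choice (fun i => betaD i b); exists v. Qed.

(** A B-linear map g to K^n is recovered from the D-linear form x |-> <g x, 1>,
    because the multiples by pi of the unit vectors lie in B; it is the form that
    is extended. *)
Lemma fractions_injective : injective_module fractions.
Proof.
move=> M N i g inji.
have [e eE] := choice unit_vector.
have divK d (w : fieldD) : d != 0 -> exists w', d *: w' = w.
  move=> d0; exists ((kappa d)^-1 * (w : K)).
  by rewrite /GRing.scale /= /fieldD_scale mulrA mulfV ?mul1r // kappa_neq0.
pose G0 x w := exists2 m, x = i m & w = pairing (g m) 1.
have [|chi [chiD chiZ chiG]] := @divisible_extension D B iota fieldD N pidD divK G0.
  split.
  - exists 0; rewrite ?linear0 // /pairing big1 // => j _.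
    by rewrite /at_ ffunE mulr0 mul0r.
  - move=> _ _ _ _ [m -> ->] [m' -> ->]; exists (m + m'); rewrite ?linearD //.
    by rewrite pairingDl.
  - move=> a _ _ [m -> ->]; exists (iota a *: m); rewrite ?linearZ //=.
    by rewrite pairingZ pairing_iota.
  - move=> w [m]; rewrite -(linear0 i) => /inji <- ->.
    rewrite linear0 /pairing big1 // => j _.
    by rewrite /at_ ffunE mulr0 mul0r.
pose h x : fractions := [ffun j => (chi (e j *: x) : K) / (kappa pi * omega j)].
have scale_e j b : exists2 d, e j * b = iota d * e j & kappa d = beta j b.
  have [v vE] := coordinates b; exists (v j); last by rewrite vE.
  apply/eqP; rewrite -subr_eq0; apply/eqP/beta_inj => l.
  rewrite rmorphB !rmorphM beta_iota vE eE; have [->|_] := eqVneq l j.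
    by rewrite mulr1 mulrC subrr.
  by rewrite !mulr0 mul0r subrr.
have hL : linear h.
  move=> a x y; apply/ffunP => j; rewrite [RHS]at_D at_Z /at_ !ffunE.
  rewrite scalerDr scalerA chiD; have [d -> dE] := scale_e j a.
  by rewrite -scalerA chiZ -dE [X in X + _]/(kappa d * _) mulrDl mulrA.
exists (make_linear hL) => m /=; apply/ffunP => j; rewrite ffunE.
rewrite -linearZ /= (chiG _ (pairing (g (e j *: m)) 1)); last by exists (e j *: m).
rewrite linearZ /= pairingZ mulr1 /pairing (bigD1 j) //= big1 ?addr0.
  rewrite eE eqxx mulr1 [kappa pi * _]mulrC [omega j * _]mulrC -[_ * omega j * _]mulrA mulfK //.
  by rewrite mulf_neq0 ?kappa_neq0.
by move=> l /negPf lj; rewrite eE lj !mulr0.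
Qed.

Let integral_submodule : submodule fieldD.
Proof.
exists (fun x : fieldD => exists d, x = kappa d :> K).
- by exists 0; rewrite rmorph0.
- by move=> _ _ [a ->] [b ->]; exists (a + b); rewrite rmorphD.
- by move=> c _ [a ->]; exists (c * a); rewrite rmorphM.
Defined.

Let ring_submodule : submodule fractions.
Proof.
exists (fun y => exists b, forall i, at_ y i = beta i b).
- by exists 0 => i; rewrite rmorph0 /at_ ffunE.
- by move=> x y [a aE] [b bE]; exists (a + b) => i; rewrite at_D aE bE rmorphD.
- by move=> c x [a aE]; exists (c * a) => i; rewrite at_Z aE rmorphM.
Defined.

Let polar := quotient integral_submodule.
Let rho : {linear fieldD -> polar} := @coset_of D fieldD integral_submodule.
Let classes := quotient ring_submodule.
Let proj : {linear fractions -> classes} := @coset_of B fractions ring_submodule.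

Let rho_eq x y : rho x = rho y <-> exists d, x - y = kappa d :> K.
Proof. exact: coset_of_eq. Qed.

Let proj_eq x y : proj x = proj y <-> exists b, forall i, at_ (x - y) i = beta i b.
Proof. exact: coset_of_eq. Qed.

Let pairing_inj y z : (forall b, rho (pairing y b) = rho (pairing z b)) <->
  proj y = proj z.
Proof.
have pairingB b : pairing y b - pairing z b = pairing (y - z) b.
  apply/eqP; rewrite subr_eq -pairingDl subrK //.
split=> [Eyz|/proj_eq/self_dual Eyz].
  apply/proj_eq/self_dual => b; have /rho_eq[d] := Eyz b.
  by rewrite pairingB => dE; exists d.
move=> b; apply/rho_eq; have [d dE] := Eyz b; exists d.
by rewrite pairingB.
Qed.

(** Likewise a B-linear map g to K^n / B is recovered from x |-> <g x, 1> with
    values in K / D.  Conversely an extended form chi defines for each x the form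
    b |-> chi (b x) on B; it extends to D^n, where it is given by the n values at
    the unit vectors, and so it is the pairing with an element of K^n. *)
Lemma classes_injective : injective_module classes.
Proof.
move=> M N i g inji.
have divP d (w : polar) : d != 0 -> exists w', d *: w' = w.
  move=> d0; exists (rho ((kappa d)^-1 * (quotient_val w : K))).
  rewrite -linearZ -[RHS]coset_ofK; congr (rho _).
  by rewrite /GRing.scale /= /fieldD_scale mulrA mulfV ?mul1r // kappa_neq0.
pose s (q : classes) : fractions := quotient_val q.
have sK q : proj (s q) = q by apply: coset_ofK.
pose chi0 m := rho (pairing (s (g m)) 1).
have chi0E m b y : proj y = g m -> chi0 (b *: m) = rho (pairing y b).
  move=> yE; rewrite /chi0 -[b in RHS]mulr1 -pairingZ; apply: (iffRL (pairing_inj _ _)).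
  by rewrite sK linearZ linearZ /= yE.
have chi0D m m' : chi0 (m + m') = chi0 m + chi0 m'.
  rewrite /chi0 -linearD -pairingDl; apply: (iffRL (pairing_inj _ _)).
  by rewrite sK !linearD /= !sK.
pose G0 x w := exists2 m, x = i m & w = chi0 m.
have [|chi [chiD chiZ chiG]] := @divisible_extension D B iota polar N pidD divP G0.
  split.
  - exists 0; rewrite ?linear0 //; apply: (addrI (chi0 0)).
    by rewrite -chi0D !addr0.
  - move=> _ _ _ _ [m -> ->] [m' -> ->]; exists (m + m').
      by rewrite linearD.
    by rewrite chi0D.
  - move=> a _ _ [m -> ->]; exists (iota a *: m); first by rewrite linearZ.
    rewrite (chi0E m _ _ (sK _)) -[iota a]mulr1 pairing_iota.
    by rewrite linearZ.
  - move=> w [m]; rewrite -(linear0 i) => /inji <- ->.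
    by apply: (addrI (chi0 0)); rewrite -chi0D !addr0.
have repr x : exists y, forall b, chi (b *: x) = rho (pairing y b).
  pose DN : lmodType D := {ffun 'I_n -> (D^o : lmodType D)}.
  pose H0 (v : DN) w :=
    exists2 b, forall j, beta j b = kappa (v j) & w = chi (b *: x).
  have [|psi [psiD psiZ psiH]] :=
      @divisible_extension D D idfun polar DN pidD divP H0.
    have chi0_0 : chi 0 = 0 by apply: (addrI (chi 0)); rewrite -chiD !addr0.
    split.
    - by exists 0; rewrite ?scale0r // => j; rewrite ffunE !rmorph0.
    - move=> u v _ _ [a aE ->] [b bE ->]; exists (a + b).
        by move=> j; rewrite ffunE !rmorphD aE bE.
      by rewrite scalerDl chiD.
    - move=> a u _ [b bE ->]; exists (iota a * b).
        by move=> j; rewrite ffunE rmorphM beta_iota bE -rmorphM.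
      by rewrite -scalerA chiZ.
    - move=> w [b bE ->]; rewrite (_ : b = 0) ?scale0r //.
      by apply: beta_inj => j; rewrite bE ffunE rmorph0.
  pose delta j : DN := [ffun l => (l == j)%:R : D].
  exists [ffun j => (quotient_val (psi (delta j)) : K) / omega j] => b.
  have [v vE] := coordinates b; pose u : DN := [ffun j => v j].
  rewrite -(psiH u (chi (b *: x))); last by exists b => // j; rewrite vE ffunE.
  have -> : u = \sum_j v j *: delta j.
    apply/ffunP => l; rewrite sum_ffunE (bigD1 l) //= big1 => [|j /negPf jl].
      by rewrite !ffunE eqxx addr0 /GRing.scale /= mulr1.
    by rewrite !ffunE eq_sym jl /GRing.scale /= mulr0.
  have psi_0 : psi 0 = 0 by apply: (addrI (psi 0)); rewrite -psiD !addr0.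
  rewrite (big_morph psi psiD psi_0) /pairing linear_sum; apply: eq_bigr => j _.
  have -> : omega j * at_ [ffun j => (quotient_val (psi (delta j)) : K) / omega j] j
      * beta j b = v j *: quotient_val (psi (delta j)) :> fieldD.
    by rewrite /at_ ffunE mulrCA mulfV // mulr1 vE mulrC.
  by rewrite linearZ /= [rho _]coset_ofK; apply: psiZ.
have [y yE] := choice repr.
have hL : linear (proj \o y).
  move=> a x x' /=; rewrite -linearZ -linearD; apply/pairing_inj => b.
  by rewrite pairingDl pairingZ linearD -!yE -chiD scalerDr scalerA mulrC.
exists (make_linear hL) => m /=.
rewrite -[RHS]sK; apply/pairing_inj => b; rewrite -yE -linearZ /=.
by rewrite (chiG _ (chi0 (b *: m))); [apply: chi0E; rewrite sK|exists (b *: m)].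
Qed.

Definition resolution_term (j : nat) : lmodType B :=
  match j with
  | 0 => (fractions : lmodType B)
  | 1 => (classes : lmodType B)
  | _ => 'rV[B]_0
  end.

Definition resolution_map (j : nat) :
    {linear resolution_term j -> resolution_term j.+1} :=
  match j return {linear resolution_term j -> resolution_term j.+1} with
  | 0 => proj
  | 1 => (\0 : {linear _ -> _})
  | _ => (\0 : {linear _ -> _})
  end.

Theorem self_dual_finite_injective_dimension : finite_injective_dimension B.
Proof.
pose eps (b : B^o) : fractions := [ffun i => beta i b].
have epsL : linear eps.
  move=> a x y; apply/ffunP => j; rewrite [RHS]at_D at_Z /at_ !ffunE.
  by rewrite rmorphD rmorphM.
exists 1%N, resolution_term, (make_linear epsL), resolution_map; split.
- case=> [|[|j]]; [exact: fractions_injective|exact: classes_injective|].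
  move=> M N i g inji; exists (\0 : {linear _ -> _}) => x.
  by apply/rowP => -[].
- move=> a b /= Eab; apply/eqP; rewrite -subr_eq0; apply/eqP/beta_inj => j.
  have := congr1 (fun z : fractions => at_ z j) Eab.
  by rewrite /at_ !ffunE rmorphB => ->; rewrite subrr.
- move=> x /=; rewrite -(linear0 proj); split=> [/proj_eq[b bE]|[a ->]].
    by exists b; apply/ffunP => j; rewrite ffunE -bE subr0.
  by apply/proj_eq; exists a => j; rewrite subr0 /at_ ffunE.
- case=> [|j] x /=; last first.
    split=> [_|_]; last by apply/rowP => -[].
    by case: j x => [|j] x; exists 0; apply/rowP => -[].
  split=> [_|_]; last by apply/rowP => -[].
  by exists (quotient_val x); rewrite [RHS]coset_ofK.
- by case=> [|[|j]] // x _; apply/rowP => -[].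
Qed.

End Resolution.

(** * Subrings of powers and the local rings of a line *)

(** Many rings below are rings of functions on finitely many lines, given by a
    condition on the n components; this turns such a condition into a ring. *)
Record power_subring (R : comNzRingType) (n : nat) := PowerSubring {
  in_power_subring :> ('I_n -> R) -> Prop;
  _ : (0 < n)%N;
  _ : in_power_subring (fun=> 1);
  _ : forall v w, in_power_subring v -> in_power_subring w ->
        in_power_subring (fun i => v i - w i);
  _ : forall v w, in_power_subring v -> in_power_subring w ->
        in_power_subring (fun i => v i * w i) }.

Section PowerSubring.
Variables (R : comNzRingType) (n : nat) (Q : power_subring R n).

Record subring_elt := SubringElt { subring_val : {ffun 'I_n -> R};
  _ : `[< Q subring_val >] }.
HB.instance Definition _ := [isSub for subring_val].
HB.instance Definition _ := [Choice of subring_elt by <:].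

Lemma subring_eltP x : Q (subring_val x).
Proof. by case: x => v /= /asboolP. Qed.

Let build (v : 'I_n -> R) (Qv : Q v) : subring_elt.
Proof.
exists [ffun i => v i]; apply/asboolP.
by rewrite (_ : fun_of_fin _ = v) //; apply/funext => i; rewrite ffunE.
Defined.

Let buildE v (Qv : Q v) i : subring_val (build Qv) i = v i.
Proof. exact: ffunE. Qed.

Let Q1 : Q (fun=> 1). Proof. by case: (Q). Qed.
Let QB v w : Q v -> Q w -> Q (fun i => v i - w i).
Proof. by case: (Q) => ? ? ? + ?; apply. Qed.
Let QM v w : Q v -> Q w -> Q (fun i => v i * w i).
Proof. by case: (Q) => ? ? ? ? +; apply. Qed.
Let Q0 : Q (fun=> 0).
Proof.
have := QB Q1 Q1; congr (Q _); apply/funext => i; exact: subrr.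
Qed.
Let QN v : Q v -> Q (fun i => - v i).
Proof.
move=> /(QB Q0); congr (Q _); apply/funext => i; exact: sub0r.
Qed.
Let QD v w : Q v -> Q w -> Q (fun i => v i + w i).
Proof.
move=> Qv /QN/(QB Qv); congr (Q _); apply/funext => i; by rewrite opprK.
Qed.

Let zero := build Q0.
Let one := build Q1.
Let opp x := build (QN (subring_eltP x)).
Let add x y := build (QD (subring_eltP x) (subring_eltP y)).
Let mul x y := build (QM (subring_eltP x) (subring_eltP y)).

Let eltP x y : (forall i, subring_val x i = subring_val y i) -> x = y.
Proof. by move=> Exy; apply/val_inj/ffunP. Qed.

Let addA : associative add.
Proof. by move=> x y z; apply: eltP => i; rewrite !buildE addrA. Qed.
Let addC : commutative add.
Proof. by move=> x y; apply: eltP => i; rewrite !buildE addrC. Qed.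
Let add0 : left_id zero add.
Proof. by move=> x; apply: eltP => i; rewrite !buildE add0r. Qed.
Let addN : left_inverse zero opp add.
Proof. by move=> x; apply: eltP => i; rewrite !buildE addNr. Qed.
HB.instance Definition _ := GRing.isZmodule.Build subring_elt addA addC add0 addN.

Let mulA : associative mul.
Proof. by move=> x y z; apply: eltP => i; rewrite !buildE mulrA. Qed.
Let mulC : commutative mul.
Proof. by move=> x y; apply: eltP => i; rewrite !buildE mulrC. Qed.
Let mul1 : left_id one mul.
Proof. by move=> x; apply: eltP => i; rewrite !buildE mul1r. Qed.
Let mulDl : left_distributive mul +%R.
Proof. by move=> x y z; apply: eltP => i; rewrite !buildE mulrDl. Qed.
Let one_neq0 : one != 0.
Proof.
have n_gt0 : (0 < n)%N by case: (Q).
apply/eqP => /(congr1 (fun x => subring_val x (Ordinal n_gt0))) /eqP.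
by rewrite !buildE oner_eq0.
Qed.
HB.instance Definition _ := GRing.Zmodule_isComNzRing.Build subring_elt
  mulA mulC mul1 mulDl one_neq0.

Definition subring_proj_fun i (x : subring_elt) : R := subring_val x i.

Let projB i : zmod_morphism (subring_proj_fun i).
Proof. by move=> x y; rewrite /subring_proj_fun !buildE. Qed.
Let projM i : monoid_morphism (subring_proj_fun i).
Proof. by split=> [|x y]; rewrite /subring_proj_fun !buildE. Qed.

Definition subring_proj i : {rmorphism subring_elt -> R} :=
  make_rmorphism (projB i) (projM i).

Lemma subring_proj_inj x y : (forall i, subring_proj i x = subring_proj i y) -> x = y.
Proof. exact: eltP. Qed.

Lemma subring_projP (v : 'I_n -> R) : Q v <-> exists x, forall i, subring_proj i x = v i.
Proof.
split=> [Qv|[x xE]]; first by exists (build Qv) => i; apply: buildE.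
by have := subring_eltP x; congr (Q _); apply/funext.
Qed.

Lemma subring_lift (C : comNzRingType) (f : 'I_n -> {rmorphism C -> R}) :
    (forall c, Q (fun i => f i c)) ->
  exists g : {rmorphism C -> subring_elt}, forall i c, subring_proj i (g c) = f i c.
Proof.
move=> Qf; pose g c := build (Qf c).
have gB : zmod_morphism g.
  by move=> x y; apply: eltP => i; rewrite !buildE rmorphB.
have gM : monoid_morphism g.
  by split=> [|x y]; apply: eltP => i; rewrite !buildE ?rmorph1 ?rmorphM.
by exists (make_rmorphism gB gM) => i c; apply: buildE.
Qed.

End PowerSubring.

Section Noetherian.

Lemma poly_principal (k : fieldType) : principal_ideals {poly k}.
Proof.
move=> I [I0 ID IM].
have [I_0|/existsNP[f0 /not_implyP[If0 /eqP f00]]] := pselect (forall f, I f -> f = 0).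
  exists 0 => f; split=> [/I_0->|[y ->]]; last by rewrite mulr0.
  by exists 0; rewrite mulr0.
have exn : exists m, `[< exists2 f, I f & f != 0 /\ size f = m >].
  by exists (size f0); apply/asboolP; exists f0.
case: (ex_minnP exn) => m /asboolP[f If [f_neq0 szf]] minm; exists f => g.
split=> [Ig|[y ->]]; last exact: IM.
exists (g %/ f); rewrite {1}(divp_eq g f).
suff -> : g %% f = 0 by rewrite addr0.
apply/eqP; apply: contraT => r0; have := minm (size (g %% f)).
rewrite -szf leqNgt ltn_modp f_neq0 => /(_ _)/negP[] //; apply/asboolP.
exists (g %% f) => //; rewrite (_ : g %% f = g + (- (g %/ f)) * f).
  by apply: ID => //; apply: IM.
by rewrite {2}(divp_eq g f) mulNr addrC addKr.
Qed.

(** By induction on the number m of coordinates that may be nonzero: the last of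
    them runs through a principal ideal. *)
Lemma submodule_finitely_generated (R : comNzRingType) n (U : ('I_n -> R) -> Prop) :
    principal_ideals R ->
    U (fun=> 0) -> (forall v w, U v -> U w -> U (fun i => v i + w i)) ->
    (forall a v, U v -> U (fun i => a * v i)) ->
  exists r (g : 'I_r -> 'I_n -> R), (forall j, U (g j)) /\
    forall v, U v -> exists c, forall i, v i = \sum_j c j * g j i.
Proof.
move=> pidR; suff H m : (m <= n)%N ->
    U (fun=> 0) -> (forall v w, U v -> U w -> U (fun i => v i + w i)) ->
    (forall a v, U v -> U (fun i => a * v i)) ->
    (forall v, U v -> forall i : 'I_n, (m <= i)%N -> v i = 0) ->
  exists r (g : 'I_r -> 'I_n -> R), (forall j, U (g j)) /\
    forall v, U v -> exists c, forall i, v i = \sum_j c j * g j i.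
  move=> U0 UD UM; apply: (H n) => // v _ i; by rewrite leqNgt ltn_ord.
elim: m U => [|m IHm] U lemn U0 UD UM Um.
  exists 0%N, (fun _ _ => 0); split=> [[]//|v Uv]; exists (fun=> 0) => i.
  by rewrite big_ord0 (Um v).
pose l : 'I_n := Ordinal lemn.
have [|a aE] := pidR (fun x => exists2 v, U v & v l = x).
  split; first by exists (fun=> 0).
    move=> _ _ [v Uv <-] [w Uw <-]; exists (fun i => v i + w i) => //; exact: UD.
  by move=> b _ [v Uv <-]; exists (fun i => b * v i) => //; apply: UM.
have [v0 Uv0 v0l] : exists2 v, U v & v l = a.
  by apply/aE; exists 1; rewrite mul1r.
have [||||r [g [Ug gE]]] := IHm (fun v => U v /\ v l = 0) (ltnW lemn).
- by split.
- by move=> v w [Uv vl] [Uw wl]; split; [apply: UD|rewrite vl wl addr0].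
- by move=> b v [Uv vl]; split; [apply: UM|rewrite vl mulr0].
- move=> v [Uv vl] i; rewrite leq_eqVlt => /predU1P[mi|]; last exact: Um.
  by rewrite -vl; congr v; apply: val_inj.
pose g' (j : 'I_r.+1) := if unlift ord0 j is Some j' then g j' else v0.
exists r.+1, g'; split=> [j|v Uv].
  by rewrite /g'; case: unliftP => [j' _|_] //; case: (Ug j').
have [y vl] : exists y, v l = y * a by apply/aE; exists v.
have Uw : U (fun i => v i + - y * v0 i) by apply: UD => //; apply: UM.
have [|c cE] := gE (fun i => v i + - y * v0 i).
  by split=> //; rewrite vl v0l mulNr subrr.
exists (fun j => if unlift ord0 j is Some j' then c j' else y) => i.
rewrite big_ord_recl /g' unlift_none; under eq_bigr => j _ do rewrite liftK.
by rewrite -cE mulNr addrC subrK.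
Qed.

End Noetherian.

Section FieldIdentities.
Variables (F : fieldType).
Implicit Types a b c f g u v w x y : F.

Lemma subf_div a b u v : u != 0 -> v != 0 -> a / u - b / v = (a * v - b * u) / (u * v).
Proof. by move=> u0 v0; field; rewrite u0 v0. Qed.

Lemma cancel_div x y a b u v : a != 0 -> u != 0 -> v != 0 ->
  x * y * (b / v) = x * b * u / (v * a) * (y * (a / u)).
Proof. by move=> a0 u0 v0; field; rewrite a0 u0 v0. Qed.

Lemma cancel_weight c x y : c != 0 -> x != 0 -> y = c^-1 * (c / x * y * x).
Proof. by move=> c0 x0; field; rewrite c0 x0. Qed.

Lemma clear_weight c x y a : x != 0 -> c / x * y * a * x = c * (y * a).
Proof. by move=> x0; field. Qed.

Lemma split_weight a b c u x : u != 0 -> x != 0 ->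
  c * a * b / (u * x) = c / x * (a / u) * b.
Proof. by move=> u0 x0; field; rewrite u0 x0. Qed.

Lemma cross_mul f g w u x : w != 0 -> u != 0 -> x != 0 ->
  g / (u * x) = f / w -> g * w = f * (u * x).
Proof.
move=> w0 u0 x0 E; rewrite -[g](divfK (mulf_neq0 u0 x0)) E.
by rewrite mulrAC divfK // mulrC.
Qed.
End FieldIdentities.

Section LocalRing.
Variables (k : fieldType) (c : k).
Local Notation K := {fraction {poly k}}.
Local Notation "x %:F" := (@FracField.tofrac {poly k} x).

Definition regular_at (x : K) :=
  exists a u : {poly k}, u.[c] != 0 /\ x = a%:F / u%:F.

Lemma tofrac_neq0 (u : {poly k}) : u.[c] != 0 -> u%:F != 0.
Proof.
by move=> uc; rewrite tofrac_eq0; apply: contra_neq uc => ->; rewrite horner0.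
Qed.

Lemma regular_at_poly f : regular_at f%:F.
Proof. by exists f, 1; rewrite hornerC oner_neq0 rmorph1 divr1. Qed.

Lemma regular_atM x y : regular_at x -> regular_at y -> regular_at (x * y).
Proof.
move=> [a [u [uc ->]]] [b [v [vc ->]]]; exists (a * b), (u * v).
by rewrite hornerM mulf_neq0 // !rmorphM invfM /= mulrACA.
Qed.

Lemma regular_atB x y : regular_at x -> regular_at y -> regular_at (x - y).
Proof.
move=> [a [u [uc ->]]] [b [v [vc ->]]]; exists (a * v - b * u), (u * v).
rewrite hornerM mulf_neq0 //; split=> //; rewrite rmorphB !rmorphM /=.
by rewrite subf_div ?tofrac_neq0.
Qed.

Definition local_subring : power_subring K 1.
Proof.
exists (fun v => regular_at (v ord0)) => //.
- by rewrite -[1](rmorph1 (@FracField.tofrac {poly k})); apply: regular_at_poly.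
- by move=> v w; apply: regular_atB.
- by move=> v w; apply: regular_atM.
Defined.

(** The local ring of the affine line at c. *)
Definition local_ring : comNzRingType := subring_elt local_subring.
Definition local_val : {rmorphism local_ring -> K} := subring_proj local_subring ord0.

Lemma local_val_inj : injective local_val.
Proof.
by move=> x y Exy; apply: subring_proj_inj => i; rewrite (ord1 i).
Qed.

Lemma local_valP x : regular_at x <-> exists d, local_val d = x.
Proof.
have := subring_projP local_subring (fun=> x); rewrite /= => -[xd dx]; split.
  by move/xd=> [d dE]; exists d; apply: dE.
by move=> [d dE]; apply: dx; exists d => i; rewrite (ord1 i).
Qed.

(** A nonzero element is a unit times a power of X - c, and an ideal is generated
    by an element for which this power is least. *)
Lemma local_ring_principal : principal_ideals local_ring.
Proof.
move=> I [I0 ID IM].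
pose order d m := exists a u : {poly k}, [/\ a.[c] != 0, u.[c] != 0 &
  local_val d = (('X - c%:P) ^+ m)%:F * (a%:F / u%:F)].
have has_order d : d != 0 -> exists m, order d m.
  move=> d0; have [a [u [uc dE]]] : regular_at (local_val d) by apply/local_valP; exists d.
  have [m [q qc aE]] := multiplicity_XsubC a c.
  have a0 : a != 0.
    apply: contra_neq d0 => a0; apply: local_val_inj.
    by rewrite dE a0 !rmorph0 mul0r.
  exists m, q, u; split=> //; first by move: qc; rewrite a0.
  by rewrite dE aE rmorphM; ring.
have [I_0|/existsNP[d0 /not_implyP[Id0 /eqP d00]]] := pselect (forall d, I d -> d = 0).
  exists 0 => f; split=> [/I_0->|[y ->]]; last by rewrite mulr0.
  by exists 0; rewrite mulr0.
have exn : exists m, `[< exists2 d, I d & order d m >].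
  by have [m d0m] := has_order d0 d00; exists m; apply/asboolP; exists d0.
case: (ex_minnP exn) => m /asboolP[d Id [a [u [ac uc dE]]]] minm; exists d => e.
split=> [Ie|[y ->]]; last exact: IM.
have [->|e0] := eqVneq e 0; first by exists 0; rewrite mul0r.
have [m' [a' [u' [ac' uc' eE]]]] := has_order e e0.
have lemm : (m <= m')%N.
  by apply: minm; apply/asboolP; exists e => //; exists a', u'.
have [y yE] : exists y, local_val y =
    (('X - c%:P) ^+ (m' - m) * a' * u)%:F / (u' * a)%:F.
  apply/local_valP; exists (('X - c%:P) ^+ (m' - m) * a' * u), (u' * a).
  by rewrite hornerM mulf_neq0.
exists y; apply: local_val_inj; rewrite rmorphM yE dE eE -(subnK lemm) exprD.
rewrite !rmorphM /= addnK.
exact: (cancel_div _ _ _ (tofrac_neq0 ac) (tofrac_neq0 uc) (tofrac_neq0 uc')).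
Qed.

End LocalRing.

(** * The cone over a weighted set of points *)

Section HomogeneousComponents.
Variables (k : closedFieldType) (m : nat).
Local Notation S := {mpoly k[m.+1]}.

(** Restriction to the line spanned by a turns homogeneous components into
    coefficients. *)
Lemma ray_coef (a : 'I_m.+1 -> k) (F : S) d :
  (arc_eval (fun j => a j *: 'X) F)`_d = (pihomog (@mdeg m.+1) d F).@[a].
Proof.
rewrite [F]mpolyE rmorph_sum coef_sum (raddf_sum (pihomog (@mdeg m.+1) d)) /=.
rewrite (raddf_sum (meval a)) /=; apply: eq_bigr => e _.
rewrite [pihomog _ _ _]linearZ /= mevalZ pihomogX -mul_mpolyC rmorphM [X in X * _]mmapC coefCM.
congr (_ * _); rewrite [arc_eval _ _]mmapX /mmap1.
have -> : \prod_(i < m.+1) (a i *: 'X) ^+ e i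
    = (\prod_(i < m.+1) a i ^+ e i) *: 'X^(mdeg e) :> {poly k}.
  rewrite mdegE -prodrXr -scaler_prod; apply: eq_bigr => i _.
  by rewrite exprZn.
rewrite coefZ coefXn eq_sym; case: eqP => _; first by rewrite mevalX mulr1.
by rewrite mulr0 meval0.
Qed.

Lemma pihomog_other d e (F : S) : homogeneous d F -> e != d ->
  pihomog (@mdeg m.+1) e F = 0.
Proof.
by move=> Fd ed; apply: (pihomog_ne0 _ Fd); rewrite eq_sym.
Qed.

Lemma ray_homogeneous (a : 'I_m.+1 -> k) d (F : S) : homogeneous d F ->
  arc_eval (fun j => a j *: 'X) F = F.@[a] *: 'X^d.
Proof.
move=> Fd; apply/polyP => e; rewrite ray_coef coefZ coefXn.
have [->|ed] := eqVneq e d; first by rewrite pihomog_dE // mulr1.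
by rewrite (pihomog_other Fd ed) meval0 mulr0.
Qed.

Lemma homogeneousM d e (F G : S) : homogeneous d F -> homogeneous e G ->
  homogeneous (d + e) (F * G).
Proof. exact: dhomogM. Qed.

Lemma homogeneousX i : homogeneous 1 ('X_i : S).
Proof. by rewrite /homogeneous dhomogX /= mdeg1. Qed.

Lemma homogeneousXn i e : homogeneous e ('X_i ^+ e : S).
Proof. by have := dhomogMn e (homogeneousX i); rewrite mul1n. Qed.

End HomogeneousComponents.

Section MaximalIdeals.
Variables (A : comNzRingType) (P : A -> Prop).
Hypothesis maxP : is_maximal P.

Lemma maximal_prime : is_prime P.
Proof.
have [idP P1 maxP'] := maxP.
have [//|//|x y -> ->|x Px x1|Q [prQ PQ Q1]] := @prime_avoiding A P (fun x => x = 1).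
- by rewrite mulr1.
- by apply: P1; rewrite -x1.
have QP : sub_ideal Q P by apply: maxP' => [|/Q1|]; first by case: prQ.
by split=> // x y /PQ; have [_ _ QM] := prQ; case/QM => /QP; [left|right].
Qed.

End MaximalIdeals.

Lemma sum_delta (R : comNzRingType) n (i : 'I_n) (a : 'I_n -> R) t :
  \sum_j a j * ((j == i)%:R * t) = a i * t.
Proof.
rewrite (bigD1 i) //= eqxx mul1r big1 ?addr0 // => j /negPf->.
by rewrite mul0r mulr0.
Qed.

Lemma dvdp_Xn (F : fieldType) n (f : {poly F}) :
  (forall d, (d < n)%N -> f`_d = 0) -> 'X^n %| f.
Proof.
move=> f0; apply/dvdpP; exists (drop_poly n f).
rewrite -{1}(poly_take_drop n f) (_ : take_poly n f = 0) ?add0r //.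
by apply/polyP => d; rewrite coef_take_poly coef0; case: ltnP => // /f0.
Qed.

Section CoordinateRing.
Variables (k : closedFieldType) (m N : nat) (p : 'M[k]_(N, m.+1)).
Local Notation S := {mpoly k[m.+1]}.
Local Notation K := {fraction {poly k}}.
Local Notation "x %:F" := (@FracField.tofrac {poly k} x).
Hypothesis N_gt0 : (0 < N)%N.
Hypothesis p0 : forall i, p i ord0 = 1.

Definition ray i : {rmorphism S -> {poly k}} := arc_eval (fun j => p i j *: 'X).

Lemma ray0 i : ray i 'X_ord0 = 'X.
Proof. by rewrite /ray arc_evalX p0 scale1r. Qed.

Definition ray_subring : power_subring {poly k} N.
Proof.
exists (fun v => exists F, forall i, v i = ray i F) => //.
- by exists 1 => i; rewrite rmorph1.
- by move=> v w [F FE] [G GE]; exists (F - G) => i; rewrite FE GE rmorphB.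
- by move=> v w [F FE] [G GE]; exists (F * G) => i; rewrite FE GE rmorphM.
Defined.

(** The homogeneous coordinate ring, as the ring of the functions that the
    polynomials induce on the N lines of the affine cone. *)
Definition cone_ring : comNzRingType := subring_elt ray_subring.
Local Notation A := cone_ring.
Definition on_ray i : {rmorphism A -> {poly k}} := subring_proj ray_subring i.

Lemma on_ray_inj x y : (forall i, on_ray i x = on_ray i y) -> x = y.
Proof. exact: subring_proj_inj. Qed.

Definition form_values d (a : 'I_N -> k) :=
  exists2 F : S, homogeneous d F & forall i, F.@[p i] = a i.

(** As the cone is homogeneous, a function on its lines can be tested degree by
    degree. *)
Lemma cone_ringP (v : 'I_N -> {poly k}) :
  (exists x, forall i, on_ray i x = v i) <-> forall d, form_values d (fun i => (v i)`_d).
Proof.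
rewrite -subring_projP; split=> [[F vE] d|Fv].
  exists (pihomog (@mdeg m.+1) d F); first exact: pihomogP.
  by move=> i; rewrite vE ray_coef.
have [F FE] := choice (fun d => (let: ex_intro2 F Fd FE := Fv d in
  ex_intro (fun F : S => homogeneous d F /\ forall i, F.@[p i] = (v i)`_d) F (conj Fd FE))).
exists (\sum_(d < \max_i size (v i)) F d) => i; apply/polyP => e.
rewrite rmorph_sum coef_sum.
have E d : (ray i (F d))`_e = (v i)`_e *+ (d == e).
  have [Fd FdE] := FE d; rewrite (ray_homogeneous _ Fd) FdE coefZ coefXn eq_sym.
  by case: eqP => [->|_]; rewrite ?mulr1 ?mulr0.
rewrite (eq_bigr (fun d : 'I_(\max_i size (v i)) => (v i)`_e *+ (d == e :> nat))); last first.
  by move=> d _; apply: E.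
have [lte|lee] := ltnP e (\max_i size (v i)).
  rewrite (bigD1 (Ordinal lte)) //= eqxx mulr1n big1 ?addr0 // => d.
  by rewrite -val_eqE /= => /negPf->.
rewrite nth_default; last by apply: leq_trans lee; apply: leq_bigmax.
by rewrite big1 // => d _; rewrite mul0rn.
Qed.

Lemma constant_on_rays f : exists x, forall i, on_ray i x = f.
Proof.
apply/cone_ringP => d; exists (f`_d *: 'X_ord0 ^+ d).
  by apply: dhomogZ; apply: homogeneousXn.
by move=> i; rewrite mevalZ rmorphXn /= mevalXU p0 expr1n mulr1.
Qed.

Lemma on_ray_const_term i j x : (on_ray i x).[0] = (on_ray j x).[0].
Proof.
have [F FE] := iffRL (subring_projP ray_subring (fun i => on_ray i x))
  (ex_intro _ x (fun=> erefl)).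
by rewrite !FE !arc_eval_horner; apply: meval_eq => l; rewrite !hornerE.
Qed.

Lemma coordinate_ring : exists pi : {rmorphism S -> A},
  is_coordinate_ring (points_ideal p) pi.
Proof.
have [|pi piE] := @subring_lift _ _ ray_subring S ray.
  by move=> F; exists F.
exists pi; split=> [x|F].
  have [F FE] := iffRL (subring_projP ray_subring (fun i => on_ray i x))
    (ex_intro _ x (fun=> erefl)).
  by exists F; apply: on_ray_inj => i; rewrite /on_ray piE -FE.
split=> [piF d i|VF].
  have := piE i F; rewrite piF rmorph0 => /esym rayF.
  by rewrite -[LHS]/(meval (p i) _) -ray_coef -/(ray i) rayF coef0.
apply: on_ray_inj => i; rewrite /on_ray piE rmorph0.
by apply/polyP => d; rewrite ray_coef coef0; apply: VF.
Qed.

Lemma cone_ring_noetherian : noetherian A.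
Proof.
move=> I [I0 ID IM].
pose U (v : 'I_N -> {poly k}) := exists2 x, I x & forall i, on_ray i x = v i.
have [c cE] := choice constant_on_rays.
have [|||r [g [Ug gE]]] := @submodule_finitely_generated _ N U (@poly_principal k).
- by exists 0 => // i; rewrite rmorph0.
- by move=> v w [x Ix xE] [y Iy yE]; exists (x + y) => [|i];
    [apply: ID|rewrite rmorphD xE yE].
- move=> a v [x Ix xE]; exists (c a * x) => [|i]; first exact: IM.
  by rewrite rmorphM xE cE.
have /choice[h hE] : forall j, exists x, I x /\ forall i, on_ray i x = g j i.
  by move=> j; have [x Ix xE] := Ug j; exists x.
exists r, h => x; split=> [Ix|[e ->]].
  have [|a aE] := gE (fun i => on_ray i x); first by exists x.
  exists (fun j => c (a j)); apply: on_ray_inj => i; rewrite aE rmorph_sum.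
  by apply: eq_bigr => j _; rewrite rmorphM cE (hE j).2.
by apply: ideal_sum => // j; apply: IM; case: (hE j).
Qed.

(** A maximal ideal contains the ideal of one of the lines, since the product of
    these ideals is zero, and a line has the coordinate ring k[t]. *)
Lemma maximal_cone_ring (P : A -> Prop) : is_maximal P ->
  exists i c, forall x, P x <-> (on_ray i x).[c] = 0.
Proof.
move=> mP; have [[P0 PD PZ] P1 maxP] := mP.
have [i kerP] : exists i, forall x, on_ray i x = 0 -> P x.
  apply: contrapT => nex.
  have /choice[x xE] : forall i, exists x, on_ray i x = 0 /\ ~ P x.
    move=> i; apply: contrapT => nx; apply: nex; exists i => x x0.
    by apply: contrapT => nPx; apply: nx; exists x.
  have /(prime_prod (maximal_prime mP))[i] : P (\prod_i x i).
    rewrite (_ : \prod_i x i = 0) //; apply: on_ray_inj => i.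
    by rewrite rmorph_prod rmorph0 (bigD1 i) // (xE i).1 /= mul0r.
  exact: (xE i).2.
have onto f : exists x, on_ray i x = f.
  by have [x xE] := constant_on_rays f; exists x.
have [|f fE] := poly_principal (I := fun f => exists2 x, P x & on_ray i x = f).
  split; first by exists 0; rewrite ?rmorph0.
    by move=> _ _ [x Px <-] [y Py <-]; exists (x + y); rewrite ?rmorphD //; apply: PD.
  move=> a _ [x Px <-]; have [y <-] := onto a.
  by exists (y * x); rewrite ?rmorphM //; apply: PZ.
have [c fc] : exists c, root f c.
  have [->|f0] := eqVneq f 0; first by exists 0; rewrite root0.
  apply/closed_rootP; apply: contra_notN P1 => /size_poly1P[a a0 Ef].
  have [x Px x1] : exists2 x, P x & on_ray i x = 1.
    apply/fE; exists (a^-1)%:P.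
    by rewrite Ef -polyCM mulVf.
  rewrite -[1](subrK x); apply: PD => //; apply: kerP.
  by rewrite rmorphB rmorph1 x1 subrr.
exists i, c; have PQ x : P x -> (on_ray i x).[c] = 0.
  move=> Px; have [y ->] : exists y, on_ray i x = y * f.
    by apply/fE; exists x.
  by rewrite hornerM (eqP fc) mulr0.
move=> x; split=> [/PQ//|]; apply: (maxP (fun x => (on_ray i x).[c] = 0)) => //.
- split; first by rewrite rmorph0 horner0.
    by move=> y z y0 z0; rewrite rmorphD hornerD y0 z0 addr0.
  by move=> a y y0; rewrite rmorphM hornerM y0 mulr0.
- by rewrite rmorph1 hornerC; apply/eqP; rewrite oner_eq0.
Qed.

Section Weights.
Variables (c : 'I_N -> k) (s : nat).
Hypothesis c0 : forall i, c i != 0.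
Hypothesis weights : forall e (G : S), (e < s)%N -> homogeneous e G ->
  \sum_i c i * G.@[p i] = 0.
Hypothesis dual : forall d (a : 'I_N -> k),
  (forall e (G : S), (e + d < s)%N -> homogeneous e G ->
     \sum_i c i * a i * G.@[p i] = 0) -> form_values d a.

Lemma form_values_all d a : (s <= d)%N -> form_values d a.
Proof. by move=> sd; apply: dual => e G; lia. Qed.

(** Outside of the vertex only one line matters: by [form_values_all], some function
    is t^s on it and zero on the other lines. *)
Lemma localization_off_vertex i (x : k) (P : A -> Prop) : x != 0 ->
    (forall b, P b <-> (on_ray i b).[x] = 0) ->
  exists phi : {rmorphism A -> local_ring x}, is_localization_at P phi.
Proof.
move=> x0 PE.
have [|phi phiE] := @subring_lift _ _ (local_subring x) A
    (fun=> (@FracField.tofrac {poly k} \o on_ray i : {rmorphism A -> K})).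
  by move=> b; apply: regular_at_poly.
have phiV b : local_val x (phi b) = (on_ray i b)%:F by apply: phiE.
exists phi; split=> [b nPb|z|b].
- have bx : (on_ray i b).[x] != 0 by apply/eqP => /PE.
  have [u uE] : exists u, local_val x u = 1%:F / (on_ray i b)%:F.
    by apply/local_valP; exists 1, (on_ray i b).
  exists u; apply: local_val_inj; rewrite rmorphM phiV uE rmorph1.
  by rewrite rmorph1 mulrC divfK // (tofrac_neq0 bx).
- have [f [u [ux zE]]] : regular_at x (local_val x z) by apply/local_valP; exists z.
  have [a aE] := constant_on_rays f; have [b bE] := constant_on_rays u.
  exists a, b; split; first by move/PE; rewrite bE; apply/eqP.
  apply: local_val_inj; rewrite rmorphM !phiV aE bE zE mulrC divfK //.
  exact: tofrac_neq0 ux.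
- have phi0 : phi b = 0 <-> on_ray i b = 0.
    split=> [b0|b0]; last by apply: local_val_inj; rewrite phiV b0 !rmorph0.
    by apply/eqP; rewrite -tofrac_eq0 -phiV b0 rmorph0.
  rewrite phi0; split=> [b0|[e [nPe eb]]].
    have [e eE] : exists e, forall j, on_ray j e = (j == i)%:R *: 'X^s.
      apply/cone_ringP => d; have [<-|sd] := eqVneq s d.
        exact: form_values_all.
      exists 0 => [|j]; first exact: dhomog0.
      by rewrite meval0 coefZ coefXn [d == s]eq_sym (negPf sd) mulr0.
    exists e; split.
      move/PE; rewrite eE eqxx scale1r hornerXn => /eqP.
      by rewrite expf_eq0 (negPf x0) andbF.
    apply: on_ray_inj => j; rewrite rmorphM rmorph0 eE.
    by have [->|_] := eqVneq j i; rewrite ?b0 ?mulr0 // scale0r mul0r.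
  have /eqP := congr1 (on_ray i) eb; rewrite rmorphM rmorph0 mulf_eq0.
  case/orP=> /eqP // e0; case: nPe; apply/PE.
  by rewrite e0 horner0.
Qed.

(** The case n = 1 of the resolution above, with the trivial form. *)
Lemma local_ring_finite_injective_dimension (x : k) :
  finite_injective_dimension (local_ring x).
Proof.
apply: (@self_dual_finite_injective_dimension (local_ring x) (local_ring x) K 1
  idfun (@local_val _ x) (fun=> @local_val _ x) 1 (fun=> 1)).
- exact: local_ring_principal.
- exact: local_val_inj.
- move=> b b0; apply: local_val_inj; rewrite rmorph0; exact: b0 ord0.
- by [].
- by move=> _ b; exists b.
- exact: oner_neq0.
- by move=> v; exists (v ord0) => i; rewrite mul1r (ord1 i).
- by move=> _; apply: oner_neq0.
- move=> y; split=> [/(_ 1)[d]|[b bE] b'].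
    rewrite big_ord1 rmorph1 mul1r mulr1 => yE; exists d => i.
    by rewrite (ord1 i).
  by exists (b * b'); rewrite big_ord1 mul1r bE rmorphM.
Qed.

(** The localization of the coordinate ring at its irrelevant ideal. *)
Definition vertex_fraction (v : 'I_N -> K) := exists (a : A) (u : {poly k}),
  u.[0] != 0 /\ forall i, v i = (on_ray i a)%:F / u%:F.

Definition vertex_subring : power_subring K N.
Proof.
exists vertex_fraction => //.
- exists 1, 1; rewrite hornerC oner_neq0; split=> // i.
  by rewrite !rmorph1 divr1.
- move=> v w [a [u [u0 vE]]] [b [v' [v0 wE]]].
  have [a' a'E] := constant_on_rays v'; have [b' b'E] := constant_on_rays u.
  exists (a * a' - b * b'), (u * v'); rewrite hornerM mulf_neq0 //; split=> // i.
  rewrite vE wE (subf_div _ _ (tofrac_neq0 u0) (tofrac_neq0 v0)).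
  rewrite (rmorphB (on_ray i)) !(rmorphM (on_ray i)) a'E b'E.
  by rewrite (rmorphB (@FracField.tofrac {poly k})) !(rmorphM (@FracField.tofrac {poly k})).
- move=> v w [a [u [u0 vE]]] [b [v' [v0 wE]]].
  exists (a * b), (u * v'); rewrite hornerM mulf_neq0 //; split=> // i.
  rewrite vE wE mulf_div (rmorphM (on_ray i)).
  by rewrite !(rmorphM (@FracField.tofrac {poly k})).
Defined.

Definition vertex_ring : comNzRingType := subring_elt vertex_subring.
Local Notation B := vertex_ring.
Definition vertex_val i : {rmorphism B -> K} := subring_proj vertex_subring i.

Lemma vertex_val_inj x y : (forall i, vertex_val i x = vertex_val i y) -> x = y.
Proof. exact: subring_proj_inj. Qed.

Lemma vertex_valP v : vertex_fraction v <-> exists x, forall i, vertex_val i x = v i.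
Proof. exact: subring_projP vertex_subring v. Qed.

(** The denominators in [vertex_fraction] are restricted to polynomials in t.  This is
    enough: a function b with nonzero value at the vertex is a root of the
    polynomial Q(T) = prod_j (T - b_j) over k[t], hence divides -Q(0), which is a
    unit near t = 0. *)
Lemma localization_at_vertex i (P : A -> Prop) :
    (forall b, P b <-> (on_ray i b).[0] = 0) ->
  exists phi : {rmorphism A -> B}, is_localization_at P phi.
Proof.
move=> PE; pose f j : {rmorphism A -> K} := @FracField.tofrac {poly k} \o on_ray j.
have [|phi phiE'] := @subring_lift _ _ vertex_subring A f.
  move=> b; exists b, 1; rewrite hornerC oner_neq0; split=> // j.
  by rewrite rmorph1 divr1.
have phiE j b : vertex_val j (phi b) = (on_ray j b)%:F by apply: phiE'.
have unit_off b : ~ P b -> exists u, phi b * u = 1.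
  move=> nPb; have b0 j : (on_ray j b).[0] != 0.
    by apply/eqP; rewrite (on_ray_const_term j i) => /PE.
  pose Q := \prod_j ('X - (on_ray j b)%:P).
  have [R QE] : exists R, Q - (Q.[0])%:P = R * 'X.
    have /factor_theorem[R] : root (Q - (Q.[0])%:P) 0.
      by rewrite /root !hornerE subrr.
    by rewrite subr0; exists R.
  pose u := - Q.[0].
  have u0 : u.[0] != 0.
    rewrite /u /Q horner_prod hornerN oppr_eq0 horner_prod; apply/prodf_neq0 => j _.
    by rewrite !hornerE oppr_eq0.
  have RE j : on_ray j b * R.[on_ray j b] = u.
    have := congr1 (horner^~ (on_ray j b)) QE.
    rewrite !hornerE horner_prod (bigD1 j) //= !hornerE subrr mul0r add0r.
    by rewrite mulrC => <-.
  have [a aE] : exists a, forall j, on_ray j a = R.[on_ray j b].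
    have [iota iotaE] := choice constant_on_rays.
    exists (\sum_(l < size R) iota R`_l * b ^+ l) => j.
    rewrite horner_coef rmorph_sum; apply: eq_bigr => l _.
    by rewrite rmorphM rmorphXn iotaE.
  have [v vE] : exists v, forall j, vertex_val j v = (on_ray j a)%:F / u%:F.
    by apply/vertex_valP; exists a, u.
  exists v; apply: vertex_val_inj => j.
  rewrite rmorphM phiE vE rmorph1 mulrA -rmorphM aE RE divff //.
  exact: tofrac_neq0 u0.
have phi_inj b : phi b = 0 -> b = 0.
  move=> b0; apply: on_ray_inj => j; apply/eqP.
  by rewrite rmorph0 -tofrac_eq0 -phiE b0 rmorph0.
exists phi; split=> [//|z|b].
- have [a [u [u0 zE]]] : vertex_fraction (fun j => vertex_val j z).
    by apply/vertex_valP; exists z.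
  have [b bE] := constant_on_rays u.
  exists a, b; split; first by move/PE; rewrite bE; apply/eqP.
  apply: vertex_val_inj => j; rewrite rmorphM !phiE bE zE mulrC divfK //.
  exact: tofrac_neq0 u0.
- split=> [/phi_inj->|[e [/unit_off[u eu] eb]]].
    exists 1; rewrite mulr0; split=> // /PE.
    by rewrite rmorph1 hornerC; apply/eqP/oner_neq0.
  rewrite -[phi b]mul1r -eu mulrAC -rmorphM eb rmorph0 mul0r //.
Qed.

Let tnz : ('X : {poly k})%:F != 0.
Proof. by rewrite tofrac_eq0 polyX_eq0. Qed.

Let Xs_neq0 e : ('X^e : {poly k})%:F != 0.
Proof. by rewrite rmorphXn expf_neq0. Qed.

(** Self-duality of the local ring for the weights c_i / t^s.  The values of the form
    on it lie in D because of the relation between the values of forms of degree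
    less than s.  Conversely let y be integral against all b.  Testing it on
    functions supported on one line shows that its components are in D.  Testing
    it on the forms of degree e, with e + d < s, shows that the coefficients of t^d
    in the numerators of y satisfy the hypothesis of duality, hence are the values
    of a form of degree d. *)
Lemma vertex_ring_finite_injective_dimension : finite_injective_dimension B.
Proof.
pose D := local_ring (0 : k).
have [|iota iotaE'] := @subring_lift _ _ vertex_subring D (fun=> @local_val _ 0).
  move=> d; have [f [u [u0 dE]]] : regular_at 0 (local_val 0 d).
    by apply/local_valP; exists d.
  have [a aE] := constant_on_rays f.
  by exists a, u; split=> // i; rewrite aE.
have iotaE i d : vertex_val i (iota d) = local_val 0 d by apply: iotaE'.
have [pi piE] : exists pi : D, local_val 0 pi = ('X ^+ s)%:F.
  by apply/local_valP; apply: regular_at_poly.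
have common (y : 'I_N -> K) : (forall i, regular_at 0 (y i)) ->
    exists2 u : {poly k}, u.[0] != 0 &
    exists a : 'I_N -> {poly k}, forall i, y i = (a i)%:F / u%:F.
  move=> ry; have /choice[w wE] : forall i, exists w : {poly k} * {poly k},
      w.2.[0] != 0 /\ y i = w.1%:F / w.2%:F.
    by move=> i; have [a [u au]] := ry i; exists (a, u).
  exists (\prod_i (w i).2).
    by rewrite horner_prod; apply/prodf_neq0 => i _; case: (wE i).
  exists (fun i => (w i).1 * \prod_(j | j != i) (w j).2) => i.
  have [_ ->] := wE i; set q := \prod_(j | j != i) _.
  have -> : \prod_j (w j).2 = (w i).2 * q by rewrite (bigD1 i).
  have q0 : q%:F != 0.
    apply: (tofrac_neq0 (c := 0)); rewrite horner_prod; apply/prodf_neq0 => j _.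
    by case: (wE j).
  rewrite !(rmorphM (@FracField.tofrac {poly k})) -mulf_div (divff q0).
  exact: esym (mulr1 _).
have shifted (a : 'I_N -> {poly k}) : exists x : A,
    forall i, on_ray i x = a i * 'X ^+ s.
  apply/cone_ringP => d; have [sd|ds] := leqP s d; first exact: form_values_all.
  exists 0; first exact: dhomog0.
  by move=> i; rewrite meval0 coefMXn ds.
apply: (@self_dual_finite_injective_dimension D B K N iota (@local_val _ 0)
  vertex_val pi (fun i => (c i)%:P%:F / ('X ^+ s)%:F)).
- exact: local_ring_principal.
- exact: local_val_inj.
- by move=> b b0; apply: vertex_val_inj => i; rewrite b0 rmorph0.
- exact: iotaE.
- move=> i b; have [a [u [u0 bE]]] : vertex_fraction (fun j => vertex_val j b).
    by apply/vertex_valP; exists b.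
  have [d dE] : exists d : D, local_val 0 d = (on_ray i a)%:F / u%:F.
    by apply/local_valP; exists (on_ray i a), u.
  by exists d; rewrite bE dE.
- apply/eqP => pi_0; have := tnz; apply/negP/negPn.
  by have := piE; rewrite pi_0 rmorph0 rmorphXn => /esym/eqP; rewrite expf_eq0 => /andP[].
- move=> v; have [|u u0 [a aE]] := common (fun i => local_val 0 (v i)).
    by move=> i; apply/local_valP; exists (v i).
  have [x xE] := shifted a.
  have /vertex_valP[b bE] : vertex_fraction (fun i => (on_ray i x)%:F / u%:F).
    by exists x, u.
  exists b => i; rewrite bE xE (rmorphM (local_val 0)) piE aE.
  by rewrite (rmorphM (@FracField.tofrac {poly k})) -mulrA mulrCA.
- move=> i; rewrite mulf_neq0 ?invr_eq0 ?tofrac_eq0 ?polyC_eq0 //.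
  by rewrite expf_eq0 polyX_eq0 andbF.
move=> y; split=> [yD|[b0 yE] b].
- have y_reg i : regular_at 0 (y i).
    have [x xE] := shifted (fun j => (j == i)%:R).
    have /vertex_valP[b bE] : vertex_fraction (fun j => (on_ray j x)%:F / 1%:F).
      by exists x, 1; rewrite hornerC oner_neq0.
    have [d dE] := yD b.
    have ci : ((c i)%:P)%:F != 0 by rewrite tofrac_eq0 polyC_eq0.
    have [e eE] : exists e : D, local_val 0 e = ((c i)^-1%:P)%:F.
      by apply/local_valP; apply: regular_at_poly.
    apply/local_valP; exists (e * d); rewrite rmorphM -dE eE.
    have bE' j : vertex_val j b = (j == i)%:R * ('X^s)%:F.
      rewrite bE xE (rmorphM (@FracField.tofrac {poly k})) rmorph1 divr1.
      by rewrite rmorph_nat.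
    rewrite (eq_bigr _ (fun j _ => congr1 _ (bE' j))) sum_delta.
    have -> : ((c i)^-1%:P)%:F = (((c i)%:P)%:F)^-1.
      apply: (mulfI ci); rewrite (mulfV ci).
      by rewrite -(rmorphM (@FracField.tofrac {poly k})) -polyCM (mulfV (c0 i)) !rmorph1.
    exact: esym (cancel_weight _ ci (Xs_neq0 _)).
  have [u u0 [a aE]] := common y y_reg.
  have /cone_ringP[x xE] : forall d, form_values d (fun i => (a i)`_d).
    move=> d; apply: dual => e G ed Ge.
    have [z zE] : exists z : A, forall i, on_ray i z = G.@[p i] *: 'X^e.
      apply/(subring_projP ray_subring (fun i => G.@[p i] *: 'X^e)); exists G => i.
      by rewrite (ray_homogeneous _ Ge).
    have /vertex_valP[b bE] : vertex_fraction (fun j => (on_ray j z)%:F / 1%:F).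
      by exists z, 1; rewrite hornerC oner_neq0.
    have [l lE] := yD b.
    have [f [w [w0 fE]]] : regular_at 0 (local_val 0 l) by apply/local_valP; exists l.
    pose g := \sum_i (c i * G.@[p i])%:P * a i.
    have gE : g * 'X^e * w = f * (u * 'X^s).
      apply/eqP; rewrite -tofrac_eq !rmorphM /=; apply/eqP.
      apply: (cross_mul (tofrac_neq0 w0) (tofrac_neq0 u0) (Xs_neq0 s)).
      rewrite -rmorphM -fE -lE mulr_suml rmorph_sum mulr_suml.
      apply: eq_bigr => i _; rewrite aE bE zE rmorph1 divr1 -mul_polyC.
      rewrite -[RHS](split_weight _ _ _ (tofrac_neq0 u0) (Xs_neq0 s)).
      by rewrite -!rmorphM polyCM; congr (_%:F / _); ring.
    have Xg : 'X^(s - e) %| g.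
      have cop : coprimep 'X^(s - e) w.
        by apply: coprimep_expl; rewrite coprimep_sym coprimepX.
      rewrite -(Gauss_dvdpl _ cop); apply/dvdpP; exists (f * u).
      have Xe : 'X^e != 0 :> {poly k} by rewrite expf_eq0 polyX_eq0 andbF.
      apply: (mulIf Xe); rewrite mulrAC gE -!mulrA -exprD subnK //; lia.
    have gd : g`_d = 0.
      by have /dvdpP[q ->] := Xg; rewrite coefMXn ifT //; lia.
    rewrite -[RHS]gd /g coef_sum; apply: eq_bigr => i _.
    by rewrite coefCM mulrAC.
  have /vertex_valP[b bE] : vertex_fraction y.
    by exists x, u; split=> // i; rewrite aE xE.
  by exists b => i; rewrite bE.
- have [x [u [u0 xE]]] : vertex_fraction (fun i => vertex_val i (b0 * b)).
    by apply/vertex_valP; exists (b0 * b).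
  have [g gE] : exists g, \sum_i (c i)%:P * on_ray i x = g * 'X^s.
    apply/dvdpP; apply/dvdp_Xn => d ds.
    have [F Fd FE] := iffLR (cone_ringP _) (ex_intro _ x (fun=> erefl)) d.
    rewrite coef_sum -[RHS](weights ds Fd); apply: eq_bigr => i _.
    by rewrite coefCM FE.
  have [l lE] : exists l : D, local_val 0 l = g%:F / u%:F.
    by apply/local_valP; exists g, u.
  exists l; rewrite lE; apply: (mulIf (Xs_neq0 s)).
  rewrite mulrAC -rmorphM -gE rmorph_sum !mulr_suml; apply: eq_bigr => i _.
  rewrite yE (clear_weight _ _ _ (Xs_neq0 s)) -(rmorphM (vertex_val i)) xE.
  by rewrite (rmorphM (@FracField.tofrac {poly k})) mulrA.
Qed.

Lemma cone_ring_gorenstein : gorenstein A.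
Proof.
split; first exact: cone_ring_noetherian.
move=> P /maximal_cone_ring[i [x PE]]; have [x0|x0] := eqVneq x 0.
  rewrite x0 in PE; have [phi phiP] := localization_at_vertex PE.
  exists B, phi; split=> //; exact: vertex_ring_finite_injective_dimension.
have [phi phiP] := localization_off_vertex x0 PE.
exists (local_ring x), phi; split=> //.
exact: local_ring_finite_injective_dimension.
Qed.

End Weights.
End CoordinateRing.

(** * Linked sets of points *)

Section PointSchemes.
Variables (k : closedFieldType) (m : nat).
Local Notation S := {mpoly k[m.+1]}.

Definition affine_points n (p : 'M[k]_(n, m.+1)) :=
  (forall i, p i ord0 = 1) /\ (forall i j, (forall l, p i l = p j l) -> i = j).

Lemma points_idealP n (p : 'M[k]_(n, m.+1)) F :
  points_ideal p F <-> forall i, ray p i F = 0.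
Proof.
split=> VF i; last by move=> j; have := VF j; rewrite /ray => /(congr1 (fun f : {poly k} => f`_i));
  rewrite ray_coef coef0.
by apply/polyP => d; rewrite ray_coef coef0; apply: VF.
Qed.

Lemma points_ideal_homogeneousP n (p : 'M[k]_(n, m.+1)) d F : homogeneous d F ->
  (points_ideal p F <-> forall i, F.@[p i] = 0).
Proof.
move=> Fd; split=> [VF i|F0].
  by have := VF d i; rewrite pihomog_dE.
apply/points_idealP => i; rewrite /ray (ray_homogeneous _ Fd).
by rewrite (_ : F.@[_] = 0) ?scale0r //; apply: F0.
Qed.

Section Points.
Variables (n : nat) (p : 'M[k]_(n, m.+1)).
Hypothesis affp : affine_points p.
Local Notation V := (points_ideal p).

Lemma points_ideal_is_ideal : is_ideal V.
Proof.
split; first by apply/points_idealP => i; rewrite rmorph0.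
  move=> F G /points_idealP VF /points_idealP VG; apply/points_idealP => i.
  by rewrite rmorphD VF VG addr0.
move=> F G /points_idealP VG; apply/points_idealP => i.
by rewrite rmorphM VG mulr0.
Qed.

Lemma points_ideal_closed : closed_subscheme V.
Proof.
split; first split; first exact: points_ideal_is_ideal.
  move=> d F VF e i; have [->|ed] := eqVneq e d.
    by rewrite pihomog_id; apply: VF.
  by rewrite (pihomog_other (pihomogP _ _ _) ed) meval0.
move=> F [N VN]; apply/points_idealP => i.
have /points_idealP/(_ i) := VN _ (homogeneousXn k ord0 N).
rewrite rmorphM rmorphXn ray0; last by case: affp.
by move=> /eqP; rewrite mulf_eq0 expf_eq0 polyX_eq0 andbF => /eqP.
Qed.

Lemma point_scheme_point i : scheme_point (fun F => ray p i F = 0).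
Proof.
have idV : is_ideal (fun F => ray p i F = 0).
  split=> [|F G F0 G0|F G G0]; first by rewrite rmorph0.
    by rewrite rmorphD F0 G0 addr0.
  by rewrite rmorphM G0 mulr0.
split.
- split=> // d F F0; apply/polyP => e; rewrite ray_coef coef0.
  have [->|ed] := eqVneq e d; last first.
    by rewrite (pihomog_other (pihomogP _ _ _) ed) meval0.
  by rewrite pihomog_id -ray_coef -/(ray p i) F0 coef0.
- split=> //; first by rewrite rmorph1; apply/eqP; rewrite oner_eq0.
  by move=> F G; rewrite rmorphM => /eqP; rewrite mulf_eq0 => /orP[]/eqP; [left|right].
- exists ord0; rewrite ray0; last by case: affp.
  by apply/eqP; rewrite polyX_eq0.
Qed.

Lemma linear_form_ray i j l :
  ray p i ('X_l - p j l *: 'X_ord0) = (p i l - p j l) *: 'X.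
Proof.
have [p0 _] := affp.
by rewrite rmorphB -mul_mpolyC rmorphM /ray !arc_evalX arc_evalC p0 scale1r mul_polyC scalerBl.
Qed.

(** A prime containing the ideal of the points contains the ideal of one of them.  It
    is not larger: a form outside the ideal of the point is a nonzero multiple of
    a power of x_0 modulo this ideal, so that a larger prime contains x_0 and with
    it all the variables. *)
Lemma scheme_point_over P : scheme_point P -> sub_ideal V P ->
  exists i, forall F, P F <-> ray p i F = 0.
Proof.
move=> [[[P0 PD PZ] Phom] prP [l nPl]] VP; have [p0 _] := affp.
have [i kerP] : exists i, forall F, ray p i F = 0 -> P F.
  apply: contrapT => nex.
  have /choice[G GE] : forall i, exists F, ray p i F = 0 /\ ~ P F.
    move=> i; apply: contrapT => nF; apply: nex; exists i => F F0.
    by apply: contrapT => nPF; apply: nF; exists F.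
  have /(prime_prod prP)[i] : P (\prod_i G i).
    apply/VP/points_idealP => i.
    by rewrite rmorph_prod (bigD1 i) // (GE i).1 /= mul0r.
  exact: (GE i).2.
exists i => F; split=> [PF|]; last exact: kerP.
apply/polyP => d; rewrite ray_coef coef0; apply/eqP; apply: contra_notT nPl => Fd0.
have PX0 : P 'X_ord0.
  apply: (primeX prP (n := d)).
  have -> : 'X_ord0 ^+ d = ((pihomog mdeg d F).@[p i])^-1%:MP * (pihomog (@mdeg m.+1) d F
      - (pihomog mdeg d F - (pihomog mdeg d F).@[p i] *: 'X_ord0 ^+ d)).
    by rewrite subKr -mul_mpolyC mulrA -mpolyCM mulVf // mul1r.
  apply: PZ; apply: (primeB prP); first exact: Phom.
  apply: kerP; rewrite rmorphB (ray_homogeneous _ (pihomogP _ _ _)).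
  rewrite -mul_mpolyC rmorphM rmorphXn ray0 // /ray arc_evalC mul_polyC subrr //.
rewrite -['X_l](subrK (p i l *: 'X_ord0)); apply: PD.
  by apply: kerP; rewrite linear_form_ray subrr scale0r.
by rewrite -mul_mpolyC; apply: PZ.
Qed.

Lemma point_ideal_inj i j :
  (forall F, ray p i F = 0 -> ray p j F = 0) -> i = j.
Proof.
move=> Iij; apply: affp.2 => l; apply/esym/eqP; rewrite -subr_eq0.
have := Iij _ (_ : ray p i ('X_l - p i l *: 'X_ord0) = 0).
rewrite !linear_form_ray subrr scale0r => /(_ erefl)/eqP.
by rewrite scaler_eq0 polyX_eq0 orbF.
Qed.

Lemma no_chain P : sub_ideal V P -> ~ has_chain P 1.
Proof.
move=> VP [Q [Qpt Qlt]].
have [spt0 P0] := Qpt 0%N isT; have [spt1 P1] := Qpt 1%N isT.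
have [|i Ei] := scheme_point_over spt0; first by move=> F /VP/P0.
have [|j Ej] := scheme_point_over spt1; first by move=> F /VP/P1.
have [Q01 nQ10] := Qlt 0%N isT; apply: nQ10 => F /Ej Fj; apply/Ei.
by rewrite (@point_ideal_inj i j) // => G /Ei/Q01/Ej.
Qed.

Hypothesis n_gt0 : (0 < n)%N.

Lemma points_dimension : dimension V 0.
Proof.
split; last by apply: no_chain => F.
exists (fun _ F => ray p (Ordinal n_gt0) F = 0); split=> // _ _.
by split; [exact: point_scheme_point|move=> F /points_idealP].
Qed.

Lemma points_liaison_scheme : liaison_scheme 0 V.
Proof.
split; first exact: points_ideal_closed.
- split; first exact: points_dimension.
  move=> P [spP VP _]; split; last exact: no_chain.
  by exists (fun=> P); split=> // _ _; split=> // F.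
- move=> P [spP [d [f [_ Pf]]]].
  have VP : sub_ideal V P.
    move=> F VF; apply/Pf; rewrite mulrC.
    by have [_ _ VZ] := points_ideal_is_ideal; apply: VZ.
  split=> // Q spQ VQ QP; have [i Ei] := scheme_point_over spP VP.
  have [j Ej] := scheme_point_over spQ VQ => F /Ei Fi; apply/Ej.
  by rewrite (@point_ideal_inj j i) // => G /Ej/QP/Ei.
Qed.

End Points.

(** A product of linear forms, one through each of the points p_i. *)
Lemma separate_point n (p : 'M[k]_(n, m.+1)) (x : 'I_m.+1 -> k) :
    (forall i, p i ord0 = 1) -> x ord0 = 1 ->
    (forall i, exists l, p i l != x l) ->
  exists d G, [/\ homogeneous d G, points_ideal p G & G.@[x] != 0].
Proof.
move=> p0 x0 /choice[l lE].
pose G : S := \prod_i ('X_(l i) - p i (l i) *: 'X_ord0).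
have Gev (y : 'I_m.+1 -> k) : G.@[y] = \prod_i (y (l i) - p i (l i) * y ord0).
  rewrite rmorph_prod; apply: eq_bigr => i _.
  by rewrite /= mevalB mevalZ !mevalXU.
have Gd : homogeneous n G.
  rewrite /G; have := homogeneousXn k (m := m) ord0 0.
  have H (r : seq 'I_n) : homogeneous (size r)
      (\prod_(i <- r) ('X_(l i) - p i (l i) *: 'X_ord0) : S).
    elim: r => [|i r IHr]; first by rewrite big_nil; apply: dhomog1.
    rewrite big_cons -[size _]/(1 + size r)%N; apply: homogeneousM => //.
    rewrite /homogeneous rpredB //; first exact: homogeneousX.
    by apply: dhomogZ; apply: homogeneousX.
  by have := H (index_enum 'I_n); rewrite /index_enum -enumT size_enum_ord.
exists n, G; split=> //.
  apply/(points_ideal_homogeneousP _ Gd) => i.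
  by rewrite Gev (bigD1 i) //= p0 mulr1 subrr mul0r.
by rewrite Gev; apply/prodf_neq0 => i _; rewrite x0 mulr1 subr_eq0 eq_sym.
Qed.

Section SheafIsomorphism.
Local Notation K := {fraction S}.
Local Notation "x %:F" := (@FracField.tofrac S x).
Variables (V X : S -> Prop) (n : nat) (q : 'M[k]_(n, m.+1)).
Local Notation W := (points_ideal q).
Hypothesis idV : is_ideal V.
Hypothesis XE : forall F, X F <-> V F /\ W F.
Hypothesis sep : forall j, exists d G, [/\ homogeneous d G, V G & G.@[q j] != 0].

Let cross (F : fieldType) (a b c x y z : F) : x != 0 -> y != 0 -> z != 0 ->
  a / x * (b / y) = c / z -> a * b * z = c * (x * y).
Proof.
move=> x0 y0 z0 E; rewrite -[a](divfK x0) -[b](divfK y0) mulrACA E.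
by rewrite mulrAC divfK.
Qed.

Lemma ideal_sectionsM f (V1 V2 V3 : S -> Prop) x y :
    (forall a b, V1 a -> V2 b -> V3 (a * b)) ->
    ideal_sections f V1 x -> ideal_sections f V2 y -> ideal_sections f V3 (x * y).
Proof.
move=> VVV [e [a [ah Va ->]]] [d [b [bh Vb ->]]]; exists (e + d)%N, (a * b); split.
- by rewrite mulnDl; apply: homogeneousM.
- exact: VVV.
- by rewrite mulf_div rmorphM exprD.
Qed.

Lemma ideal_sections0 f (V1 : S -> Prop) : V1 0 -> ideal_sections f V1 0.
Proof.
move=> V10; exists 0%N, 0; split=> //; last by rewrite rmorph0 mul0r.
exact: dhomog0.
Qed.

(** A section that carries the ideal of V into that of X vanishes at each q_j, where
    some element of the ideal of V does not vanish. *)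
Lemma sections_annihilator f x : basic_open f -> regular_sections f x ->
    (forall y, ideal_sections f V y -> ideal_sections f X (y * x)) ->
  ideal_sections f W x.
Proof.
move=> [f0 fd fh] [e [a [ah _ xE]]] xV.
have fF0 r : f%:F ^+ r != 0 by rewrite expf_neq0 // tofrac_eq0.
have fah : homogeneous (e.+1 * degree f) (f * a).
  by rewrite mulSn; apply: homogeneousM.
exists e.+1, (f * a); split=> //; last first.
  rewrite xE rmorphM exprS -mulf_div divff ?mul1r //.
  by have := fF0 1%N; rewrite expr1.
apply/(points_ideal_homogeneousP _ fah) => j.
have [fj|fj] := eqVneq f.@[q j] 0; first by rewrite mevalM fj mul0r.
have [d [G [Gd VG Gj]]] := sep j.
have VGf : V (G ^+ degree f).
  rewrite -(ltn_predK fd) exprS mulrC; case: idV => _ _; apply.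
  exact: VG.
have [|r [b [bh /XE[_ Wb]]]] := xV (( G ^+ degree f)%:F / f%:F ^+ d).
  exists d, (G ^+ degree f); split=> //.
  exact: dhomogMn.
rewrite xE => /(cross (fF0 _) (fF0 _) (fF0 _)) /eqP.
rewrite -!rmorphXn -!rmorphM tofrac_eq => /eqP /(congr1 (meval (q j))).
rewrite !mevalM (iffLR (points_ideal_homogeneousP _ bh) Wb) mul0r.
rewrite !rmorphXn /= => /eqP; rewrite !mulf_eq0 !expf_eq0 (negPf Gj) (negPf fj).
by rewrite !andbF !orbF => /eqP->; rewrite mulr0.
Qed.

(** The product of the ideals of V and W is contained in that of X, so that sections
    of the second act by multiplication on the sections of O_V; every
    homomorphism h is multiplication by h 1. *)
Lemma multiplication_sheaf_iso : ideal_sheaf_iso_hom V W X.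
Proof.
exists (fun f x y => x * y).
have [V0 VD VZ] := idV; have [W0 WD WZ] := points_ideal_is_ideal q.
have X0 : X 0 by apply/XE.
have XZ a b : X b -> X (a * b).
  by move=> /XE[Vb Wb]; apply/XE; split; [apply: VZ|apply: WZ].
split; last by move=> f g _ _ _ x y _ _; rewrite subrr; apply: ideal_sections0.
move=> f bf; have one_reg : regular_sections f 1.
  exists 0%N, 1; split=> //; first exact: dhomog1.
  by rewrite rmorph1 expr0 divr1.
split.
- move=> x Wx; split.
  + by move=> y; apply: ideal_sectionsM Wx.
  + move=> y; apply: ideal_sectionsM Wx => a b Wa Vb; apply/XE.
    by split; [apply: VZ|rewrite mulrC; apply: WZ].
  + move=> a y z _ _ _; rewrite (_ : _ - _ = 0); first exact: ideal_sections0.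
    by rewrite mulrDr mulrCA subrr.
- move=> a x y _ _ _ z _; rewrite (_ : _ - _ = 0); first exact: ideal_sections0.
  by rewrite mulrDl mulrA subrr.
- move=> x Wx; split=> [/(_ 1 one_reg)|Xx y ry].
    by rewrite mulr1 subr0.
  rewrite subr0 mulrC; apply: ideal_sectionsM ry Xx => a b _; exact: XZ.
- move=> h [hreg hV hlin].
  have XD x y : ideal_sections f X x -> ideal_sections f X y ->
      ideal_sections f X (x + y).
    move=> [e [a [ah Xa ->]]] [d [b [bh Xb ->]]].
    have [f0 fd fh] := bf.
    have fXh r : homogeneous (r * degree f) (f ^+ r).
      by rewrite mulnC; apply: dhomogMn.
    exists (e + d)%N, (a * f ^+ d + b * f ^+ e); split.
    + rewrite mulnDl; apply: dhomogD; first exact: homogeneousM.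
      by rewrite addnC; apply: homogeneousM.
    + move: (XZ (f ^+ d) a Xa) (XZ (f ^+ e) b Xb); rewrite ![f ^+ _ * _]mulrC.
      by move=> /XE[? ?] /XE[? ?]; apply/XE; split; [apply: VD|apply: WD].
    + have fF0 : f%:F != 0 by rewrite tofrac_eq0.
      by rewrite addf_div ?expf_neq0 // rmorphD !rmorphM !rmorphXn exprD.
  have XN x : ideal_sections f X x -> ideal_sections f X (- x).
    move=> Xx; rewrite -mulN1r.
    apply: (@ideal_sectionsM f (fun=> True)) Xx => [a b _|]; first exact: XZ.
    exists 0%N, (-1); split=> //; first by rewrite /homogeneous rpredN; apply: dhomog1.
    by rewrite expr0 divr1 rmorphN rmorph1.
  have hE y : regular_sections f y -> ideal_sections f X (h 1 * y - h y).
    move=> ry; have reg0 : regular_sections f 0 by apply: ideal_sections0.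
    have h0 : ideal_sections f X (h 0) by apply/hV/ideal_sections0.
    have := hlin y 1 0 ry one_reg reg0; rewrite mulr1 addr0 => hy.
    rewrite (_ : _ - _ = - (h y - (y * h 1 + h 0)) - h 0); last first.
      by rewrite opprB addrAC addrK mulrC.
    by apply: XD; apply: XN.
  exists (h 1) => //; apply: sections_annihilator => //; first exact: hreg.
  move=> y Vy; have ry : regular_sections f y.
    by have [e [a [ah _ yE]]] := Vy; exists e, a.
  rewrite mulrC -[h 1 * y](subrK (h y)); apply: XD; first exact: hE.
  exact: hV.
Qed.

End SheafIsomorphism.

(** The hypotheses on c say that the forms of degree d have as values exactly the
    orthogonal, for the weights c, of the values of the forms of degree less than
    s - d. *)
Lemma gorenstein_link n n' s (p : 'M[k]_(n, m.+1)) (q : 'M[k]_(n', m.+1))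
    (c : 'I_(n + n') -> k) :
    (0 < n)%N -> (0 < n')%N -> affine_points (col_mx p q) -> (forall i, c i != 0) ->
    (forall e (G : S), (e < s)%N -> homogeneous e G ->
       \sum_i c i * G.@[(col_mx p q) i] = 0) ->
    (forall d (a : 'I_(n + n') -> k),
       (forall e (G : S), (e + d < s)%N -> homogeneous e G ->
          \sum_i c i * a i * G.@[(col_mx p q) i] = 0) ->
       form_values (col_mx p q) d a) ->
  g_linked 0 (points_ideal p) (points_ideal q).
Proof.
move=> n_gt0 n'_gt0 affpq c0 weights dual; have [pq0 pq_inj] := affpq.
have affp : affine_points p.
  split=> [i|i j pij]; first by rewrite -(col_mxEu p q) pq0.
  by apply: (@lshift_inj n n'); apply: pq_inj => l; rewrite !col_mxEu.
have affq : affine_points q.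
  split=> [i|i j qij]; first by rewrite -(col_mxEd p q) pq0.
  by apply: (@rshift_inj n n'); apply: pq_inj => l; rewrite !col_mxEd.
have pq_neq i j : exists l, p i l != q j l.
  apply: contrapT => nex.
  have /pq_inj/eqP : forall l, col_mx p q (lshift n' i) l = col_mx p q (rshift n j) l.
    move=> l; rewrite col_mxEu col_mxEd; apply/eqP/negPn/negP => ne.
    by apply: nex; exists l.
  by rewrite eq_lrshift.
have XE F : points_ideal (col_mx p q) F <-> points_ideal p F /\ points_ideal q F.
  split=> [XF|[pF qF] d i].
    split=> d i; have := XF d; [move/(_ (lshift n' i))|move/(_ (rshift n i))];
    by move=> <-; apply: meval_eq => l; rewrite ?col_mxEu ?col_mxEd.
  rewrite -[i]splitK; case: (split i) => j /=.
    by rewrite -[RHS](pF d j); apply: meval_eq => l; rewrite col_mxEu.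
  by rewrite -[RHS](qF d j); apply: meval_eq => l; rewrite col_mxEd.
have N_gt0 : (0 < n + n')%N by rewrite addn_gt0 n_gt0.
split; [exact: points_liaison_scheme|exact: points_liaison_scheme|].
exists (points_ideal (col_mx p q)); split.
- split; last exact: points_dimension.
  split; first exact: points_ideal_closed.
  have [pi piP] := coordinate_ring (col_mx p q) N_gt0.
  exists (cone_ring (col_mx p q) N_gt0), pi; split=> //.
  exact: (cone_ring_gorenstein N_gt0 pq0 c0 weights dual).
- by split=> F /XE[].
- apply: multiplication_sheaf_iso => //; first exact: points_ideal_is_ideal.
  move=> j; apply: separate_point; [exact: affp.1|exact: affq.1|].
  by move=> i; apply: pq_neq.
- apply: multiplication_sheaf_iso.
  + exact: points_ideal_is_ideal.
  + by move=> F; rewrite XE; split=> -[].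
  + move=> j; apply: separate_point; [exact: affq.1|exact: affp.1|].
    by move=> i; have [l ne] := pq_neq j i; exists l; rewrite eq_sym.
Qed.

Lemma point_complete_intersection (p : 'M[k]_(1, m.+1)) :
  p ord0 ord0 = 1 -> complete_intersection 0 (points_ideal p).
Proof.
move=> p00; have affp : affine_points p.
  by split=> [i|i j _]; rewrite (ord1 i) // (ord1 j).
split; [exact: points_ideal_closed|exact: points_dimension|].
pose L (j : 'I_m.+1) : S := 'X_j - p ord0 j *: 'X_ord0.
exists (fun i => L (lift ord0 (cast_ord (subn0 m) i))); split.
  move=> i; exists 1%N; rewrite /homogeneous rpredB //; first exact: homogeneousX.
  by apply: dhomogZ; apply: homogeneousX.
move=> F; set g := fun i => _; have idJ := is_ideal_generated g.
have [J0 JD JZ] := idJ; split=> [/points_idealP/(_ ord0) F0|[e ->]]; last first.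
  apply: ideal_sum; first exact: points_ideal_is_ideal.
  move=> i; have [_ _ VZ] := points_ideal_is_ideal p; apply: VZ.
  by apply/points_idealP => j; rewrite linear_form_ray // (ord1 j) subrr scale0r.
have JL j : generated g (L j).
  have [->|j0] := eqVneq j ord0; first by rewrite /L p00 scale1r subrr.
  have [l ->] : exists l, j = lift ord0 (cast_ord (subn0 m) l).
    have [l -> //|jE] := unliftP ord0 j; last by rewrite jE eqxx in j0.
    by exists (cast_ord (esym (subn0 m)) l); rewrite cast_ordKV.
  exists (fun i => (i == l)%:R); rewrite (bigD1 l) //= eqxx mul1r big1 ?addr0 //.
  by move=> i /negPf->; rewrite mul0r.
(* modulo the linear forms, F becomes a polynomial in the first variable *)
pose sub : {rmorphism S -> S} :=
  (horner_eval ('X_ord0 : S) \o map_poly (@mpolyC m.+1 k)) \o ray p ord0.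
have subX j : sub 'X_j = p ord0 j *: 'X_ord0.
  rewrite /sub /= [mmap _ _ _]arc_evalX linearZ /= map_polyX /horner_eval.
  by rewrite hornerZ hornerX mul_mpolyC.
have subC a : sub a%:MP = a%:MP.
  by rewrite /sub /= [mmap _ _ _]arc_evalC map_polyC /horner_eval hornerC.
suff : generated g (F - sub F).
  by rewrite /sub /= F0 !rmorph0 subr0.
elim/mpoly_closed_ind: F {F0} => [a|j|F G JF JG|F G JF JG].
- by rewrite subC subrr.
- by rewrite subX; apply: JL.
- by rewrite rmorphD opprD addrACA; apply: JD.
- have -> : F * G - sub (F * G) = F * (G - sub G) + sub G * (F - sub F).
    by rewrite rmorphM; ring.
  by apply: (JD); apply: JZ.
Qed.

End PointSchemes.

(** * A rank criterion for links *)

Definition deg3 (t : nat * nat * nat) := (t.1.1 + t.1.2 + t.2)%N.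

Definition monos (e : nat) : seq (nat * nat * nat) :=
  [seq t <- [seq (ab, c) | ab <- [seq (a, b) | a <- iota 0 e.+1, b <- iota 0 e.+1],
                           c <- iota 0 e.+1] | (deg3 t <= e)%N].

Lemma monos_uniq e : uniq (monos e).
Proof.
by apply/filter_uniq/allpairs_uniq; rewrite ?iota_uniq ?allpairs_uniq ?iota_uniq //;
  move=> [? ?] [? ?].
Qed.

Lemma mem_monos e t : (t \in monos e) = (deg3 t <= e)%N.
Proof.
rewrite mem_filter andb_idr // => le_e; case: t le_e => -[a b] c.
rewrite -[deg3 _]/(a + b + c)%N => le_e; apply/allpairsP; exists ((a, b), c).
split=> //; last by rewrite mem_iota /=; lia.
by apply/allpairsP; exists (a, b); split=> //; rewrite mem_iota /=; lia.
Qed.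

Definition v0 : 'I_3 := @Ordinal 3 0 isT.
Definition v1 : 'I_3 := @Ordinal 3 1 isT.
Definition v2 : 'I_3 := @Ordinal 3 2 isT.

Lemma ord3P (Q : 'I_3 -> Prop) : Q v0 -> Q v1 -> Q v2 -> forall l, Q l.
Proof.
move=> Q0 Q1 Q2 [[|[|[|l]]] ltl] //.
- by rewrite (_ : Ordinal ltl = v0) //; apply: val_inj.
- by rewrite (_ : Ordinal ltl = v1) //; apply: val_inj.
- by rewrite (_ : Ordinal ltl = v2) //; apply: val_inj.
Qed.

Section Evaluation.
Variable R : comNzRingType.
Implicit Types (t : nat * nat * nat) (x : 'I_3 -> R).

Definition mono t x : R := x v0 ^+ t.1.1 * x v1 ^+ t.1.2 * x v2 ^+ t.2.

Definition dmono (l : 'I_3) t x : R :=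
  match val l with
  | 0 => x v0 ^+ t.1.1.-1 *+ t.1.1 * x v1 ^+ t.1.2 * x v2 ^+ t.2
  | 1 => x v0 ^+ t.1.1 * (x v1 ^+ t.1.2.-1 *+ t.1.2) * x v2 ^+ t.2
  | _ => x v0 ^+ t.1.1 * x v1 ^+ t.1.2 * (x v2 ^+ t.2.-1 *+ t.2)
  end.

Variable e : nat.
Definition nth_mono (j : 'I_(size (monos e))) := nth (0, 0, 0)%N (monos e) j.

Lemma nth_mono_deg j : (deg3 (nth_mono j) <= e)%N.
Proof. by rewrite -mem_monos mem_nth. Qed.

Lemma nth_mono_inj : injective nth_mono.
Proof.
move=> i j /eqP; rewrite nth_uniq ?monos_uniq //.
by move=> /eqP/val_inj.
Qed.

Lemma nth_monoP t : (deg3 t <= e)%N -> exists j, nth_mono j = t.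
Proof.
rewrite -mem_monos => te; have ti : (index t (monos e) < size (monos e))%N.
  by rewrite index_mem.
by exists (Ordinal ti); rewrite /nth_mono /= nth_index.
Qed.

Definition evmx n (x : 'M[R]_(n, 3)) : 'M[R]_(n, size (monos e)) :=
  \matrix_(i, j) mono (nth_mono j) (x i).

Definition devmx l n (x : 'M[R]_(n, 3)) : 'M[R]_(n, size (monos e)) :=
  \matrix_(i, j) dmono l (nth_mono j) (x i).

Lemma mono_eq t x y : x =1 y -> mono t x = mono t y.
Proof. by move=> xy; rewrite /mono !xy. Qed.

Lemma evmx_col n n' (x : 'M[R]_(n, 3)) (y : 'M[R]_(n', 3)) :
  evmx (col_mx x y) = col_mx (evmx x) (evmx y).
Proof.
apply/matrixP => i j; rewrite mxE -[i]splitK; case: (split i) => l /=.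
  by rewrite col_mxEu mxE; apply: mono_eq => a; rewrite col_mxEu.
by rewrite col_mxEd mxE; apply: mono_eq => a; rewrite col_mxEd.
Qed.

End Evaluation.

Lemma monoM (R : comNzRingType) t t' (x : 'I_3 -> R) :
  mono (t.1.1 + t'.1.1, t.1.2 + t'.1.2, t.2 + t'.2)%N x = mono t x * mono t' x.
Proof. by rewrite /mono /= !exprD; ring. Qed.

Lemma rmorph_mono (R R' : comNzRingType) (f : {rmorphism R -> R'}) t (x : 'I_3 -> R) :
  f (mono t x) = mono t (f \o x).
Proof. by rewrite /mono !rmorphM !rmorphXn. Qed.

Lemma rmorph_dmono (R R' : comNzRingType) (f : {rmorphism R -> R'}) l t (x : 'I_3 -> R) :
  f (dmono l t x) = dmono l t (f \o x).
Proof.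
by rewrite /dmono; case: (val l) => [|[|_]]; rewrite !rmorphM rmorphMn !rmorphXn.
Qed.

Lemma map_evmx (R R' : comNzRingType) (f : {rmorphism R -> R'}) e n (x : 'M[R]_(n, 3)) :
  map_mx f (evmx e x) = evmx e (map_mx f x).
Proof. by apply/matrixP => i j; rewrite !mxE rmorph_mono; apply: mono_eq => l; rewrite mxE. Qed.

Lemma map_devmx (R R' : comNzRingType) (f : {rmorphism R -> R'}) e l n (x : 'M[R]_(n, 3)) :
  map_mx f (devmx e l x) = devmx e l (map_mx f x).
Proof. by apply/matrixP => i j; rewrite !mxE rmorph_dmono /dmono /= !mxE. Qed.

Section Homogenization.
Variable k : closedFieldType.
Local Notation S := {mpoly k[4]}.

Definition projective n (x : 'M[k]_(n, 3)) : 'M[k]_(n, 4) :=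
  \matrix_(i, j) if unlift ord0 j is Some l then x i l else 1.

Lemma projective0 n (x : 'M[k]_(n, 3)) i : projective x i ord0 = 1.
Proof. by rewrite mxE unlift_none. Qed.

Lemma projectiveS n (x : 'M[k]_(n, 3)) i l : projective x i (lift ord0 l) = x i l.
Proof. by rewrite mxE liftK. Qed.

Lemma projective_col n n' (x : 'M[k]_(n, 3)) (y : 'M[k]_(n', 3)) :
  projective (col_mx x y) = col_mx (projective x) (projective y).
Proof.
apply/matrixP => i j; rewrite mxE -[i]splitK; case: (split i) => l /=.
  by rewrite col_mxEu mxE; case: unlift => // a; rewrite col_mxEu.
by rewrite col_mxEd mxE; case: unlift => // a; rewrite col_mxEd.
Qed.

Definition projective_mono d t : S :=
  'X_ord0 ^+ (d - deg3 t) * mono t (fun l => 'X_(lift ord0 l)).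

Lemma projective_mono_homogeneous d t : (deg3 t <= d)%N -> homogeneous d (projective_mono d t).
Proof.
move=> td; rewrite -[d in homogeneous d _](subnK td) /projective_mono.
apply: homogeneousM; first exact: homogeneousXn.
rewrite /deg3 /mono; apply: homogeneousM; last exact: homogeneousXn.
by apply: homogeneousM; apply: homogeneousXn.
Qed.

Lemma projective_mono_eval d t n (x : 'M[k]_(n, 3)) i :
  (projective_mono d t).@[projective x i] = mono t (x i).
Proof.
rewrite /projective_mono rmorphM rmorphXn /= mevalXU projective0 expr1n mul1r rmorph_mono.
by apply: mono_eq => l; rewrite /= mevalXU projectiveS.
Qed.

Lemma form_eval e (G : S) : homogeneous e G ->
  exists v : 'cV[k]_(size (monos e)), forall n (x : 'M[k]_(n, 3)) i,
    G.@[projective x i] = (evmx e x *m v) i 0.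
Proof.
move=> Ge; pose t (m : 'X_{1..4}) :=
  (m (lift ord0 v0), m (lift ord0 v1), m (lift ord0 v2)).
have tdeg m : (deg3 (t m) <= mdeg m)%N.
  rewrite mdegE big_ord_recl -[X in (X <= _)%N]add0n leq_add //.
  rewrite !big_ord_recl big_ord0 addn0 addnA /deg3 /t /= leq_eqVlt; apply/orP; left.
  apply/eqP; congr (m _ + m _ + m _)%N; exact: val_inj.
have /choice[j jE] : forall m, exists j, mdeg m = e -> @nth_mono e j = t m.
  move=> m; have [me|ne] := eqVneq (mdeg m) e; last first.
    have [//|j _] := @nth_monoP e (0, 0, 0)%N.
    by exists j => me; rewrite me eqxx in ne.
  have [|j jE] := @nth_monoP e (t m); first by rewrite -me.
  by exists j.
exists (\sum_(m <- msupp G) G@_m *: delta_mx (j m) 0) => n x i.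
rewrite mulmx_sumr summxE mevalE; apply: eq_big_seq => m Gm.
rewrite -scalemxAr mxE -colE !mxE jE; last exact: (dhomog_mf Ge).
congr (_ * _); rewrite big_ord_recl projective0 expr1n mul1r.
rewrite !big_ord_recl big_ord0 mulr1 mulrA /mono /=.
by do ![congr (_ * _)]; rewrite projectiveS; congr (_ ^+ _);
  do ?[congr (m _)|congr (x i _)]; apply: val_inj.
Qed.

Lemma form_of_vector e (v : 'cV[k]_(size (monos e))) d : (e <= d)%N ->
  exists2 G : S, homogeneous d G & forall n (x : 'M[k]_(n, 3)) i,
    G.@[projective x i] = (evmx e x *m v) i 0.
Proof.
move=> ed; exists (\sum_j v j 0 *: projective_mono d (nth_mono j)).
  rewrite /homogeneous rpred_sum // => j _; apply: dhomogZ.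
  by apply: projective_mono_homogeneous; apply: leq_trans ed; apply: nth_mono_deg.
move=> n x i; rewrite mxE (raddf_sum (meval _)); apply: eq_bigr => j _ /=.
by rewrite mevalZ projective_mono_eval mxE mulrC.
Qed.

(** The row relation makes the values in degree d orthogonal, for the weights c, to
    the values in degree s - 1 - d, and the ranks force each space to be the whole
    orthogonal of the other.  In degree s all values occur; in particular the
    points are distinct. *)
Theorem rank_link n n' s (r : nat -> nat) (p : 'M[k]_(n, 3)) (q : 'M[k]_(n', 3))
    (c : 'rV[k]_(n + n')) :
    (0 < n)%N -> (0 < n')%N -> (0 < s)%N -> (forall i, c 0 i != 0) ->
    c *m evmx s.-1 (col_mx p q) = 0 ->
    (forall d, (d <= s)%N -> r d <= \rank (evmx d (col_mx p q)))%N ->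
    (forall d, (d < s)%N -> r d + r (s.-1 - d) = n + n')%N -> r s = (n + n')%N ->
  [/\ forall i j, (forall l, p i l = p j l) -> i = j &
      g_linked 0 (points_ideal (projective p)) (points_ideal (projective q))].
Proof.
set x := col_mx p q => n_gt0 n'_gt0 s_gt0 c0 crel rk rr rs.
have free_s : row_free (evmx s x).
  by rewrite /row_free eqn_leq rank_leq_row -{1}rs rk.
have x_inj i j : (forall l, x i l = x j l) -> i = j.
  move=> xij; apply/eqP; apply: contraT => nij.
  have /(row_free_inj free_s)/rowP/(_ i) :
      delta_mx 0 i *m evmx s x = delta_mx 0 j *m evmx s x :> 'rV_ _.
    rewrite -!rowE; apply/rowP => l; rewrite !mxE.
    by apply: mono_eq => a; rewrite xij.
  by rewrite !mxE !eqxx (negPf nij) => /eqP; rewrite oner_eq0.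
have affx : affine_points (projective x).
  split=> [i|i j xij]; first exact: projective0.
  by apply: x_inj => l; rewrite -!projectiveS xij.
split.
  move=> i j pij; apply: (@lshift_inj n n'); apply: x_inj => l.
  by rewrite /x !col_mxEu.
have relE e (G : S) : (e < s)%N -> homogeneous e G ->
    exists w : 'cV[k]_(size (monos s.-1)), forall i, G.@[projective x i] = (evmx s.-1 x *m w) i 0.
  move=> es Ge; have [|G' G'd G'E] := @form_of_vector s.-1 0 s.-1 => //.
  have G1 : homogeneous s.-1 ('X_ord0 ^+ (s.-1 - e) * G).
    have := homogeneousM (homogeneousXn k ord0 (s.-1 - e)) Ge.
    by rewrite subnK //; lia.
  have [w wE] := form_eval G1; exists w => i.
  by rewrite -wE mevalM rmorphXn /= mevalXU projective0 expr1n mul1r.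
apply: (@gorenstein_link _ _ _ _ s _ _ (c 0)) => //.
- by rewrite -projective_col.
- move=> e G es Ge; rewrite -projective_col; have [w wE] := relE e G es Ge.
  transitivity ((c *m (evmx s.-1 x *m w)) 0 0); last by rewrite mulmxA crel mul0mx mxE.
  by rewrite [RHS]mxE; apply: eq_bigr => i _; rewrite wE.
rewrite -projective_col => d a aG; have [ds|sd] := ltnP d s; last first.
  have full_s : row_full (evmx s x)^T by rewrite /row_full mxrank_tr.
  have /submxP[v vE] : (\row_i a i <= (evmx s x)^T)%MS by rewrite submx_full.
  have [G Gd GE] := form_of_vector v^T sd; exists G => // i.
  by rewrite GE -[evmx s x]trmxK -trmx_mul -vE !mxE.
pose e := (s.-1 - d)%N; pose C := diag_mx c.
have polar : (evmx d x)^T *m (C *m evmx e x) = 0.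
  apply/matrixP => i j; rewrite [RHS]mxE mxE.
  have [|l lE] := @nth_monoP s.-1 ((nth_mono i).1.1 + (nth_mono j).1.1,
     (nth_mono i).1.2 + (nth_mono j).1.2, (nth_mono i).2 + (nth_mono j).2)%N.
    have := nth_mono_deg i; have := nth_mono_deg j; rewrite /deg3 /= /e.
    lia.
  transitivity ((c *m evmx s.-1 x) 0 l); last by rewrite crel mxE.
  rewrite [RHS]mxE; apply: eq_bigr => b _; rewrite mul_diag_mx !mxE lE monoM; ring.
have le1 : ((evmx d x)^T <= kermx (C *m evmx e x))%MS by apply/sub_kermxP.
have Cu : C \in unitmx.
  by rewrite unitmxE det_diag unitfE; apply/prodf_neq0 => i _.
have rkC : \rank (C *m evmx e x) = \rank (evmx e x).
  by rewrite -mxrank_tr trmx_mul mxrankMfree ?mxrank_tr // row_free_unit unitmx_tr.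
have le2 : (kermx (C *m evmx e x) <= (evmx d x)^T)%MS.
  have [_ <-] := mxrank_leqif_sup le1.
  rewrite eqn_leq mxrankS //= mxrank_ker mxrank_tr rkC.
  have es : (e <= s)%N by rewrite /e; lia.
  have rkd := rk d (ltnW ds); have rke := rk e es; have rde : (r d + r e = n + n')%N := rr d ds.
  rewrite leq_subLR; apply: leq_trans (leq_add rke rkd).
  by rewrite [leqRHS]addnC rde.
have /submxP[v vE] : (\row_i a i <= (evmx d x)^T)%MS.
  apply: submx_trans le2; apply/sub_kermxP/rowP => j; rewrite [RHS]mxE.
  rewrite -(aG e (projective_mono e (nth_mono j))); last first.
  - by apply: projective_mono_homogeneous; apply: nth_mono_deg.
  - by rewrite /e; lia.
  rewrite mxE; apply: eq_bigr => i _.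
  by rewrite projective_mono_eval mul_diag_mx !mxE; ring.
have [G Gd GE] := form_of_vector v^T (leqnn d); exists G => // i.
by rewrite GE -[evmx d x]trmxK -trmx_mul -vE !mxE.
Qed.

End Homogenization.

(** * Deformations of weighted sets of points *)

Lemma evmxE (R : comNzRingType) e n (x : 'M[R]_(n, 3)) i j :
  evmx e x i j = mono (nth_mono j) (x i).
Proof. exact: mxE. Qed.

Section OpenConditions.
Variables (k : fieldType) (M : nat).
Implicit Types (z : 'I_M -> k).

Definition open_at (z0 : 'I_M -> k) (Q : ('I_M -> k) -> Prop) :=
  exists2 g : {mpoly k[M]}, g.@[z0] != 0 & forall z, g.@[z] != 0 -> Q z.

Lemma open_and z0 Q Q' : open_at z0 Q -> open_at z0 Q' ->
  open_at z0 (fun z => Q z /\ Q' z).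
Proof.
move=> [g g0 gQ] [g' g'0 gQ']; exists (g * g').
  by rewrite mevalM mulf_neq0.
by move=> z; rewrite mevalM mulf_eq0 negb_or => /andP[/gQ Qz /gQ' Q'z].
Qed.

Lemma open_forall z0 (I : finType) (Q : I -> ('I_M -> k) -> Prop) :
  (forall i, open_at z0 (Q i)) -> open_at z0 (fun z => forall i, Q i z).
Proof.
move=> oQ; have /choice[g gQ] : forall i, exists g : {mpoly k[M]},
    g.@[z0] != 0 /\ forall z, g.@[z] != 0 -> Q i z.
  by move=> i; have [g g0 gQ] := oQ i; exists g.
exists (\prod_i g i).
  rewrite rmorph_prod; apply/prodf_neq0 => i _.
  by case: (gQ i).
move=> z; rewrite rmorph_prod => /prodf_neq0 gz i.
by case: (gQ i) => _; apply; apply: gz.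
Qed.

Lemma open_neq0 z0 (f : ('I_M -> k) -> k) (F : {mpoly k[M]}) :
  (forall z, F.@[z] = f z) -> f z0 != 0 -> open_at z0 (fun z => f z != 0).
Proof. by move=> Ff fz0; exists F => [|z]; rewrite Ff. Qed.

Lemma exists_unit_minor m n (A : 'M[k]_(m, n)) :
  exists f g, mxsub f g A \in (unitmx : pred 'M[k]_(\rank A)).
Proof.
pose B := rowsub (maxrankfun A) A.
have Bfull : row_full B^T.
  by rewrite /row_full mxrank_tr; apply: maxrowsub_free.
exists (maxrankfun A), (fullrankfun Bfull).
rewrite -unitmx_tr -row_full_unit (_ : _^T = rowsub (fullrankfun Bfull) B^T).
  exact: fullrowsub_full.
by apply/matrixP => i j; rewrite !mxE.
Qed.

Lemma open_rank m n z0 (A : ('I_M -> k) -> 'M[k]_(m, n)) (F : 'M[{mpoly k[M]}]_(m, n)) r :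
    (forall z, map_mx (meval z) F = A z) -> (r <= \rank (A z0))%N ->
  open_at z0 (fun z => r <= \rank (A z))%N.
Proof.
move=> FA rA; have [f [g fgu]] := exists_unit_minor (A z0).
have mapE z : map_mx (meval z) (mxsub f g F) = mxsub f g (A z).
  by apply/matrixP => i j; have /matrixP/(_ (f i) (g j)) := FA z; rewrite !mxE.
exists (\det (mxsub f g F)).
  by rewrite -det_map_mx mapE -unitfE -unitmxE.
move=> z; rewrite -det_map_mx mapE -unitfE -unitmxE => /mxrank_unit rk; apply: leq_trans rA _.
rewrite -rk (_ : mxsub f g (A z) = rowsub f (colsub g (A z))); last first.
  by apply/matrixP => i j; rewrite !mxE.
apply: leq_trans (mxrankS (rowsub_sub _ _)) _.
rewrite -mxrank_tr -[\rank (A z)]mxrank_tr.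
rewrite (_ : (colsub g (A z))^T = rowsub g (A z)^T); last first.
  by apply/matrixP => i j; rewrite !mxE.
exact: mxrankS (rowsub_sub _ _).
Qed.

End OpenConditions.

Section Incidence.
Variables (k : closedFieldType) (n n' s : nat).
Local Notation d := (n * 3)%N.
Local Notation r := (n' * 3 + (n + n'))%N.
Local Notation M := (d + r)%N.
Implicit Types z : 'I_M -> k.

Definition first_points (R : Type) (y : 'I_M -> R) : 'M[R]_(n, 3) :=
  \matrix_(i, l) y (lshift r (mxvec_index i l)).
Definition second_points (R : Type) (y : 'I_M -> R) : 'M[R]_(n', 3) :=
  \matrix_(i, l) y (rshift d (lshift (n + n') (mxvec_index i l))).
Definition point_weights (R : Type) (y : 'I_M -> R) : 'rV[R]_(n + n') :=
  \row_i y (rshift d (rshift (n' * 3) i)).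
Definition all_points (R : Type) (y : 'I_M -> R) : 'M[R]_(n + n', 3) :=
  col_mx (first_points y) (second_points y).

Definition coordinates_of (p : 'M[k]_(n, 3)) : 'I_d -> k := mxvec p 0.
Definition residual_of (q : 'M[k]_(n', 3)) (c : 'rV[k]_(n + n')) : 'I_r -> k :=
  joint (mxvec q 0) (c 0).

Lemma first_pointsK p w : first_points (joint (coordinates_of p) w) = p.
Proof. by apply/matrixP => i l; rewrite mxE jointl; apply: mxvecE. Qed.
Lemma second_pointsK u q c : second_points (joint u (residual_of q c)) = q.
Proof. by apply/matrixP => i l; rewrite mxE jointr /residual_of jointl; apply: mxvecE. Qed.
Lemma point_weightsK u q c : point_weights (joint u (residual_of q c)) = c.
Proof. by apply/rowP => i; rewrite mxE jointr /residual_of jointr. Qed.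

Definition generic_coord (v : 'I_M) : {mpoly k[M]} := 'X_v.

Lemma map_first z : map_mx (meval z) (first_points generic_coord) = first_points z.
Proof. by apply/matrixP => i l; rewrite !mxE mevalXU. Qed.
Lemma map_second z : map_mx (meval z) (second_points generic_coord) = second_points z.
Proof. by apply/matrixP => i l; rewrite !mxE mevalXU. Qed.
Lemma map_all z : map_mx (meval z) (all_points generic_coord) = all_points z.
Proof. by rewrite map_col_mx map_first map_second. Qed.
Lemma map_weights z : map_mx (meval z) (point_weights generic_coord) = point_weights z.
Proof. by apply/rowP => l; rewrite !mxE mevalXU. Qed.

Definition relation (z : 'I_M -> k) := point_weights z *m evmx s (all_points z).

(** The differential of [relation] in the directions of the weights, given by the
    values at all the points, and of the points q, given by the partial
    derivatives there up to the weights of q, which are not zero. *)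
Definition jacobian (R : comNzRingType) (x : 'M[R]_(n + n', 3)) (q : 'M[R]_(n', 3)) :=
  col_mx (evmx s x) (col_mx (devmx s v0 q) (col_mx (devmx s v1 q) (devmx s v2 q))).

Lemma open_weights z0 : (forall i, point_weights z0 0 i != 0) ->
  open_at z0 (fun z => forall i, point_weights z 0 i != 0).
Proof.
move=> c0; apply: open_forall => i.
apply: (@open_neq0 k M _ (fun z => point_weights z 0 i)
  ('X_(rshift d (rshift (n' * 3) i)))) => // z.
by rewrite mevalXU mxE.
Qed.

Lemma open_points_rank z0 e rk : (rk <= \rank (evmx e (all_points z0)))%N ->
  open_at z0 (fun z => rk <= \rank (evmx e (all_points z)))%N.
Proof.
apply: (@open_rank k M _ _ z0 (fun z => evmx e (all_points z))
  (evmx e (all_points generic_coord))) => z.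
by rewrite map_evmx map_all.
Qed.

Lemma open_second_points z0 (H : {mpoly k[n' * 3]}) :
  H.@[mxvec (second_points z0) 0] != 0 ->
  open_at z0 (fun z => H.@[mxvec (second_points z) 0] != 0).
Proof.
pose F : {mpoly k[M]} := H \mPo [tuple 'X_(rshift d (lshift (n + n') i)) | i < n' * 3].
apply: (@open_neq0 k M _ (fun z => H.@[mxvec (second_points z) 0]) F) => z.
rewrite /F comp_mpoly_meval; apply: meval_eq => i; rewrite tnth_mktuple mevalXU.
by case/mxvec_indexP: i => i l; rewrite mxvecE mxE.
Qed.

Lemma dirderivXn K (F : {mpoly k[K]}) a e m :
  dirderiv (F ^+ m) a e = F.@[a] ^+ m.-1 *+ m * dirderiv F a e.
Proof.
elim: m => [|m IHm]; first by rewrite expr0 mulr0n mul0r -mpolyC1 dirderivC.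
rewrite exprS dirderivM IHm rmorphXn /=; case: m {IHm} => [|m].
  by rewrite mulr0n mul0r mulr0 add0r expr0 mulr1 mulr1n mul1r.
move: (F.@[a]) (dirderiv F a e) => x y /=.
rewrite -[x ^+ m *+ _]mulr_natr -[x ^+ m.+1 *+ _]mulr_natr exprS -[in RHS]natr1.
by move: (m.+1)%:R (x ^+ m) => c w; ring.
Qed.

Lemma dirderiv_sum K (I : Type) (rr : seq I) (F : I -> {mpoly k[K]}) a e :
  dirderiv (\sum_(i <- rr) F i) a e = \sum_(i <- rr) dirderiv (F i) a e.
Proof.
elim: rr => [|i rr IHr]; last by rewrite !big_cons dirderivD IHr.
by rewrite !big_nil -mpolyC0 dirderivC.
Qed.

Lemma dirderiv_mono K t (F : 'I_3 -> {mpoly k[K]}) a e :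
  dirderiv (mono t F) a e
  = \sum_l dirderiv (F l) a e * dmono l t (fun l => (F l).@[a]).
Proof.
have [E0 E1 E2] : [/\ ord0 = v0, lift ord0 ord0 = v1 & lift ord0 (lift ord0 ord0) = v2].
  by split; apply: val_inj.
rewrite !big_ord_recl big_ord0 E2 E1 E0 addr0 /mono /dmono /=.
rewrite !dirderivM !dirderivXn !mevalM !rmorphXn /=.
move: (dirderiv _ a e) (dirderiv _ a e) (dirderiv _ a e) => D0 D1 D2.
move: (_.@[a]) (_.@[a]) (_.@[a]) => x y z.
move: (x ^+ _) (y ^+ _) (z ^+ _) (x ^+ _ *+ _) (y ^+ _ *+ _) (z ^+ _ *+ _).
by move=> *; ring.
Qed.

(** Where the differential of [relation] in (q, c) is onto, its zeros dominate the
    space of the p, and an open condition true at one such zero z0 holds over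
    almost every p. *)
Theorem deform (z0 : 'I_M -> k) (Q : ('I_M -> k) -> Prop) :
    relation z0 = 0 -> (forall i, point_weights z0 0 i != 0) ->
    (size (monos s) <= \rank (jacobian (all_points z0) (second_points z0)))%N ->
    open_at z0 Q ->
  exists2 h : {mpoly k[n * 3]}, h != 0 & forall p : 'M[k]_(n, 3), h.@[mxvec p 0] != 0 ->
    exists z, [/\ first_points z = p, relation z = 0 & Q z].
Proof.
move=> rel0 c0 rkJ [D D0 DQ].
pose u0 v := z0 (lshift r v); pose w0 v := z0 (rshift d v).
have z0E : joint u0 w0 = z0.
  by apply/funext => v; rewrite -[v]splitK; case: (split v) => i /=; rewrite ?jointl ?jointr.
pose E j : {mpoly k[M]} := (point_weights generic_coord *m evmx s (all_points generic_coord)) 0 j.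
have Eval z j : (E j).@[z] = relation z 0 j.
  by rewrite /relation -map_weights -map_all -map_evmx -map_mxM [RHS]mxE.
have Jfull : row_full (jacobian (all_points z0) (second_points z0)).
  by rewrite /row_full eqn_leq rank_leq_col.
have [|||h h0 Hh] := @implicit_function k d r _ E D u0 w0.
- by move=> j; rewrite z0E Eval rel0 mxE.
- by rewrite z0E.
- move=> eta; rewrite z0E.
  have /submxP[v vE] : (\row_j eta j <= jacobian (all_points z0) (second_points z0))%MS.
    exact: submx_full.
  have [cc [q0 [q1 [q2 vE']]]] : exists cc q0 q1 q2,
      v = row_mx cc (row_mx q0 (row_mx q1 q2)).
    exists (lsubmx v), (lsubmx (rsubmx v)), (lsubmx (rsubmx (rsubmx v))).
    by exists (rsubmx (rsubmx (rsubmx v))); rewrite !hsubmxK.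
  pose dq : 'M[k]_(n', 3) := \matrix_(i, l)
    ((if val l is 0 then q0 else if val l is 1 then q1 else q2) 0 i
     / point_weights z0 0 (rshift n i)).
  exists (residual_of dq cc) => j; set del := joint _ _.
  have delc i : del (rshift d (rshift (n' * 3) i)) = cc 0 i by rewrite /del jointr /residual_of jointr.
  have delq i l : del (rshift d (lshift (n + n') (mxvec_index i l))) = dq i l.
    by rewrite /del jointr /residual_of jointl mxvecE.
  have delp v' : del (lshift r v') = 0 by rewrite /del jointl.
  have -> : eta j = (v *m jacobian (all_points z0) (second_points z0)) 0 j.
    by rewrite -vE mxE.
  rewrite vE' !mul_row_col [RHS]mxE /E mxE dirderiv_sum.
  have derE i : dirderiv (point_weights generic_coord 0 i
        * evmx s (all_points generic_coord) i j) z0 del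
      = cc 0 i * evmx s (all_points z0) i j + point_weights z0 0 i *
         dirderiv (evmx s (all_points generic_coord) i j) z0 del.
    rewrite dirderivM addrC; congr (_ + _); rewrite !mxE ?mevalXU //.
    rewrite dirderivX delc rmorph_mono; congr (_ * _); apply: mono_eq => l.
    by rewrite -map_all [RHS]mxE.
  rewrite (eq_bigr _ (fun i _ => derE i)) big_split /= !mxE; congr (_ + _).
  rewrite big_split_ord /= big1 ?add0r => [|i _]; last first.
    rewrite evmxE dirderiv_mono big1 ?mulr0 // => l _.
    by rewrite /all_points col_mxEu mxE dirderivX delp mul0r.
  rewrite -!big_split /=; apply: eq_bigr => i _.
  rewrite evmxE dirderiv_mono !big_ord_recl big_ord0 addr0.
  have dE l : dirderiv (all_points generic_coord (rshift n i) l) z0 del = dq i l.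
    by rewrite /all_points col_mxEd mxE dirderivX delq.
  have dmE l : dmono l (nth_mono j) (fun l => (all_points generic_coord (rshift n i) l).@[z0])
     = devmx s l (second_points z0) i j.
    rewrite mxE; congr (dmono _ _ _); apply/funext => a.
    by rewrite /all_points col_mxEd !mxE mevalXU.
  rewrite !dE !dmE !mulrDr !mulrA.
  have dqE l : point_weights z0 0 (rshift n i) * dq i l =
     (if val l is 0 then q0 else if val l is 1 then q1 else q2) 0 i.
    by rewrite [dq i l]mxE mulrC divfK.
  by rewrite !dqE /= addrA; do ![congr (_ + _)]; congr (_ * devmx _ _ _ _ _); apply: val_inj.
exists h => // p /Hh[w [Ew Dw]]; exists (joint (mxvec p 0) w); split.
- exact: first_pointsK.
- by apply/rowP => j; rewrite -Eval Ew mxE.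
- exact: DQ.
Qed.

End Incidence.

(** * From the residual part to a generic part *)

Section Generic.
Variable k : closedFieldType.

Definition glicci_points n (p : 'M[k]_(n, 3)) :=
  (forall i j, (forall l, p i l = p j l) -> i = j) /\
  exists2 C, complete_intersection 0 C &
    g_liaison 0 (points_ideal (projective p)) C.

Definition generically_glicci n := exists2 H : {mpoly k[n * 3]}, H != 0 &
  forall p : 'M[k]_(n, 3), H.@[mxvec p 0] != 0 -> glicci_points p.

Lemma generically_glicci1 : generically_glicci 1.
Proof.
exists 1 => [|p _]; first exact: oner_neq0.
split=> [i j _|]; first by rewrite (ord1 i) (ord1 j).
exists (points_ideal (projective p)); last exact: rst_refl.
by apply: point_complete_intersection; apply: projective0.
Qed.

Lemma mxrank_col_mxC m1 m2 n (A : 'M[k]_(m1, n)) (B : 'M[k]_(m2, n)) :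
  \rank (col_mx A B) = \rank (col_mx B A).
Proof. by rewrite -!addsmxE addsmxC. Qed.

Section Link.
Variables (n n' s : nat) (r : nat -> nat).
Variables (p0 : 'M[k]_(n, 3)) (q0 : 'M[k]_(n', 3)) (c0 : 'rV[k]_(n + n')).
Hypothesis n_gt0 : (0 < n)%N.
Hypothesis n'_gt0 : (0 < n')%N.
Hypothesis s_gt0 : (0 < s)%N.
Hypothesis c0_neq0 : forall i, c0 0 i != 0.
Hypothesis rel0 : c0 *m evmx s.-1 (col_mx p0 q0) = 0.
Hypothesis rank0 : forall d, (d <= s)%N -> (r d <= \rank (evmx d (col_mx p0 q0)))%N.
Hypothesis sum_r : forall d, (d < s)%N -> (r d + r (s.-1 - d) = n + n')%N.
Hypothesis r_s : r s = (n + n')%N.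
Hypothesis submersion_p : (size (monos s.-1) <=
  \rank (jacobian s.-1 (col_mx p0 q0) q0))%N.
Hypothesis submersion_q : (size (monos s.-1) <=
  \rank (jacobian s.-1 (col_mx q0 p0) p0))%N.

Local Notation M := (n * 3 + (n' * 3 + (n + n')))%N.
Local Notation M' := (n' * 3 + (n * 3 + (n' + n)))%N.

Definition swap_weights m m' (c : 'rV[k]_(m + m')) : 'rV[k]_(m' + m) :=
  row_mx (rsubmx c) (lsubmx c).

Lemma swap_weights_neq0 m m' (c : 'rV[k]_(m + m')) :
  (forall i, c 0 i != 0) -> forall i, swap_weights c 0 i != 0.
Proof.
move=> c_neq0 i; rewrite -[i]splitK; case: (split i) => j /=.
  by rewrite row_mxEl mxE.
by rewrite row_mxEr mxE.
Qed.

Lemma swap_relation m m' e (c : 'rV[k]_(m + m')) (p : 'M[k]_(m, 3)) (q : 'M[k]_(m', 3)) :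
  c *m evmx e (col_mx p q) = 0 -> swap_weights c *m evmx e (col_mx q p) = 0.
Proof. by rewrite -{1}[c]hsubmxK !evmx_col !mul_row_col addrC. Qed.

Lemma swap_rank m m' e (p : 'M[k]_(m, 3)) (q : 'M[k]_(m', 3)) :
  \rank (evmx e (col_mx p q)) = \rank (evmx e (col_mx q p)).
Proof. by rewrite !evmx_col mxrank_col_mxC. Qed.

Lemma open_first_jacobian_rank (z0 : 'I_M' -> k) rk :
  (rk <= \rank (jacobian s.-1 (col_mx (second_points z0) (first_points z0))
                 (first_points z0)))%N ->
  open_at z0 (fun z => rk <= \rank (jacobian s.-1
    (col_mx (second_points z) (first_points z)) (first_points z)))%N.
Proof.
pose g := @generic_coord k n' n.
apply: (@open_rank k M' _ _ z0 (fun z => jacobian s.-1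
    (col_mx (second_points z) (first_points z)) (first_points z))
  (jacobian s.-1 (col_mx (second_points g) (first_points g)) (first_points g))) => z.
by rewrite !map_col_mx map_evmx !map_devmx map_col_mx map_first map_second.
Qed.

(** The residual part must be generic enough to be glicci by H', although q0 need not be.
    So q is moved first: deforming (p0, q0) over the space of the q gives a
    configuration (p1, q1) that is still a submersion over the space of the p and
    has H'(q1) <> 0.  Deforming the latter over the space of the p keeps H'(q)
    different from zero. *)
Theorem link_step : generically_glicci n' -> generically_glicci n.
Proof.
move=> [H' H'0 H'good].
pose z0 : 'I_M' -> k := joint (coordinates_of q0) (residual_of p0 (swap_weights c0)).
pose ranks m (x : 'M[k]_(m, 3)) :=
  forall i : 'I_s.+1, (r i <= \rank (evmx i x))%N.
have first0 : first_points z0 = q0 by apply: first_pointsK.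
have second0 : second_points z0 = p0 by apply: second_pointsK.
have weights0 : point_weights z0 = swap_weights c0 by apply: point_weightsK.
have all0 : all_points z0 = col_mx q0 p0 by rewrite /all_points first0 second0.
have [||||h1 h10 Hh1] := @deform k n' n s.-1 z0 (fun z =>
    (forall i, point_weights z 0 i != 0) /\ (ranks _ (all_points z) /\
     (size (monos s.-1) <= \rank (jacobian s.-1
        (col_mx (second_points z) (first_points z)) (first_points z)))%N)).
- by rewrite /relation weights0 all0; apply: swap_relation.
- by rewrite weights0; apply: swap_weights_neq0.
- by rewrite all0 second0.
- apply: open_and; first by apply: open_weights; rewrite weights0; apply: swap_weights_neq0.
  apply: open_and; last by apply: open_first_jacobian_rank; rewrite first0 second0.
  apply: open_forall => i; apply: open_points_rank; rewrite all0 swap_rank.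
  by apply: rank0; rewrite -ltnS.
have [u] := mpoly_nonroot (mulf_neq0 h10 H'0).
pose q1 : 'M[k]_(n', 3) := vec_mx (\row_v u v).
have uE : u =1 mxvec q1 0 by move=> v; rewrite vec_mxK mxE.
rewrite (meval_eq _ uE) mevalM mulf_eq0 negb_or => /andP[/Hh1[z1 [first1 rel1]]].
move=> [c1_neq0 [rank1 jac1]] H'q1.
pose p1 := second_points z1; pose c1 := swap_weights (point_weights z1).
pose z2 : 'I_M -> k := joint (coordinates_of p1) (residual_of q1 c1).
have first2 : first_points z2 = p1 by apply: first_pointsK.
have second2 : second_points z2 = q1 by apply: second_pointsK.
have weights2 : point_weights z2 = c1 by apply: point_weightsK.
have all2 : all_points z2 = col_mx p1 q1 by rewrite /all_points first2 second2.
have [||||h2 h20 Hh2] := @deform k n n' s.-1 z2 (fun z =>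
    (forall i, point_weights z 0 i != 0) /\ (ranks _ (all_points z) /\
     H'.@[mxvec (second_points z) 0] != 0)).
- rewrite /relation weights2 all2; apply: swap_relation.
  by move: rel1; rewrite /relation /all_points first1.
- by rewrite weights2; apply: swap_weights_neq0.
- by rewrite all2 second2; move: jac1; rewrite first1.
- apply: open_and; first by apply: open_weights; rewrite weights2; apply: swap_weights_neq0.
  apply: open_and; last by apply: open_second_points; rewrite second2.
  apply: open_forall => i; apply: open_points_rank; rewrite all2 swap_rank.
  by move: (rank1 i); rewrite /all_points first1.
exists h2 => // p /Hh2[z [first rel [c_neq0 [rank /H'good[_ [C CIC linkC]]]]]].
have [||||||||p_inj link] := @rank_link k n n' s r p (second_points z) (point_weights z) => //.
- by rewrite -first.
- by move=> d ds; have := rank (Ordinal (ds : (d < s.+1)%N)); rewrite /all_points first.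
split=> //; exists C => //; apply: rst_trans linkC; exact: rst_step.
Qed.

End Link.
End Generic.

(** * Triple points of planes and Bezout's theorem on lines *)

(** The elementary symmetric functions.  The points (e1, e2, e3) with the root u in
    common form a plane, osculating a twisted cubic: [esp u w x] is the point
    common to three of these planes, and two of them meet in a line on which x is
    an affine coordinate. *)
Definition esp (R : comNzRingType) (u w x : R) (l : 'I_3) : R :=
  match val l with
  | 0 => u + w + x
  | 1 => u * w + u * x + w * x
  | _ => u * w * x
  end.

Lemma sum3 (V : nmodType) (F : 'I_3 -> V) : \sum_l F l = F v0 + F v1 + F v2.
Proof.
rewrite !big_ord_recl big_ord0 addr0 addrA.
by congr (F _ + F _ + F _); apply: val_inj.
Qed.

Section Symmetric.
Variables (R : comNzRingType).
Implicit Types u w x : R.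

Lemma espC u w x : esp u w x =1 esp w u x.
Proof. by apply: ord3P; rewrite /esp /=; ring. Qed.

Lemma espA u w x : esp u w x =1 esp x u w.
Proof. by apply: ord3P; rewrite /esp /=; ring. Qed.

Lemma espCr u w x : esp u w x =1 esp u x w.
Proof. by apply: ord3P; rewrite /esp /=; ring. Qed.

Lemma rmorph_esp (R' : comNzRingType) (f : {rmorphism R -> R'}) u w x :
  f \o esp u w x =1 esp (f u) (f w) (f x).
Proof. by apply: ord3P; rewrite /esp /= ?rmorphD ?rmorphM. Qed.

End Symmetric.

Section MultipleRoots.
Variable k : fieldType.
Implicit Types (p q : {poly k}).

Lemma double_root p x : p.[x] = 0 -> p^`().[x] = 0 -> ('X - x%:P) ^+ 2 %| p.
Proof.
move=> /eqP/factor_theorem[q ->]; rewrite derivM derivXsubC mulr1 !hornerE subrr.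
rewrite mulr0 add0r => /eqP/factor_theorem[q' ->].
by rewrite expr2 -mulrA dvdp_mulIr.
Qed.

Variables (I : eqType) (x : I -> k) (mu : I -> nat).

Lemma multiple_roots p (s : seq I) : uniq s -> {in s &, injective x} ->
  (forall i, i \in s -> ('X - (x i)%:P) ^+ mu i %| p) ->
  \prod_(i <- s) ('X - (x i)%:P) ^+ mu i %| p.
Proof.
elim: s => [|i s IHs] /= ; first by rewrite big_nil dvd1p.
move=> /andP[xs us] x_inj dv; rewrite big_cons Gauss_dvdp; last first.
  rewrite big_seq; apply: (big_ind (fun q => coprimep _ q)) => [|q q' cq cq'|j js].
  - exact: coprimep1.
  - by rewrite coprimepMr cq.
  apply/coprimep_expl/coprimep_expr; rewrite coprimep_XsubC root_XsubC.
  by apply: contraNneq xs => /x_inj <- //; rewrite inE ?eqxx ?js ?orbT.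
rewrite dv ?mem_head //= IHs // => [j l js ls|j js]; last by rewrite dv // inE js orbT.
by apply: x_inj; rewrite inE ?js ?ls orbT.
Qed.

Lemma many_roots p (s : seq I) : uniq s -> {in s &, injective x} ->
  (forall i, i \in s -> ('X - (x i)%:P) ^+ mu i %| p) ->
  (size p <= \sum_(i <- s) mu i)%N -> p = 0.
Proof.
move=> us x_inj dv size_p; apply/eqP; apply: contraLR size_p => p0; rewrite -ltnNge.
have := dvdp_leq p0 (multiple_roots us x_inj dv); apply: leq_trans.
rewrite size_prod_seq => [|i _]; last by rewrite expf_neq0 ?polyXsubC_eq0.
rewrite [X in (_ < X.+1 - _)%N](eq_bigr (fun i => mu i + 1)%N) => [|i _]; last first.
  by rewrite size_exp_XsubC addn1.
by rewrite big_split /= sum1_size; lia.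
Qed.

End MultipleRoots.

Section Restriction.
Variables (k : closedFieldType) (e : nat) (v : 'cV[k]_(size (monos e))).

Definition value (x : 'I_3 -> k) : k := \sum_j v j 0 * mono (nth_mono j) x.
Definition partial (x : 'I_3 -> k) l : k := \sum_j v j 0 * dmono l (nth_mono j) x.

Lemma eq_value x y : x =1 y -> value x = value y.
Proof. by move=> xy; apply: eq_bigr => j _; rewrite (mono_eq _ xy). Qed.

Lemma eq_partial x y l : x =1 y -> partial x l = partial y l.
Proof. by move=> xy; apply: eq_bigr => j _; rewrite /dmono !xy. Qed.

Lemma evmx_value n (x : 'M[k]_(n, 3)) i : (evmx e x *m v) i 0 = value (x i).
Proof. by rewrite mxE; apply: eq_bigr => j _; rewrite mxE mulrC. Qed.

Lemma devmx_partial l n (x : 'M[k]_(n, 3)) i : (devmx e l x *m v) i 0 = partial (x i) l.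
Proof. by rewrite mxE; apply: eq_bigr => j _; rewrite mxE mulrC. Qed.

Lemma size_mono d t (z : 'I_3 -> {poly k}) : (forall l, (size (z l) <= 2)%N) ->
  (deg3 t <= d)%N -> (size (mono t z) <= d.+1)%N.
Proof.
move=> sz td; have szX a l : (size (z l ^+ a) <= a.+1)%N.
  apply: leq_trans (size_poly_exp_leq _ _) _; rewrite ltnS -[X in (_ <= X)%N]mul1n.
  by rewrite leq_mul2r; case: (size _) (sz l) => [|[|[]]] //; rewrite orbT.
apply: leq_trans (size_polyMleq _ _) _.
have := size_polyMleq (z v0 ^+ t.1.1) (z v1 ^+ t.1.2).
have := (szX t.1.1 v0, szX t.1.2 v1, szX t.2 v2) => -[[]]; move: td; rewrite /deg3.
by set A := size _; set B := size _; set C := size _; set D := size _; lia.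
Qed.

Lemma deriv_mono t (z : 'I_3 -> {poly k}) :
  (mono t z)^`() = \sum_l dmono l t z * (z l)^`().
Proof.
rewrite sum3 /mono !derivM !deriv_exp /dmono /=.

ring.
Qed.

Variables u w : k.
Definition line_coord : 'I_3 -> {poly k} := esp u%:P w%:P 'X.
Definition line_poly : {poly k} := \sum_j (v j 0)%:P * mono (nth_mono j) line_coord.

Lemma line_coord_size l : (size (line_coord l) <= 2)%N.
Proof.
have CX (a b : k) : (size (a%:P + b%:P * 'X)%R <= 2)%N.
  by rewrite addrC -cons_poly_def size_cons_poly; case: ifP => // _; rewrite ltnS size_polyC leq_b1.
move: l; apply: ord3P; rewrite /line_coord /esp /=.
- by have := CX (u + w) 1; rewrite polyCD mul1r.
- by have := CX (u * w) (u + w); rewrite polyCD polyCM mulrDl addrA.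
- by have := CX 0 (u * w); rewrite add0r polyCM.
Qed.

Lemma line_poly_size : (size line_poly <= e.+1)%N.
Proof.
apply: leq_trans (size_sum _ _ _) _; apply/bigmax_leqP => j _.
rewrite mul_polyC; apply: leq_trans (size_scale_leq _ _) _.
exact: size_mono line_coord_size (nth_mono_deg j).
Qed.

Lemma horner_line x : horner_eval x \o line_coord =1 esp u w x.
Proof.
move=> l; rewrite [LHS](rmorph_esp (horner_eval x)) /= /horner_eval.
by rewrite !hornerC hornerX.
Qed.

Lemma line_polyE x : line_poly.[x] = value (esp u w x).
Proof.
rewrite /line_poly horner_sum; apply: eq_bigr => j _; rewrite hornerM hornerC.
congr (_ * _); transitivity (mono (nth_mono j) (horner_eval x \o line_coord)).
  exact: (rmorph_mono (horner_eval x)).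
exact: mono_eq (horner_line x).
Qed.

Lemma line_poly_deriv x : (forall l, partial (esp u w x) l = 0) -> line_poly^`().[x] = 0.
Proof.
move=> sing; rewrite /line_poly raddf_sum /= horner_sum.
transitivity (\sum_l partial (esp u w x) l * ((line_coord l)^`()).[x]); last first.
  by rewrite big1 // => l _; rewrite sing mul0r.
rewrite (eq_bigr (fun l => \sum_j v j 0 * dmono l (nth_mono j) (esp u w x)
    * ((line_coord l)^`()).[x])); last by move=> l _; rewrite mulr_suml.
rewrite exchange_big /=; apply: eq_bigr => j _; rewrite derivM derivC mul0r add0r.
rewrite hornerM hornerC deriv_mono horner_sum mulr_sumr; apply: eq_bigr => l _.
rewrite hornerM mulrA; congr (_ * _ * _).
transitivity (dmono l (nth_mono j) (horner_eval x \o line_coord)).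
  exact: (rmorph_dmono (horner_eval x)).
by rewrite /dmono !horner_line.
Qed.

(** Bezout's theorem on a line: e + 1 zeros counted with multiplicity, where points
    at which the polynomial is singular count twice. *)
Lemma line_vanishing (I : eqType) (x : I -> k) (mu : I -> nat) (s : seq I) :
  uniq s -> {in s &, injective x} ->
  (forall i, i \in s -> mu i = 0%N \/ value (esp u w (x i)) = 0 /\
     (mu i = 1%N \/ mu i = 2%N /\ forall l, partial (esp u w (x i)) l = 0)) ->
  (e < \sum_(i <- s) mu i)%N -> forall y, value (esp u w y) = 0.
Proof.
move=> us x_inj mult lt_e y; rewrite -line_polyE.
suff -> : line_poly = 0 by rewrite horner0.
apply: many_roots us x_inj _ (leq_trans line_poly_size lt_e) => i /mult[->|[val0]].
  by rewrite dvd1p.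
have root0 : line_poly.[x i] = 0 by rewrite line_polyE.
case=> [->|[-> sing]]; first by rewrite expr1 dvdp_XsubCl; apply/eqP.
by apply: double_root => //; apply: line_poly_deriv.
Qed.

End Restriction.

Lemma esp_surjective (k : closedFieldType) (x : 'I_3 -> k) : exists a b c, x =1 esp a b c.
Proof.
have [a] := @solve_monicpoly k 3 (nth 0 [:: x v2; - x v1; x v0]) isT.
rewrite sum3 /= => aE.
have [b] := @solve_monicpoly k 2 (nth 0 [:: a * (x v0 - a) - x v1; x v0 - a]) isT.
rewrite !big_ord_recl big_ord0 /= addr0 => bE.
exists a, b, (x v0 - a - b); apply: ord3P; rewrite /esp /=; first by ring.
  rewrite (_ : a * b + _ + _ = a * (x v0 - a) + (x v0 - a) * b - b ^+ 2); last by ring.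
  by rewrite bE; ring.
rewrite (_ : _ * _ = a * ((x v0 - a) * b - b ^+ 2)); last by ring.
rewrite bE (_ : a * _ = a * x v1 - x v0 * a ^+ 2 + a ^+ 3); last by ring.
by rewrite aE; ring.
Qed.

Lemma value_eq0 (k : closedFieldType) e (v : 'cV[k]_(size (monos e))) :
  (forall x, value v x = 0) -> v = 0.
Proof.
move=> val0; pose mon (t : nat * nat * nat) : 'X_{1..3} :=
  [multinom (match val l with 0 => t.1.1 | 1 => t.1.2 | _ => t.2 end)%N | l < 3].
have mon_inj : injective mon.
  move=> [[a b] c] [[a' b'] c'] E.
  by have := (congr1 (fun m : 'X_{1..3} => (m v0, m v1, m v2)) E); rewrite /= !mnmE.
have mevalE t (x : 'I_3 -> k) : ('X_[mon t] : {mpoly k[3]}).@[x] = mono t x.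
  rewrite mevalX /mono; transitivity (\prod_l x l ^+ mon t l) => //.
  rewrite !big_ord_recl big_ord0 mulr1 !mnmE /= mulrA.
  by congr (x _ ^+ _ * x _ ^+ _ * x _ ^+ _); apply: val_inj.
pose F : {mpoly k[3]} := \sum_j v j 0 *: 'X_[mon (nth_mono j)].
have [F0|/mpoly_nonroot[x]] := eqVneq F 0; last first.
  rewrite /F raddf_sum /= => /eqP[]; rewrite -[RHS](val0 x); apply: eq_bigr => j _.
  by rewrite mevalZ mevalE.
apply/matrixP => i l; rewrite (ord1 l) [RHS]mxE.
have := congr1 (mcoeff (mon (nth_mono i))) F0.
rewrite raddf_sum mcoeff0 (bigD1 i) //= mcoeffZ mcoeffX eqxx mulr1 big1 ?addr0 // => j ji.
by rewrite mcoeffZ mcoeffX (inj_eq mon_inj) (inj_eq (@nth_mono_inj e)) (negPf ji) mulr0.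
Qed.

Definition triple := (nat * nat * nat)%type.

Definition norm (i j l : nat) : triple :=
  if (i < j)%N then
    if (j < l)%N then (i, j, l) else if (i < l)%N then (i, l, j) else (l, i, j)
  else
    if (i < l)%N then (j, i, l) else if (j < l)%N then (j, l, i) else (l, j, i).

Definition triples (m : nat) : seq triple :=
  [seq T <- [seq (ij.2, ij.1, l) | l <- iota 0 m, ij <- [seq (j, i) | j <- iota 0 m, i <- iota 0 m]]
  | (T.1.1 < T.1.2 < T.2)%N].

Lemma mem_triples m i j l : ((i, j, l) \in triples m) = (i < j < l)%N && (l < m)%N.
Proof.
rewrite mem_filter /=; have [/andP[ij jl] /=|] := boolP (i < j < l)%N; last by [].
apply/idP/idP.
  case/allpairsP => -[l' [j' i']] [lm /allpairsP[[j1 i1] [jm im E]] E'].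
  by case: E' lm => _ _ ->; rewrite mem_iota.
move=> lm; apply/allpairsP; exists (l, (j, i)); split=> //; first by rewrite mem_iota.
by apply/allpairsP; exists (j, i); split=> //; rewrite mem_iota /=; lia.
Qed.

Lemma norm_triples m i j l : uniq [:: i; j; l] ->
  i \in iota 0 m -> j \in iota 0 m -> l \in iota 0 m -> norm i j l \in triples m.
Proof.
rewrite /= !inE negb_or !mem_iota /norm => uq im jm lm.
by do ![case: ltnP => ?]; rewrite mem_triples; lia.
Qed.

Lemma size_filterC1 n (s : seq nat) i : uniq s ->
  (n < size s)%N -> (n <= size [seq l <- s | l != i])%N.
Proof.
move=> us lt_n; have := rem_filter i us; have [si <-|/memPn si _] := boolP (i \in s).
  by rewrite size_rem //; case: size lt_n.
by rewrite (_ : filter _ s = s) 1?ltnW //; apply/all_filterP/allP.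
Qed.

Definition others m i j := [seq l <- [seq l <- iota 0 m | l != j] | l != i].

Lemma others_uniq m i j : uniq (others m i j).
Proof. by rewrite !filter_uniq ?iota_uniq. Qed.

Lemma others_size m n i j : (n.+1 < m)%N -> (n <= size (others m i j))%N.
Proof.
move=> lt_n; apply: size_filterC1; first by rewrite filter_uniq ?iota_uniq.
by apply: size_filterC1; rewrite ?iota_uniq ?size_iota.
Qed.

Lemma others_iota m i j : {subset others m i j <= iota 0 m}.
Proof. by move=> l; rewrite !mem_filter => /and3P[]. Qed.

Definition line_points m (ij : nat * nat) := [seq norm ij.1 ij.2 l | l <- others m ij.1 ij.2].

Definition order_at (D Z : seq triple) T : nat :=
  if T \in Z then if T \in D then 2 else 1 else 0.

(** One use of [line_vanishing] on the line (i, j). *)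
Definition saturate m e D Z ij :=
  if (e < sumn [seq order_at D Z T | T <- line_points m ij])%N
  then [seq T <- line_points m ij | T \notin Z] ++ Z else Z.

Definition sweep m e D Z :=
  foldl (saturate m e D) Z [seq (i, j) | i <- iota 0 m, j <- iota 0 i].

Fixpoint bezout_closure m e D n Z : bool :=
  all (mem Z) (triples m) || if n is n'.+1 then bezout_closure m e D n' (sweep m e D Z) else false.

Definition spans m e Z D := bezout_closure m e D m Z.

Section Arrangement.
Variables (k : closedFieldType) (m : nat) (t : nat -> k).
Hypothesis t_inj : {in iota 0 m &, injective t}.

Definition triple_point (T : triple) : 'I_3 -> k := esp (t T.1.1) (t T.1.2) (t T.2).

Lemma triple_point_norm i j l : triple_point (norm i j l) =1 esp (t i) (t j) (t l).
Proof.
rewrite /norm /triple_point => a.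
do ![case: ltnP => _] => /=; first [exact: espC | exact: espCr | exact: espA | by [] | idtac].
- by rewrite [RHS]espA.
- by rewrite [RHS]espA espCr.
Qed.

Variables (e : nat) (v : 'cV[k]_(size (monos e))).

Section Grid.
Hypothesis em : (e + 3 <= m)%N.

Let line_zero u w (s : seq nat) : uniq s -> {subset s <= iota 0 m} -> (e < size s)%N ->
  (forall i, i \in s -> value v (esp u w (t i)) = 0) ->
  forall x, value v (esp u w x) = 0.
Proof.
move=> us sm es vs; apply: (@line_vanishing _ _ v u w _ t (fun=> 1%N) s) => //.
- by move=> i j /sm im /sm jm; apply: t_inj.
- by move=> i si; right; split; [apply: vs | left].
- by rewrite sum1_size.
Qed.

(** The triple points on a line of two planes outnumber the degree e, so that the
    polynomial vanishes on these lines; then so do the lines in a plane, and then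
    the planes. *)
Lemma grid_vanishing :
  (forall T, T \in triples m -> value v (triple_point T) = 0) -> v = 0.
Proof.
move=> grid.
have zero2 i j x : i \in iota 0 m -> j \in iota 0 m -> i != j ->
    value v (esp (t i) (t j) x) = 0.
  move=> im jm ij; move: x; apply: (line_zero (others_uniq m i j) (@others_iota m i j)).
    by apply: others_size; lia.
  move=> l; rewrite !mem_filter => /and3P[li lj lm].
  rewrite -(eq_value v (triple_point_norm _ _ _)) grid // norm_triples //= !inE.
  by rewrite negb_or ij eq_sym li eq_sym lj.
have zero1 i x y : i \in iota 0 m -> value v (esp (t i) x y) = 0.
  move=> im; rewrite (eq_value v (espCr _ _ _)).
  move: x; apply: (line_zero (filter_uniq (fun l => l != i) (iota_uniq 0 m))) => [l||l].
  - by rewrite mem_filter => /andP[].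
  - by apply: size_filterC1; rewrite ?iota_uniq ?size_iota; lia.
  rewrite mem_filter => /andP[li lm].
  by rewrite (eq_value v (espCr _ _ _)) zero2 // eq_sym.
apply: value_eq0 => z; have [a [b [c /(eq_value v) ->]]] := esp_surjective z.
move: c; apply: (line_zero (iota_uniq 0 m)) => // [|l lm]; first by rewrite size_iota; lia.
by rewrite (eq_value v (espA _ _ _)) zero1.
Qed.
End Grid.

Section Closure.
Variable D : seq triple.

Lemma saturate_sound Z ij :
  (forall T, T \in Z -> value v (triple_point T) = 0) ->
  (forall T, T \in D -> forall l, partial v (triple_point T) l = 0) ->
  forall T, T \in saturate m e D Z ij -> value v (triple_point T) = 0.
Proof.
case: ij => i j Z0 D0 T; rewrite /saturate; case: ifP => [lt_e|_]; last exact: Z0.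
rewrite mem_cat mem_filter => /orP[/andP[_ /mapP[l _ ->]]|]; last exact: Z0.
rewrite (eq_value v (triple_point_norm _ _ _)).
apply: (@line_vanishing _ _ v (t i) (t j) _ t
  (fun l => order_at D Z (norm i j l)) (others m i j)).
- exact: others_uniq.
- by move=> a b /others_iota am /others_iota bm; apply: t_inj.
- move=> a am; rewrite /order_at; case: ifP => [/Z0 val0|]; last by left.
  right; split; first by rewrite -(eq_value v (triple_point_norm _ _ _)).
  case: ifP => [/D0 sing|_]; [right; split=> // b | by left].
  by rewrite -(eq_partial v b (triple_point_norm _ _ _)).
- by move: lt_e; rewrite sumnE big_map big_map.
Qed.

(** [spans m e Z D] is a certificate that a polynomial of degree at most e that
    vanishes on Z and is singular on D is zero. *)
Lemma spans_sound Z : (e + 3 <= m)%N -> spans m e Z D ->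
  (forall T, T \in Z -> value v (triple_point T) = 0) ->
  (forall T, T \in D -> forall l, partial v (triple_point T) l = 0) -> v = 0.
Proof.
move=> em spanZ Z0 D0; apply: grid_vanishing => // T Tm.
move: spanZ Z0; rewrite /spans; elim: (X in bezout_closure _ _ _ X) Z => [|n IHn] Z /=.
  by rewrite orbF => /allP/(_ T Tm)/= TZ; apply.
case/orP=> [/allP/(_ T Tm)/= TZ|/IHn-sweepZ] Z0; first exact: Z0.
apply: sweepZ; rewrite /sweep; elim: [seq _ | _ <- _, _ <- _] Z Z0 => //= ij s IHs Y Y0.
by apply: IHs => T'; apply: saturate_sound.
Qed.
End Closure.
End Arrangement.

(** * Ranks and weights at triple points *)

Lemma row_full_of_injective (k : fieldType) m n (A : 'M[k]_(m, n)) :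
  (forall v : 'cV_n, A *m v = 0 -> v = 0) -> (n <= \rank A)%N.
Proof.
move=> inj; suff: row_full A by move/eqP->.
rewrite -cokermx_eq0; apply/eqP/matrixP => i j; rewrite [RHS]mxE.
have /matrixP/(_ i 0) : col j (cokermx A) = 0; last by rewrite !mxE.
by apply: inj; rewrite colE mulmxA mulmx_coker mul0mx.
Qed.

Section PointMatrices.
Variables (k : closedFieldType) (m : nat) (t : nat -> k).
Hypothesis t_inj : {in iota 0 m &, injective t}.
Implicit Types P Q X Y : seq triple.

Definition points_of P : 'M[k]_(size P, 3) :=
  \matrix_(i, l) triple_point t (nth (0, 0, 0)%N P i) l.

Lemma points_of_row P i : points_of P i =1 triple_point t (nth (0, 0, 0)%N P i).
Proof. by move=> l; rewrite mxE. Qed.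

Lemma evmx_points_eq0 e P v : evmx e (points_of P) *m v = 0 ->
  forall T, T \in P -> value v (triple_point t T) = 0.
Proof.
move=> Pv T /(nthP (0, 0, 0)%N)[i ltiP <-].
have := congr1 (fun w : 'cV_(size P) => w (Ordinal ltiP) 0) Pv.
by rewrite evmx_value mxE (eq_value v (points_of_row (Ordinal ltiP))).
Qed.

Lemma devmx_points_eq0 e P v l : devmx e l (points_of P) *m v = 0 ->
  forall T, T \in P -> partial v (triple_point t T) l = 0.
Proof.
move=> Pv T /(nthP (0, 0, 0)%N)[i ltiP <-].
have := congr1 (fun w : 'cV_(size P) => w (Ordinal ltiP) 0) Pv.
by rewrite devmx_partial mxE (eq_partial v l (points_of_row (Ordinal ltiP))).
Qed.

Lemma col_mx_points_eq0 e P Q v : evmx e (col_mx (points_of P) (points_of Q)) *m v = 0 ->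
  forall T, T \in P ++ Q -> value v (triple_point t T) = 0.
Proof.
rewrite evmx_col mul_col_mx => /eqP; rewrite col_mx_eq0 => /andP[/eqP Pv /eqP Qv] T.
by rewrite mem_cat => /orP[]; apply: evmx_points_eq0.
Qed.

(** A polynomial in the kernel of the Jacobian vanishes on P and Q and is singular
    on Q. *)
Lemma jacobian_rank e P Q Z D : (e + 3 <= m)%N ->
  {subset Z <= P ++ Q} -> {subset D <= Q} -> spans m e Z D ->
  (size (monos e) <= \rank (jacobian e (col_mx (points_of P) (points_of Q)) (points_of Q)))%N.
Proof.
move=> em subZ subD spanZ; apply: row_full_of_injective => v /eqP.
rewrite !mul_col_mx !col_mx_eq0 => /and4P[/eqP val0 /eqP d0 /eqP d1 /eqP d2].
apply: (spans_sound t_inj em spanZ) => [T /subZ|T /subD TQ].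
  exact: (col_mx_points_eq0 val0).
by apply: ord3P; [apply: (devmx_points_eq0 d0)|apply: (devmx_points_eq0 d1)|
  apply: (devmx_points_eq0 d2)].
Qed.

(** The points of Y complete those of P and Q to a set on which a polynomial of
    degree at most e is determined by its values. *)
Lemma evaluation_rank e P Q Y : (e + 3 <= m)%N -> spans m e (P ++ Q ++ Y) [::] ->
  (size (monos e) <= \rank (evmx e (col_mx (points_of P) (points_of Q))) + size Y)%N.
Proof.
move=> em spanY; set A := evmx _ _.
have full : (size (monos e) <= \rank (col_mx A (evmx e (points_of Y))))%N.
  apply: row_full_of_injective => v /eqP; rewrite mul_col_mx col_mx_eq0 => /andP[/eqP PQ0 /eqP Y0].
  apply: (spans_sound t_inj em spanY) => // T; rewrite catA mem_cat => /orP[].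
    exact: (col_mx_points_eq0 PQ0).
  exact: evmx_points_eq0.
apply: leq_trans full _; rewrite -addsmxE.
by apply: leq_trans (mxrank_adds_leqif _ _) _; rewrite leq_add2l rank_leq_row.
Qed.

End PointMatrices.

Section Residues.
Variable k : fieldType.
Variables (I : eqType) (x : I -> k).

(** The sum of the residues of h dX / prod_i (X - x_i), which is regular at
    infinity: compare the coefficients of X^(N - 1) in Lagrange's interpolation
    formula. *)
Lemma residue_sum (s : seq I) (h : {poly k}) : uniq s -> {in s &, injective x} ->
  (size h < size s)%N ->
  \sum_(i <- s) h.[x i] / \prod_(j <- s | j != i) (x i - x j) = 0.
Proof.
move=> us x_inj lt_h.
pose N i : {poly k} := \prod_(j <- s | j != i) ('X - (x j)%:P).
pose d i := \prod_(j <- s | j != i) (x i - x j).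
have Nx i j : (N j).[x i] = \prod_(l <- s | l != j) (x i - x l).
  by rewrite horner_prod; apply: eq_bigr => l _; rewrite !hornerE.
have d0 i : i \in s -> d i != 0.
  move=> si; rewrite prodf_seq_neq0; apply/allP => j sj; apply/implyP => ji.
  by rewrite subr_eq0; apply: contraNneq ji => /x_inj ->.
have N0 i j : i \in s -> i != j -> (N j).[x i] = 0.
  move=> si ij; rewrite Nx (big_rem i) //= ij subrr mul0r //.
have sizeN i : i \in s -> size (N i) = size s.
  move=> si; rewrite /N -big_filter size_prod_XsubC -rem_filter // size_rem //.
  by rewrite prednK //; case: (s) si.
have Nmonic i : N i \is monic by apply: monic_prod => j _; apply: monicXsubC.
have hE : h = \sum_(i <- s) (h.[x i] / d i) *: N i.
  apply/eqP; rewrite -subr_eq0; apply/eqP; apply: (many_roots (mu := fun=> 1%N) us x_inj) => [i si|].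
    rewrite expr1 dvdp_XsubCl; apply/eqP; rewrite !hornerE horner_sum (bigD1_seq i) //=.
    rewrite hornerZ Nx divfK ?d0 // big1_seq ?addr0 ?subrr // => j /andP[ji sj].
    by rewrite hornerZ N0 ?mulr0 // eq_sym.
  rewrite sum1_size; apply: leq_trans (size_polyD _ _) _; rewrite geq_max ltnW // size_polyN.
  rewrite big_seq; apply: (big_ind (fun p : {poly k} => size p <= size s)%N) => [|p q sp sq|i si].
  - by rewrite size_poly0.
  - by apply: leq_trans (size_polyD _ _) _; rewrite geq_max sp.
  - by apply: leq_trans (size_scale_leq _ _) _; rewrite sizeN.
have := congr1 (fun p : {poly k} => p`_(size s).-1) hE.
rewrite nth_default; last by case: (s) lt_h.
rewrite coef_sum => E; rewrite {}[RHS]E; apply: eq_big_seq => i si.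
rewrite coefZ; suff -> : (N i)`_(size s).-1 = 1 by rewrite mulr1.
by rewrite -(sizeN i si); apply/monicP.
Qed.

End Residues.

Section AlternatingSums.
Variables (V : nmodType) (m : nat).

Definition triple_sum (F : nat -> nat -> nat -> V) :=
  \sum_(i <- iota 0 m) \sum_(j <- iota 0 m) \sum_(l <- iota 0 m) F i j l.

Lemma eq_triple_sum F G : (forall i j l, F i j l = G i j l) -> triple_sum F = triple_sum G.
Proof. by move=> FG; do 3![apply: eq_bigr => ? _]. Qed.

Lemma triple_sumD F G : triple_sum (fun i j l => F i j l + G i j l) = triple_sum F + triple_sum G.
Proof.
rewrite /triple_sum -big_split; apply: eq_bigr => i _.
by rewrite -big_split; apply: eq_bigr => j _; rewrite -big_split.
Qed.

Lemma triple_sum_swap12 F : triple_sum F = triple_sum (fun i j l => F j i l).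
Proof. exact: exchange_big. Qed.

Lemma triple_sum_swap23 F : triple_sum F = triple_sum (fun i j l => F i l j).
Proof. by apply: eq_bigr => i _; apply: exchange_big. Qed.

Lemma sum_triples (F : triple -> V) : \sum_(T <- triples m) F T =
  triple_sum (fun i j l => if (i < j < l)%N then F (i, j, l) else 0).
Proof.
rewrite /triples big_filter big_mkcond big_allpairs_dep.
rewrite triple_sum_swap12 triple_sum_swap23 triple_sum_swap12.
by apply: eq_bigr => l _; rewrite big_allpairs_dep.
Qed.

End AlternatingSums.

Section Coboundary.
Variables (R : comNzRingType) (m : nat) (g : nat -> nat -> nat -> R) (mu : nat -> nat -> nat).
Hypothesis g12 : forall i j l, g j i l = - g i j l.
Hypothesis g23 : forall i j l, g i l j = - g i j l.
Hypothesis g_diag : forall i j, g i j j = 0.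
Hypothesis g_sum : forall i j, i \in iota 0 m -> j \in iota 0 m ->
  \sum_(l <- iota 0 m) g i j l = 0.

(** The combination with coefficients mu of the relations on the lines (i, j), i < j,
    regrouped by triple points: each of them lies on three lines. *)
Lemma alternating_relation : \sum_(T <- triples m)
  ((mu T.1.1 T.1.2 + mu T.1.2 T.2)%:R - (mu T.1.1 T.2)%:R) * g T.1.1 T.1.2 T.2 = 0.
Proof.
pose A a b c (mu' : R) := if (a < b < c)%N then mu' * g a b c else 0.
have g_diag' i j : g i j i = 0 by rewrite g12 g_diag oppr0.
transitivity (triple_sum m (fun i j l =>
  if (i < j)%N then (mu i j)%:R * g i j l else 0)); last first.
  apply: big1_seq => i /andP[_ im]; apply: big1_seq => j /andP[_ jm]; case: (i < j)%N.
    by rewrite -mulr_sumr g_sum ?mulr0.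
  by rewrite big1.
transitivity (triple_sum m (fun i j l => A i j l (mu i j)%:R + (A i l j (- (mu i j)%:R)
    + A l i j (mu i j)%:R))); last first.
  apply: eq_triple_sum.
  move=> i j l; rewrite /A; have [->|ij] := eqVneq i j.
    by rewrite !ltnn andbF /= !add0r addr0 (_ : (j < l < j)%N = false) //; lia.
  have [->|il] := eqVneq i l.
    by rewrite g_diag' mulr0 !ltnn /= !if_same !addr0.
  have [->|jl] := eqVneq j l.
    by rewrite g_diag g_diag' !mulr0 !if_same !addr0.
  rewrite (g23 i j l) (_ : g l i j = g i j l); last by rewrite g12 g23 opprK.
  rewrite mulrNN; have : ((i < j < l) + (i < l < j) + (l < i < j) = (i < j))%N by lia.
  by case: (i < j < l)%N; case: (i < l < j)%N; case: (l < i < j)%N; case: (i < j)%N => //= _;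
    rewrite ?addr0 ?add0r.
rewrite !triple_sumD [X in _ + (X + _)]triple_sum_swap23 [X in _ + (_ + X)]triple_sum_swap23.
rewrite [X in _ + (_ + X)]triple_sum_swap12 -!triple_sumD sum_triples; apply: eq_triple_sum => i j l.
by rewrite /A /=; case: ifP => _; rewrite ?addr0 // natrD; ring.
Qed.

End Coboundary.

Section Weights.
Variables (k : closedFieldType) (m : nat) (t : nat -> k).
Hypothesis t_inj : {in iota 0 m &, injective t}.

(** Up to a factor that depends only on i and j, the residue at t_l of the
    differential on the line (i, j) with poles at its triple points; the factor
    makes it alternating.  It is zero on repeated indices, as the inverse of 0 is 0. *)
Definition weight i j l : k :=
  ((t i - t j) * (t j - t l) * (t i - t l) *
   \prod_(q <- iota 0 m | [&& q != i, q != j & q != l])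
     ((t i - t q) * (t j - t q) * (t l - t q)))^-1.

Lemma weight12 i j l : weight j i l = - weight i j l.
Proof.
rewrite /weight -invrN; congr (_^-1); rewrite -mulNr; congr (_ * _); first by ring.
by apply: eq_big => [q|q _]; [rewrite andbCA | ring].
Qed.

Lemma weight23 i j l : weight i l j = - weight i j l.
Proof.
rewrite /weight -invrN; congr (_^-1); rewrite -mulNr; congr (_ * _); first by ring.
by apply: eq_big => [q|q _]; [rewrite [(q != l) && _]andbC | ring].
Qed.

Lemma weight_diag i j : weight i j j = 0.
Proof. by rewrite /weight subrr mulr0 !mul0r invr0. Qed.

Lemma weight_neq0 T : T \in triples m -> weight T.1.1 T.1.2 T.2 != 0.
Proof.
case: T => -[i j] l; rewrite mem_triples /= => /andP[/andP[ij jl] lm].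
have tB a b : a \in iota 0 m -> b \in iota 0 m -> a != b -> t a - t b != 0.
  by move=> am bm ab; rewrite subr_eq0; apply: contraNneq ab => /t_inj ->.
have [im jm lm'] : [/\ i \in iota 0 m, j \in iota 0 m & l \in iota 0 m].
  by rewrite !mem_iota; split; lia.
rewrite invr_eq0 !mulf_neq0 ?tB //; try lia.
rewrite prodf_seq_neq0; apply/allP => q qm; apply/implyP => /and3P[qi qj ql].
by rewrite !mulf_neq0 ?tB // eq_sym.
Qed.

Lemma weight_sum e (v : 'cV[k]_(size (monos e))) i j : (e + 4 <= m)%N ->
  i \in iota 0 m -> j \in iota 0 m ->
  \sum_(l <- iota 0 m) weight i j l * value v (esp (t i) (t j) (t l)) = 0.
Proof.
move=> em im jm; rewrite (bigID (fun l => (l != i) && (l != j))) /=.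
rewrite [X in _ + X]big1 ?addr0 => [|l]; last first.
  rewrite negb_and !negbK => /orP[]/eqP->; rewrite ?weight_diag ?mul0r //.
  by rewrite weight12 weight_diag oppr0 mul0r.
rewrite -big_filter; have -> : [seq l <- iota 0 m | (l != i) && (l != j)] = others m i j.
  by rewrite /others -filter_predI.
set s := others m i j; pose c a := \prod_(q <- s) (t a - t q).
transitivity ((t i - t j)^-1 * (c i)^-1 * (c j)^-1 *
  \sum_(l <- s) (line_poly v (t i) (t j)).[t l] / \prod_(q <- s | q != l) (t l - t q)).
  rewrite mulr_sumr; apply: eq_big_seq => l sl.
  have cE a : c a = (t a - t l) * \prod_(q <- s | q != l) (t a - t q).
    by rewrite /c (bigD1_seq l) ?others_uniq.
  rewrite !cE line_polyE /weight.
  have -> : \prod_(q <- iota 0 m | [&& q != i, q != j & q != l])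
        ((t i - t q) * (t j - t q) * (t l - t q))
      = \prod_(q <- s | q != l) (t i - t q) * \prod_(q <- s | q != l) (t j - t q)
        * \prod_(q <- s | q != l) (t l - t q).
    rewrite -!big_split /= -[LHS]big_filter -[RHS]big_filter /s /others -!filter_predI.
    rewrite (_ : [seq q <- _ | predI _ _ q]
      = [seq q <- iota 0 m | [&& q != i, q != j & q != l]]) //.
    by apply: eq_filter => q /=; rewrite andbC andbA.
  move: (\prod_(q <- s | q != l) (t i - t q)) (\prod_(q <- s | q != l) (t j - t q)).
  move: (\prod_(q <- s | q != l) (t l - t q)) (t i - t j) (t i - t l) (t j - t l) (value _ _).
  by move=> A B C D E F G; rewrite !invfM; ring.
rewrite residue_sum ?mulr0 ?others_uniq //.
  by move=> a b /others_iota am /others_iota bm; apply: t_inj.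
by apply: leq_ltn_trans (line_poly_size _ _ _) _; apply: others_size; lia.
Qed.

End Weights.

(** * Seven arrangements of planes *)

Definition sort_mod (a b c M : nat) : seq triple -> seq triple :=
  let key T := ((a * T.1.1 + b * T.1.2 + c * T.2) %% M)%N in
  sort (fun T T' => key T <= key T')%N.

(** The m planes are given positions on a circle; mu_ij is 1 for i < j if the arc
    from i to j is longer than half of it, and 0 otherwise.  When the positions
    increase and the circumference is odd, the chosen triples are those for which
    no arc between consecutive vertices is longer than half of the circle. *)
Record arrangement := Arrangement { positions : seq nat; circumference : nat;
  ordering : seq triple -> seq triple; hilbert : seq nat }.

Section Arrangements.
Variable A : arrangement.
Local Notation m := (size (positions A)).
Local Notation s := (m - 3)%N.

Definition far i j : nat :=
  (circumference A < 2 * (nth 0 (positions A) j - nth 0 (positions A) i))%N.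

Definition is_chosen T := (far T.1.1 T.1.2 + far T.1.2 T.2 != far T.1.1 T.2)%N.

(** The order decides the splitting into two parts, one formed by the first n points.
    It is one of the few simple orders for which the parts of all the sizes needed
    satisfy [independent_split]. *)
Definition chosen : seq triple := sort_mod 7 7 7 8 [seq T <- triples m | is_chosen T].

Definition unchosen : seq triple := ordering A [seq T <- triples m | ~~ is_chosen T].

(** The first points in the given ordering, as many as are needed to complete the
    chosen points in degree d, which have rank [nth 0 (hilbert A) d]. *)
Definition complement d := take (size (monos d) - nth 0 (hilbert A) d) unchosen.

(** The weights are units, and the ranks have the symmetry required by
    [rank_link]. *)
Definition gorenstein_arrangement : bool :=
  [&& (3 < m)%N,
      all (fun T => (far T.1.1 T.1.2 + far T.1.2 T.2 == (far T.1.1 T.2).+1)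
        || ((far T.1.1 T.1.2 + far T.1.2 T.2).+1 == far T.1.1 T.2))%N chosen,
      all (fun d => (nth 0 (hilbert A) d <= size (monos d))%N &&
        spans m d (chosen ++ complement d) [::]) (iota 0 s.+1),
      all (fun d => nth 0 (hilbert A) d + nth 0 (hilbert A) (s.-1 - d) == size chosen)%N (iota 0 s) &
      nth 0 (hilbert A) s == size chosen].

(** Submersivity for the splittings into n0 and N - n0 points, n <= n0 <= n': more
    singular points only make it easier. *)
Definition independent_split n n' : bool :=
  [&& (0 < n)%N, (n' < size chosen)%N, spans m s.-1 chosen (take n chosen)
    & spans m s.-1 chosen (drop n' chosen)].

Variable k : closedFieldType.

Lemma distinct_scalars n : exists t : nat -> k, {in iota 0 n &, injective t}.
Proof.
suff [ts us sz] : exists2 ts : seq k, uniq ts & size ts = n.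
  exists (nth 0 ts) => i j; rewrite !mem_iota /= -sz => im jm /eqP.
  by rewrite nth_uniq // => /eqP.
elim: n => [|n [ts us sz]]; first by exists [::].
have /closed_nonrootP[x] : \prod_(y <- ts) ('X - y%:P) != 0.
  by rewrite monic_neq0 // monic_prod_XsubC.
by rewrite root_prod_XsubC => xts; exists (x :: ts); rewrite /= ?xts ?sz.
Qed.

Section Relation.
Variable t : nat -> k.
Hypothesis t_inj : {in iota 0 m &, injective t}.
Hypothesis good : gorenstein_arrangement.

Definition point_weight T : k :=
  ((far T.1.1 T.1.2 + far T.1.2 T.2)%:R - (far T.1.1 T.2)%:R) * weight m t T.1.1 T.1.2 T.2.

Lemma mem_chosen T : (T \in chosen) = is_chosen T && (T \in triples m).
Proof. by rewrite mem_sort mem_filter. Qed.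

Lemma point_weight_neq0 T : T \in chosen -> point_weight T != 0.
Proof.
move=> TX; have [_ /allP/(_ T TX) sgn _ _ _] := and5P good.
rewrite mulf_neq0 //; last by apply: weight_neq0 t_inj _ _; move: TX; rewrite mem_chosen => /andP[].
case/orP: sgn => /eqP; first by move->; rewrite -addn1 natrD addrAC subrr add0r oner_neq0.
by move<-; rewrite -addn1 [X in _ - X]natrD opprD addNKr oppr_eq0 oner_neq0.
Qed.

Lemma point_weight_sum e (v : 'cV[k]_(size (monos e))) : (e + 4 <= m)%N ->
  \sum_(T <- chosen) point_weight T * value v (triple_point t T) = 0.
Proof.
move=> em; rewrite (perm_big [seq T <- triples m | is_chosen T]) /=; last first.
  by apply/permPl/perm_sort.
pose g i j l := weight m t i j l * value v (esp (t i) (t j) (t l)).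
rewrite -[RHS](@alternating_relation k m g far).
- rewrite big_filter [RHS](bigID is_chosen) /= [X in _ + X]big1 ?addr0 => [|T].
    by apply: eq_bigr => T _; rewrite /point_weight mulrA.
  by rewrite negbK => /eqP->; rewrite subrr mul0r.
- by move=> i j l; rewrite /g weight12 (eq_value v (espC _ _ _)) mulNr.
- by move=> i j l; rewrite /g weight23 (eq_value v (espCr _ _ _)) mulNr.
- by move=> i j; rewrite /g weight_diag mul0r.
- by move=> i j im jm; apply: (weight_sum t_inj).
Qed.

End Relation.

Lemma arrangement_link a b n n' : gorenstein_arrangement -> independent_split a b ->
  (a <= n <= b)%N -> (n + n')%N = size chosen ->
  generically_glicci k n' -> generically_glicci k n.
Proof.
move=> good /and4P[a_gt0 lt_b spanP spanQ] /andP[an nb] nn'.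
have [m_gt3 _ /allP rkX /allP sumX /eqP rkT] := and5P good.
have [t t_inj] := distinct_scalars m.
pose P := take n chosen; pose Q := drop n chosen.
have PQ : P ++ Q = chosen by apply: cat_take_drop.
have sizeP : size P = n by rewrite size_take; case: ltngtP; lia.
have sizeQ : size Q = n' by rewrite size_drop; lia.
rewrite -sizeP -sizeQ; have s_lt : (s.-1 + 4 <= m)%N by lia.
pose w (Y : seq triple) : 'rV[k]_(size Y) := \row_i point_weight t (nth (0, 0, 0)%N Y i).
have w_neq0 Y i : {subset Y <= chosen} -> w Y 0 i != 0.
  by move=> sub; rewrite mxE point_weight_neq0 // sub // mem_nth.
have subP : {subset P <= chosen} by move=> T /mem_take.
have subQ : {subset Q <= chosen} by move=> T /mem_drop.
have wE Y e j : (w Y *m evmx e (points_of t Y)) 0 j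
    = \sum_(T <- Y) point_weight t T * mono (nth_mono j) (triple_point t T).
  rewrite mxE (big_nth (0, 0, 0)%N) big_mkord; apply: eq_bigr => i _; rewrite !mxE.
  by congr (_ * _); apply: mono_eq; apply: points_of_row.
apply: (@link_step k _ _ s (nth 0%N (hilbert A)) (points_of t P) (points_of t Q)
  (row_mx (w P) (w Q))).
- by rewrite sizeP; lia.
- by rewrite sizeQ; lia.
- by lia.
- by move=> i; rewrite -[i]splitK; case: (split i) => j /=; rewrite ?row_mxEl ?row_mxEr w_neq0.
- rewrite evmx_col mul_row_col; apply/matrixP => i j; rewrite (ord1 i) [RHS]mxE mxE !wE -big_cat PQ.
  rewrite -[RHS](point_weight_sum t_inj (delta_mx j 0) s_lt); apply: eq_bigr => T _.
  congr (_ * _); rewrite /value (bigD1 j) //= mxE !eqxx mul1r big1 ?addr0 // => l lj.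
  by rewrite mxE (negPf lj) mul0r.
- move=> d ds; have /rkX/andP[le_r] : d \in iota 0 s.+1 by rewrite mem_iota.
  have dm : (d + 3 <= m)%N by lia.
  rewrite -PQ -catA => /(evaluation_rank t_inj dm) rk.
  have : (size (complement d) <= size (monos d) - nth 0%N (hilbert A) d)%N.
    by rewrite size_take_min geq_minl.
  rewrite -(leq_add2l (\rank (evmx d (col_mx (points_of t P) (points_of t Q))))).
  by move=> /(leq_trans rk); lia.
- by move=> d ds; rewrite sizeP sizeQ nn'; apply/eqP/sumX; rewrite mem_iota.
- by rewrite sizeP sizeQ nn'.
- apply: (jacobian_rank t_inj _ _ _ spanQ); first by lia.
    by move=> T; rewrite PQ.
  move=> T; rewrite /Q -(subnK nb) -drop_drop; exact: mem_drop.
- apply: (jacobian_rank t_inj _ _ _ spanP); first by lia.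
    by move=> T; rewrite -PQ !mem_cat orbC.
  by move=> T; rewrite /P -{1}(minn_idPl an) take_min; exact: mem_take.
Qed.

End Arrangements.

(** The number N of points, the arrangement, and the least and greatest sizes of the
    part to be linked to its complement.  The orderings were found by a search. *)
Definition configurations : seq (nat * arrangement * (nat * nat)) := [::
 (3, Arrangement [:: 0; 1; 2; 2; 2] 3 (sort_mod 6 1 4 10) [:: 1; 2; 3], (2, 2));
 (5, Arrangement [:: 0; 1; 2; 3; 4] 5 (sort_mod 6 1 4 10) [:: 1; 4; 5], (3, 4));
 (8, Arrangement [:: 0; 0; 1; 1; 2; 2] 3 (sort_mod 6 1 4 10) [:: 1; 4; 7; 8], (5, 7));
 (14, Arrangement [:: 0; 1; 2; 3; 4; 5; 6] 7 (sort_mod 6 1 4 10) [:: 1; 4; 10; 13; 14],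
   (8, 11));
 (20, Arrangement [:: 0; 0; 1; 2; 3; 4; 5; 6] 7 (sort_mod 6 1 4 10)
   [:: 1; 4; 10; 16; 19; 20], (12, 13));
 (27, Arrangement [:: 0; 0; 0; 1; 1; 1; 2; 2; 2] 3 (sort_mod 6 2 3 10)
   [:: 1; 4; 10; 17; 23; 26; 27], (14, 15));
 (30, Arrangement [:: 0; 1; 2; 3; 4; 5; 6; 7; 8] 9 (sort_mod 0 3 7 10)
   [:: 1; 4; 10; 20; 26; 29; 30], (16, 19))]%N.

Definition valid (c : nat * arrangement * (nat * nat)) : bool :=
  [&& size (chosen c.1.2) == c.1.1, gorenstein_arrangement c.1.2
    & independent_split c.1.2 c.2.1 c.2.2].

Lemma configurations_valid : all valid configurations.
Proof. by vm_compute. Qed.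

Lemma configuration_link (k : closedFieldType) i n :
  let c := nth (0, Arrangement [::] 0 id [::], (0, 0))%N configurations i in
  (i < size configurations)%N -> (c.2.1 <= n <= c.2.2)%N ->
  generically_glicci k (c.1.1 - n) -> generically_glicci k n.
Proof.
move=> c ltc; have /and3P[/eqP sizeX good split] : valid c.
  exact: (elimT (all_nthP _) configurations_valid).
move=> /[dup] an /(arrangement_link good split); apply.
rewrite subnKC // -sizeX; case/and4P: split => _ lt_b _ _.
by case/andP: an => _ /leq_trans; apply; apply: ltnW.
Qed.

Lemma generically_glicci_small (k : closedFieldType) n :
  (1 <= n <= 19)%N -> generically_glicci k n.
Proof.
have step := @configuration_link k.
have g1 := generically_glicci1 k.
have g2 := step 0 2 isT isT g1.
have g4 := step 1 4 isT isT g1.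
have g3 := step 1 3 isT isT g2.
have g7 := step 2 7 isT isT g1.
have g6 := step 2 6 isT isT g2.
have g5 := step 2 5 isT isT g3.
have g8 := step 3 8 isT isT g6.
have g9 := step 3 9 isT isT g5.
have g10 := step 3 10 isT isT g4.
have g11 := step 3 11 isT isT g3.
have g12 := step 4 12 isT isT g8.
have g13 := step 4 13 isT isT g7.
have g14 := step 5 14 isT isT g13.
have g15 := step 5 15 isT isT g12.
have g16 := step 6 16 isT isT g14.
have g17 := step 6 17 isT isT g13.
have g18 := step 6 18 isT isT g12.
have g19 := step 6 19 isT isT g11.
by do 20![case: n => [|n] //].
Qed.

(** * Open families of sets of points *)

Lemma prod_mxvec (R : comNzRingType) n a (f : 'I_(n * a) -> R) :
  \prod_v f v = \prod_i \prod_j f (mxvec_index i j).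
Proof.
by rewrite pair_bigA (reindex _ (curry_mxvec_bij _ _)); apply: eq_bigr => -[].
Qed.

Lemma leq_block_mdeg n a (mm : 'X_{1..n * a}) i :
  (\sum_(j < a) mm (mxvec_index i j) <= mdeg mm)%N.
Proof.
have -> : mdeg mm = (\sum_i \sum_(j < a) mm (mxvec_index i j))%N.
  rewrite mdegE pair_bigA (reindex _ (curry_mxvec_bij _ _)).
  by apply: eq_bigr => -[].
by rewrite (bigD1 i) //= leq_addr.
Qed.

Section Multihomogenization.
Variables (k : closedFieldType) (n m : nat).

Definition affine_part (p : 'M[k]_(n, m.+1)) : 'M[k]_(n, m) :=
  \matrix_(i, l) (p i (lift ord0 l) / p i ord0).

Lemma affine_part_perm s p : affine_part (row_perm s p) = row_perm s (affine_part p).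
Proof. by apply/matrixP => i l; rewrite !mxE. Qed.

Variables (H : {mpoly k[n * m]}) (D : nat).
Hypothesis lt_D : (msize H <= D)%N.

Definition block_degree (mm : 'X_{1..n * m}) i := (\sum_l mm (mxvec_index i l))%N.

(** In each block of coordinates the monomial is completed to degree D by a power of
    the coordinate 0, positive because D exceeds the degree of H. *)
Definition multi_monomial (mm : 'X_{1..n * m}) : 'X_{1..n * m.+1} :=
  [multinom mxvec (\matrix_(i, j) if unlift ord0 j is Some l then mm (mxvec_index i l)
                                  else (D - block_degree mm i)%N) 0%R v | v < _].

Lemma multi_monomial0 mm i :
  multi_monomial mm (mxvec_index i ord0) = (D - block_degree mm i)%N.
Proof. by rewrite mnmE mxvecE mxE unlift_none. Qed.

Lemma multi_monomialS mm i l :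
  multi_monomial mm (mxvec_index i (lift ord0 l)) = mm (mxvec_index i l).
Proof. by rewrite mnmE mxvecE mxE liftK. Qed.

Definition multi_poly : {mpoly k[n * m.+1]} :=
  \sum_(mm <- msupp H) H@_mm *: 'X_[multi_monomial mm].

Lemma block_degree_lt mm i : mm \in msupp H -> (block_degree mm i < D)%N.
Proof.
by move=> /msize_mdeg_lt lt; apply: leq_ltn_trans (leq_block_mdeg _ _) (leq_trans lt lt_D).
Qed.

Lemma multi_poly_homogeneous : multihomogeneous multi_poly.
Proof.
exists (fun=> D) => mm; rewrite mcoeff_msupp raddf_sum /= => mm0 i.
have [mm' Hmm' ->] : exists2 mm', mm' \in msupp H & mm = multi_monomial mm'.
  apply: contrapT => no; move: mm0; rewrite big1_seq ?eqxx // => mm' /andP[_ Hmm'].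
  rewrite mcoeffZ mcoeffX; case: eqP => [E|_]; rewrite ?mulr0 //.
  by case: no; exists mm'.
rewrite big_ord_recl multi_monomial0; under eq_bigr do rewrite multi_monomialS.
by rewrite subnK // ltnW // block_degree_lt.
Qed.

Lemma multi_poly_eval (p : 'M[k]_(n, m.+1)) : (forall i, p i ord0 != 0) ->
  multi_poly.@[mxvec p 0] = (\prod_i p i ord0) ^+ D * H.@[mxvec (affine_part p) 0].
Proof.
move=> p0; rewrite /multi_poly raddf_sum /= [H.@[_]]mevalE mulr_sumr.
apply: eq_big_seq => mm Hmm; rewrite mevalZ mevalX mulrCA; congr (_ * _).
rewrite !prod_mxvec -prodrXl -big_split; apply: eq_bigr => i _ /=.
rewrite big_ord_recl mxvecE multi_monomial0.
rewrite [X in _ = _ * X](eq_bigr (fun l => p i (lift ord0 l) ^+ mm (mxvec_index i l)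
    * (p i ord0)^-1 ^+ mm (mxvec_index i l))); last by move=> l _; rewrite mxvecE mxE exprMn.
rewrite big_split /= prodrXr -/(block_degree mm i) mulrCA mulrC.
congr (_ * _); last by rewrite exprVn -expfB_cond // (negPf (p0 i)) add0n ltnW // block_degree_lt.
by apply: eq_bigr => l _; rewrite mxvecE multi_monomialS.
Qed.

Lemma multi_poly_neq0 (p : 'M[k]_(n, m.+1)) : multi_poly.@[mxvec p 0] != 0 <->
  (forall i, p i ord0 != 0) /\ H.@[mxvec (affine_part p) 0] != 0.
Proof.
split=> [F0|[p0 Hp]]; last first.
  by rewrite multi_poly_eval // mulf_neq0 // expf_neq0 //; apply/prodf_neq0.
have p0 i : p i ord0 != 0.
  apply: contraNneq F0 => pi0; rewrite /multi_poly raddf_sum /= big1_seq // => mm /andP[_ Hmm].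
  rewrite mevalZ mevalX prod_mxvec (bigD1 i) //= (bigD1 ord0) //= mxvecE pi0.
  rewrite multi_monomial0 expr0n subn_eq0 leqNgt block_degree_lt //=.
  by rewrite !mul0r mulr0.
by split=> //; move: F0; rewrite multi_poly_eval // mulf_eq0 => /norP[].
Qed.

End Multihomogenization.

(** The families are closed under permutations of the points, whereas H is not. *)
Lemma permute_points (k : closedFieldType) n m (H : {mpoly k[n * m]}) (s : 'S_n) :
  exists Hs : {mpoly k[n * m]}, forall p : 'M[k]_(n, m),
    Hs.@[mxvec p 0] = H.@[mxvec (row_perm s p) 0].
Proof.
pose G : 'M[{mpoly k[n * m]}]_(n, m) := \matrix_(i, l) 'X_(mxvec_index i l).
exists (H \mPo [tuple mxvec (row_perm s G) 0 v | v < n * m]) => p.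
rewrite comp_mpoly_meval; apply: meval_eq => v; rewrite tnth_mktuple.
by case/mxvec_indexP: v => i l; rewrite !mxvecE !mxE mevalXU mxvecE.
Qed.

Section General.
Variable k : closedFieldType.

Lemma row_of_row_perm a b (p : 'M[k]_(a, b)) (s : 'S_a) i : row i (row_perm s p) = row (s i) p.
Proof. by apply/rowP => j; rewrite !mxE. Qed.

Lemma eq_points_ideal n (p q : 'M[k]_(n, 4)) (s : 'S_n) (c : 'I_n -> k) :
  (forall i, c i != 0) -> (forall i j, q i j = c i * p (s i) j) ->
  points_ideal q = points_ideal p.
Proof.
move=> c0 qE; apply/funext => f; apply/propext.
have scale d i : (pihomog (@mdeg 4) d f).@[fun j => q i j]
    = c i ^+ d * (pihomog (@mdeg 4) d f).@[fun j => p (s i) j].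
  have fd : homogeneous d (pihomog (@mdeg 4) d f) by apply: pihomogP.
  rewrite !mevalE mulr_sumr; apply: eq_big_seq => mm fmm; rewrite mulrCA; congr (_ * _).
  have dE : mdeg mm = d := dhomog_mf fd fmm.
  rewrite -dE mdegE -prodrXr -big_split; apply: eq_bigr => j _.
  by rewrite qE exprMn.
split=> f0 d i; last by rewrite scale f0 mulr0.
have := f0 d (s^-1 i)%g; rewrite scale permKV => /eqP.
by rewrite mulf_eq0 expf_eq0 (negPf (c0 _)) andbF => /eqP.
Qed.

Lemma general_points_glicci n : generically_glicci k n -> general_points n (@glicci k 3).
Proof.
move=> [H H0 Hgood].
pose good (p : 'M[k]_(n, 4)) s :=
  (forall i, p i ord0 != 0) /\ H.@[mxvec (row_perm s (affine_part p)) 0] != 0.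
pose Phi (F : {mpoly k[n * 4]}) := multihomogeneous F /\
  exists s, forall p, F.@[mxvec p 0] != 0 <-> good p s.
have PhiE p s : good p s -> exists2 F, Phi F & F.@[mxvec p 0] != 0.
  have [Hs HsE] := permute_points H s.
  have Fs q : (multi_poly Hs (msize Hs)).@[mxvec q 0] != 0 <-> good q s.
    by rewrite multi_poly_neq0 // HsE.
  move=> gp; exists (multi_poly Hs (msize Hs)); last exact/Fs.
  by split; [apply: multi_poly_homogeneous | exists s].
exists (fun p => distinct_points p /\ exists2 F, Phi F & F.@[mxvec p 0] != 0); split.
- split=> [|p s [[p0 p_inj] [F [_ [u FE]] /FE[px0 Hp]]]].
    by exists Phi; split=> // F [].
  split; first split=> [i|i j ij c].
  + by rewrite row_of_row_perm.
  + by rewrite !row_of_row_perm; apply: p_inj; rewrite (inj_eq perm_inj).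
  apply: (PhiE _ (u * s^-1)%g); split=> [i|]; first by rewrite mxE.
  by rewrite affine_part_perm -row_permM mulgKV.
- have [q Hq] : exists q : 'M[k]_(n, 3), H.@[mxvec q 0] != 0.
    have [u Hu] := mpoly_nonroot H0; exists (vec_mx (\row_v u v)).
    by rewrite vec_mxK; apply: contra_neq Hu => <-; apply: meval_eq => v; rewrite mxE.
  have [q_inj _] := Hgood _ Hq.
  exists (projective q); split.
    split=> [i|i j ij c].
      by apply/eqP => /rowP/(_ ord0); rewrite !mxE unlift_none => /eqP; rewrite oner_eq0.
    apply/eqP => /rowP E; move: (E ord0); rewrite !mxE unlift_none mulr1 => c1.
    by case/eqP: ij; apply: q_inj => l; have := E (lift ord0 l); rewrite !mxE liftK -c1 mul1r.
  apply: (PhiE _ 1%g); split=> [i|]; first by rewrite projective0 oner_neq0.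
  rewrite row_perm1 (_ : affine_part _ = q) //.
  by apply/matrixP => i l; rewrite mxE projective0 projectiveS divr1.
- move=> p [_ [F [_ [s FE]] /FE[p0 /Hgood[_ [C CIC link]]]]].
  exists 0%N, C; split=> //; move: link.
  rewrite (@eq_points_ideal _ p _ s (fun i => (p (s i) ord0)^-1)) //.
    by move=> i; rewrite invr_eq0.
  move=> i j; rewrite mxE; case: unliftP => [l|] ->; first by rewrite !mxE mulrC.
  by rewrite mulVf.
Qed.

End General.

Theorem corollary2p6 (k : closedFieldType) (n : nat) (hn : (1 <= n <= 19)%N) :
  general_points n (@glicci k 3).
Proof. exact/general_points_glicci/generically_glicci_small. Qed.
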